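(* Let $R$ be an associative unital algebra over $\mathbb C$ and let $L(z)$ be an $n\times n$ Lax matrix of $gl_n$-Gaudin type over $R$. Let the quantum Hamiltonians $QH_i(z)$ be defined by $$\det{}^{column}(\partial_z-L(z))=\sum_{i=0}^{n}QH_i(z)\,\partial_z^i ,$$ and let the quantum powers $L^{[i]}(z)$ be defined inductively by $L^{[0]}(z)=\mathrm{Id}$, $L^{[i]}(z)=L^{[i-1]}(z)L(z)+\partial_z\bigl(L^{[i-1]}(z)\bigr)$ (where the last term is the derivative in $z$ of $L^{[i-1]}(z)$). Then for all $k,l=1,\dots,n$ and all $u,v\in\mathbb C$ $$[QH_k(u),\mathrm{Tr}\,L^{[l]}(v)]=0,\qquad [\mathrm{Tr}\,L^{[k]}(u),\mathrm{Tr}\,L^{[l]}(v)]=0 .$$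
   Context: An $n\times n$ matrix $L(z)$ with entries in $R((z))$ (or in $R((z^{-1}))$, or rational in $z$) is called a Lax matrix of $gl_n$-Gaudin type if $$[L_{ij}(u),L_{kl}(v)]=\frac{1}{u-v}\bigl(L_{il}(v)\delta_{jk}-L_{il}(u)\delta_{jk}-L_{kj}(v)\delta_{li}+L_{kj}(u)\delta_{li}\bigr)$$ for all $i,j,k,l$. Here $\partial_z-L(z)$ means $\partial_z\,\mathrm{Id}-L(z)$, with $\partial_z$ commuting with $R$ and $[\partial_z,f(z)]=f'(z)$. The column determinant is $\det^{column}N=\sum_{\sigma\in S_n}(-1)^\sigma N_{\sigma(1),1}N_{\sigma(2),2}\cdots N_{\sigma(n),n}$. When $L(z)$ is a formal series, the commutation of values at $u$ and $v$ is understood with $u,v$ independent formal variables, i.e. all coefficients of the generating series commute. *)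

(* Defs.v *)
From HB Require Import structures.
From mathcomp Require Import all_boot all_order all_algebra all_fingroup.
From mathcomp Require Import generic_quotient zify ring.
From mathcomp Require Import boolp classical_sets functions fsbigop.
From mathcomp Require Export reals complex.

Set Implicit Arguments.
Unset Strict Implicit.
Unset Printing Implicit Defensive.

Import GRing.Theory.

Local Open Scope ring_scope.
Local Open Scope quotient_scope.

HB.mixin Record NzRing_hasDerivation A of GRing.NzRing A := {
  der : A -> A;
  derD : {morph der : f g / f + g};
  derM : forall f g, der (f * g) = der f * g + f * der g
}.

#[short(type="diffRingType")]
HB.structure Definition DiffRing :=
  {A of GRing.NzRing A & NzRing_hasDerivation A}.

(* Differential operators \sum_i a_i d^i over A, with d f = f d + f'. The
   coefficient a_i (written on the left of d^i) is the i-th coefficient of the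
   underlying polynomial; only the product differs from that of {poly A}. *)
Definition diffop (A : diffRingType) : Type := {poly A}.

Section DiffOp.
Variable A : diffRingType.

HB.instance Definition _ := GRing.Zmodule.on (diffop A).

Lemma der0 : der (0 : A) = 0.
Proof. by apply: (addrI (der 0)); rewrite -derD !addr0. Qed.

Lemma derN (f : A) : der (- f) = - der f.
Proof. by apply: (addrI (der f)); rewrite -derD !subrr der0. Qed.

Lemma der1 : der (1 : A) = 0.
Proof.
by apply: (addrI (der 1)); rewrite addr0 -{3}(mulr1 1) derM mul1r mulr1.
Qed.

(* the product d * q *)
Definition ddmul (q : {poly A}) : {poly A} := q * 'X + map_poly der q.

Definition dopmul (p q : diffop A) : diffop A :=
  \sum_(i < size (p : {poly A})) (p : {poly A})`_i *: iter i ddmul q.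

Lemma coef_map_der (p : {poly A}) i : (map_poly der p)`_i = der p`_i.
Proof. by rewrite coef_map_id0 ?der0. Qed.

Lemma ddmulD p q : ddmul (p + q) = ddmul p + ddmul q.
Proof.
rewrite /ddmul mulrDl addrACA; congr (_ + _); apply/polyP => i.
by rewrite coefD !coef_map_der coefD derD.
Qed.

Lemma ddmul0 : ddmul 0 = 0.
Proof. by rewrite /ddmul mul0r add0r map_poly0. Qed.

Lemma ddmulZ (a : A) p : ddmul (a *: p) = der a *: p + a *: ddmul p.
Proof.
rewrite /ddmul scalerDr -scalerAl addrCA; congr (_ + _).
by apply/polyP => i; rewrite coefD !coefZ !coef_map_der coefZ derM.
Qed.

Lemma ddmul_sum (I : Type) (r : seq I) (F : I -> {poly A}) :
  ddmul (\sum_(i <- r) F i) = \sum_(i <- r) ddmul (F i).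
Proof.
by elim/big_rec2: _ => [|i x y _ <-]; rewrite (ddmul0, ddmulD).
Qed.

Lemma iter_ddmulD i p q : iter i ddmul (p + q) = iter i ddmul p + iter i ddmul q.
Proof. by elim: i => //= i ->; rewrite ddmulD. Qed.

Lemma dopmulE n (p q : {poly A}) : (size p <= n)%N ->
  dopmul p q = \sum_(i < n) p`_i *: iter i ddmul q.
Proof.
move=> le_pn; rewrite /dopmul (big_ord_widen n (fun i => p`_i *: iter i ddmul q) le_pn).
rewrite big_mkcond; apply: eq_bigr => i _; case: ltnP => // le_pi.
by rewrite nth_default // scale0r.
Qed.

Lemma dopmulDl : left_distributive dopmul +%R.
Proof.
move=> p q r; pose n := maxn (size (p : {poly A})) (size (q : {poly A})).
rewrite !(@dopmulE n) ?leq_maxl ?leq_maxr ?size_polyD // -big_split.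
by apply: eq_bigr => i _; rewrite coefD scalerDl.
Qed.

Lemma dopmulDr : right_distributive dopmul +%R.
Proof.
move=> p q r; rewrite /dopmul -big_split.
by apply: eq_bigr => i _; rewrite iter_ddmulD scalerDr.
Qed.

Lemma dopmulZl (a : A) (p q : {poly A}) : dopmul (a *: p) q = a *: dopmul p q.
Proof.
rewrite (@dopmulE (size p)) ?size_scale_leq // /dopmul scaler_sumr.
by apply: eq_bigr => i _; rewrite coefZ scalerA.
Qed.

Lemma dopmul0l (q : {poly A}) : dopmul 0 q = 0.
Proof. by rewrite /dopmul size_poly0 big_ord0. Qed.

Lemma dopmul_suml (I : Type) (r : seq I) (F : I -> {poly A}) q :
  dopmul (\sum_(i <- r) F i) q = \sum_(i <- r) dopmul (F i) q.
Proof.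
by elim/big_rec2: _ => [|i x y _ <-]; rewrite (dopmul0l, dopmulDl).
Qed.

Lemma dopmul_ddmul p q : dopmul (ddmul p) q = ddmul (dopmul p q).
Proof.
rewrite {1}/ddmul dopmulDl (@dopmulE (size p).+1 (p * 'X)); last first.
  by rewrite (leq_trans (size_polyMleq _ _)) // size_polyX addn2.
rewrite (@dopmulE (size p) (map_poly _ _)) ?size_poly //.
rewrite big_ord_recl coefMX scale0r add0r -big_split /dopmul ddmul_sum.
apply: eq_bigr => i _; rewrite /= coefMX /= coef_map_der.
by rewrite ddmulZ addrC.
Qed.

Lemma dopmulA : associative dopmul.
Proof.
move=> p q r; rewrite {1 4}/dopmul dopmul_suml; apply: eq_bigr => i _.
rewrite dopmulZl; congr (_ *: _).
by elim: (i : nat) => //= k IHk; rewrite dopmul_ddmul IHk.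
Qed.

Lemma dopmulCl (a : A) (q : {poly A}) : dopmul a%:P q = a *: q.
Proof. by rewrite (@dopmulE 1) ?size_polyC_leq1 // big_ord1 coefC. Qed.

Lemma dopmul1l : left_id (1%:P : diffop A) dopmul.
Proof. by move=> q; rewrite dopmulCl scale1r. Qed.

Lemma iter_ddmul1 i : iter i ddmul 1 = 'X^i.
Proof.
elim: i => [|i /= ->]; first by rewrite expr0.
rewrite /ddmul -exprSr; apply/polyP => j.
rewrite coefD coef_map_der !coefXn !mulrb (fun_if (@der A)) der1 der0 if_same.
by rewrite addr0.
Qed.

Lemma dopmul1r : right_id (1%:P : diffop A) dopmul.
Proof.
move=> p; rewrite /dopmul -[RHS]coefK poly_def.
by apply: eq_bigr => i _; rewrite iter_ddmul1.
Qed.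

Lemma dopone_neq0 : (1%:P : diffop A) != 0.
Proof. by rewrite polyC_eq0 oner_neq0. Qed.

HB.instance Definition _ := GRing.Zmodule_isNzRing.Build (diffop A)
  dopmulA dopmul1l dopmul1r dopmulDl dopmulDr dopone_neq0.

Definition dopC (f : A) : diffop A := f%:P.
Definition ddz : diffop A := 'X.
Definition dopcoef (p : diffop A) (i : nat) : A := (p : {poly A})`_i.

Lemma ddz_dopC (f : A) : ddz * dopC f = dopC f * ddz + dopC (der f).
Proof.
rewrite /GRing.mul /= dopmulCl /dopC /ddz -mul_polyC.
rewrite (@dopmulE 2) ?size_polyX // !big_ord_recl big_ord0 !coefX /=.
rewrite scale0r add0r scale1r addr0 /ddmul; congr (_ + _).
apply/polyP => i; rewrite coef_map_der !coefC.
by case: (i == 0%N); rewrite ?der0.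
Qed.

Lemma dopC_ddzX (f : A) i : dopC f * ddz ^+ i = (f *: 'X^i : {poly A}).
Proof.
rewrite /GRing.mul /= dopmulCl; congr (_ *: _).
elim: i => [|i IHi]; first by rewrite !expr0.
rewrite exprS /GRing.mul /= IHi (@dopmulE 2) ?size_polyX //.
rewrite !big_ord_recl big_ord0 !coefX /= scale0r add0r scale1r addr0.
by rewrite /= -[in LHS]iter_ddmul1 -[ddmul _]iterS iter_ddmul1.
Qed.

Lemma dopE m (p : diffop A) : (size (p : {poly A}) <= m)%N ->
  p = \sum_(i < m) dopC (dopcoef p i) * ddz ^+ i.
Proof.
move=> le_pm; under eq_bigr do rewrite dopC_ddzX.
rewrite -(poly_def m (fun i => (p : {poly A})`_i)); apply/polyP => i.
by rewrite coef_poly; case: ltnP => // le_mi; rewrite nth_default // (leq_trans le_pm).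
Qed.

Lemma size_iter_ddmul i (p : {poly A}) :
  (size (iter i ddmul p) <= size p + i)%N.
Proof.
elim: i => [|i IHi] /=; first by rewrite addn0.
rewrite (leq_trans (size_polyD _ _)) // geq_max.
rewrite (leq_trans (size_polyMleq _ _)) ?size_polyX ?addn2 /= ?addnS ?ltnS //.
by rewrite (leq_trans (size_poly _ _)) // leqW.
Qed.

Lemma size_dopmul (p q : diffop A) m k :
  (size (p : {poly A}) <= m.+1)%N -> (size (q : {poly A}) <= k.+1)%N ->
  (size ((p * q)%R : {poly A}) <= (m + k).+1)%N.
Proof.
move=> le_pm le_qk; rewrite [p * q](@dopmulE m.+1 p q le_pm).
rewrite (leq_trans (size_sum _ _ _)) //; apply/bigmax_leqP => i _.
rewrite (leq_trans (size_scale_leq _ _)) // (leq_trans (size_iter_ddmul _ _)) //.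
by have := ltn_ord i; lia.
Qed.

End DiffOp.

Definition det_column (B : nzRingType) (n : nat) (N : 'M[B]_n) : B :=
  \sum_(s : 'S_n) (-1) ^+ s * \prod_(j < n) N (s j) j.

Section Quantum.
Variables (A : diffRingType) (n : nat).
Implicit Type L : 'M[A]_n.

Definition ddz_sub L : 'M[diffop A]_n := (ddz A)%:M - map_mx (@dopC A) L.

Definition QH L (i : nat) : A := dopcoef (det_column (ddz_sub L)) i.

Fixpoint qpow L (i : nat) : 'M[A]_n :=
  if i is j.+1 then qpow L j *m L + map_mx der (qpow L j) else 1%:M.

Lemma det_column_QH L :
  det_column (ddz_sub L) = \sum_(i < n.+1) dopC (QH L i) * ddz A ^+ i.
Proof.
apply: dopE; rewrite (leq_trans (size_sum _ _ _)) //.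
apply/bigmax_leqP => s _.
have -> : forall p : diffop A, (-1) ^+ s * p = if s then - p else p.
  by move=> p; case: (s : bool); rewrite ?mulN1r ?mul1r.
suff szp r : (size ((\prod_(j <- r) ddz_sub L (s j) j)%R : {poly A})
              <= (size r).+1)%N.
  have := szp (index_enum 'I_n); rewrite /index_enum -enumT size_enum_ord.
  by case: (s : bool); rewrite ?size_polyN.
elim: r => [|j r IHr]; first by rewrite big_nil size_polyC oner_neq0.
rewrite big_cons -[(size _).+1]/((1 + size r).+1); apply: size_dopmul => //.
rewrite !mxE (leq_trans (size_polyD _ _)) // geq_max size_polyN.
rewrite (leq_trans (size_polyC_leq1 _)) // andbT.
by case: (_ == _); rewrite ?mulr1n ?mulr0n ?size_polyX ?size_poly0.
Qed.

End Quantum.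

Variant expansion := at_zero | at_infinity.

Definition bounded (e : expansion) (N m : int) : Prop :=
  match e with at_zero => (N <= m)%R | at_infinity => (m <= N)%R end.

Section Laurent.
Variables (e : expansion) (R : nzRingType).

Definition laurent_supp : {pred int -> R} :=
  fun f => `[< exists N : int, forall m, f m != 0 -> bounded e N m >].

(* R((z)) for e = at_zero, R((z^-1)) for e = at_infinity; f : int -> R is
   the series \sum_m f m * z^m. *)
Record laurent := Laurent {
  lcoef :> int -> R;
  _ : lcoef \in laurent_supp
}.

HB.instance Definition _ := [isSub for lcoef].
HB.instance Definition _ := [Choice of laurent by <:].

Implicit Types f g h : laurent.

Lemma laurentP f g : lcoef f =1 lcoef g -> f = g.
Proof. by move=> fg; apply: val_inj; apply/funext. Qed.

Lemma laurent_bnd f : exists N : int, forall m, f m != 0 -> bounded e N m.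
Proof. by apply/asboolP; case: f. Qed.

Lemma bounded_common N M :
  exists K, forall m, bounded e N m \/ bounded e M m -> bounded e K m.
Proof.
rewrite /bounded; case: e; [exists (Num.min N M) | exists (Num.max N M)] => m;
  lia.
Qed.

Lemma laurent_zmod_closed : zmod_closed laurent_supp.
Proof.
split=> [|f g]; first by apply/asboolP; exists 0 => m; rewrite eqxx.
move=> /asboolP[N Nf] /asboolP[M Mg]; apply/asboolP.
have [K NMK] := bounded_common N M; exists K => m fg0; apply: NMK.
have [fm0|/Nf] := eqVneq (f m) 0; last by left.
right; apply: Mg; apply: contraNneq fg0 => gm0.
have -> : (f - g) m = f m - g m by [].
by rewrite fm0 gm0 subrr.
Qed.

HB.instance Definition _ :=
  GRing.isZmodClosed.Build (int -> R) laurent_supp laurent_zmod_closed.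
HB.instance Definition _ := [SubChoice_isSubZmodule of laurent by <:].

Lemma lcoefD f g m : (f + g) m = f m + g m. Proof. by []. Qed.
Lemma lcoefN f m : (- f) m = - f m. Proof. by []. Qed.
Lemma lcoef0 m : (0 : laurent) m = 0. Proof. by []. Qed.

Definition int_range (N M : int) : seq int :=
  [seq N + k%:Z | k <- iota 0 (absz (M - N)).+1].

Lemma int_range_uniq N M : uniq (int_range N M).
Proof. by rewrite map_inj_uniq ?iota_uniq // => i j; lia. Qed.

Lemma mem_int_range N M m : (N <= m)%R -> (m <= M)%R -> m \in int_range N M.
Proof.
move=> Nm mM; apply/mapP; exists (absz (m - N)); last by lia.
by rewrite mem_iota; lia.
Qed.

Definition erange N M := if e is at_zero then int_range N M else int_range M N.

Lemma erange_uniq N M : uniq (erange N M).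
Proof. by rewrite /erange; case: e; apply: int_range_uniq. Qed.

Lemma mem_erange N M m : bounded e N m -> bounded e m M -> m \in erange N M.
Proof. by rewrite /erange /bounded; case: e => *; apply: mem_int_range. Qed.

Lemma fsum_seq (F : int -> R) (r : seq int) :
    uniq r -> (forall m, m \notin r -> F m = 0) ->
  \sum_(m \in [set: int]) F m = \sum_(m <- r) F m.
Proof.
move=> ur F0; rewrite (fsbigE r) // => [|m _]; last exact: F0.
by apply: eq_bigl => m; rewrite in_setT.
Qed.

Lemma fsum_erange (F : int -> R) N M :
    (forall m, F m != 0 -> bounded e N m /\ bounded e m M) ->
  \sum_(m \in [set: int]) F m = \sum_(m <- erange N M) F m.
Proof.
move=> FNM; apply: fsum_seq; rewrite ?erange_uniq // => m.
apply: contraNeq => /FNM[]; exact: mem_erange.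
Qed.

(* finitely many terms are nonzero *)
Definition lmul_coef (f g : int -> R) (m : int) : R :=
  \sum_(a \in [set: int]) f a * g (m - a).

Lemma mulr_neq0 (x y : R) : x * y != 0 -> x != 0 /\ y != 0.
Proof.
by move=> xy0; split; apply: contraNneq xy0 => ->; rewrite ?mul0r ?mulr0.
Qed.

Lemma boundedD N M a b :
  bounded e N a -> bounded e M b -> bounded e (N + M) (a + b).
Proof. by rewrite /bounded; case: e; lia. Qed.

Lemma boundedB N M a b :
  bounded e N a -> bounded e b M -> bounded e (N - M) (a - b).
Proof. by rewrite /bounded; case: e; lia. Qed.

Lemma bounded_refl a : bounded e a a.
Proof. by rewrite /bounded; case: e. Qed.

Lemma lmul_coefE (f g : int -> R) N M m :
    (forall a, f a != 0 -> bounded e N a) ->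
    (forall a, g a != 0 -> bounded e M a) ->
  lmul_coef f g m = \sum_(a <- erange N (m - M)) f a * g (m - a).
Proof.
move=> Nf Mg; apply: fsum_erange => a /mulr_neq0[/Nf fa /Mg ga]; split=> //.
by move: ga; rewrite /bounded; case: e; lia.
Qed.

Lemma lmul_bnd (f g : int -> R) N M m :
    (forall a, f a != 0 -> bounded e N a) ->
    (forall a, g a != 0 -> bounded e M a) ->
  lmul_coef f g m != 0 -> bounded e (N + M) m.
Proof.
move=> Nf Mg; apply: contra_neqP => nNM; apply: fsbig1 => a _.
apply: contra_notP nNM => /eqP/mulr_neq0[/Nf fa /Mg ga].
by rewrite (_ : m = a + (m - a)); [apply: boundedD | lia].
Qed.

Lemma lmul_subproof f g : lmul_coef f g \in laurent_supp.
Proof.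
apply/asboolP; have [N Nf] := laurent_bnd f; have [M Mg] := laurent_bnd g.
by exists (N + M) => m; apply: lmul_bnd.
Qed.

Definition lmul f g : laurent := Laurent (lmul_subproof f g).

Lemma lone_subproof : (fun m : int => (m == 0)%:R : R) \in laurent_supp.
Proof.
apply/asboolP; exists 0 => m; have [->|] := eqVneq m 0; rewrite ?eqxx //.
by move=> _; apply: bounded_refl.
Qed.

Definition lone : laurent := Laurent lone_subproof.

Lemma lmulA : associative lmul.
Proof.
move=> f g h; apply: laurentP => m /=.
have [N Nf] := laurent_bnd f; have [M Mg] := laurent_bnd g.
have [K Kh] := laurent_bnd h.
have NMfg a := @lmul_bnd f g N M a Nf Mg.
have MKgh a := @lmul_bnd g h M K a Mg Kh.
rewrite (lmul_coefE m Nf MKgh) (lmul_coefE m NMfg Kh).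
transitivity (\sum_(a <- erange N (m - (M + K)))
   \sum_(c <- erange (N + M) (m - K)) f a * g (c - a) * h (m - c)).
  apply: eq_bigr => a _.
  have [->|/Nf fa] := eqVneq (f a) 0.
    by rewrite mul0r big1 // => c _; rewrite !mul0r.
  under eq_bigr do rewrite -mulrA; rewrite -mulr_sumr; congr (_ * _).
  rewrite /lmul_coef (reindex_fsbigT (fun c => c - a)); last first.
    by exists (fun c => c + a) => c; rewrite ?addrK ?subrK.
  transitivity (\sum_(c \in [set: int]) g (c - a) * h (m - c)).
    by apply: eq_fsbigr => c _; congr (_ * h _); lia.
  apply: fsum_erange => c /mulr_neq0[/Mg gc /Kh hc].
  by move: fa gc hc; rewrite /bounded; case: e; lia.
rewrite exchange_big /=; apply: eq_bigr => c _.
rewrite -mulr_suml.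
have [->|/Kh hc] := eqVneq (h (m - c)) 0; first by rewrite !mulr0.
congr (_ * _); apply/esym/fsum_erange => a /mulr_neq0[/Nf fa /Mg ga].
by move: fa ga hc; rewrite /bounded; case: e; lia.
Qed.

Lemma lmul1l : left_id lone lmul.
Proof.
move=> f; apply: laurentP => m /=; rewrite /lmul_coef.
rewrite (@fsum_seq _ [:: 0]) //= => [|a].
  by rewrite big_seq1 mul1r subr0.
by rewrite inE => /negPf ->; rewrite mul0r.
Qed.

Lemma lmul1r : right_id lone lmul.
Proof.
move=> f; apply: laurentP => m /=; rewrite /lmul_coef.
rewrite (@fsum_seq _ [:: m]) //= => [|a].
  by rewrite big_seq1 subrr mulr1.
by rewrite inE eq_sym -subr_eq0 => /negPf ->; rewrite mulr0.
Qed.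

Lemma lmulDl : left_distributive lmul +%R.
Proof.
move=> f g h; apply: laurentP => m.
have [N Nf] := laurent_bnd f; have [M Mg] := laurent_bnd g.
have [K Kh] := laurent_bnd h; have [N' NM] := bounded_common N M.
rewrite lcoefD /= !(@lmul_coefE _ _ N' K) //.
- by rewrite -big_split; apply: eq_bigr => a _; rewrite /= -mulrDl.
- by move=> a /Mg; auto.
- by move=> a /Nf; auto.
move=> a; change (f a + g a != 0 -> bounded e N' a).
have [->|/Nf] := eqVneq (f a) 0; last by auto.
by rewrite add0r => /Mg; auto.
Qed.

Lemma lmulDr : right_distributive lmul +%R.
Proof.
move=> h f g; apply: laurentP => m.
have [N Nf] := laurent_bnd f; have [M Mg] := laurent_bnd g.
have [K Kh] := laurent_bnd h; have [N' NM] := bounded_common N M.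
rewrite lcoefD /= !(@lmul_coefE _ _ K N') //.
- by rewrite -big_split; apply: eq_bigr => a _; rewrite /= -mulrDr.
- by move=> a /Mg; auto.
- by move=> a /Nf; auto.
move=> a; change (f a + g a != 0 -> bounded e N' a).
have [->|/Nf] := eqVneq (f a) 0; last by auto.
by rewrite add0r => /Mg; auto.
Qed.

Lemma lone_neq0 : lone != 0.
Proof.
by apply/eqP => /(congr1 (fun f : laurent => f 0)) /eqP /=; rewrite oner_eq0.
Qed.

HB.instance Definition _ := GRing.Zmodule_isNzRing.Build laurent
  lmulA lmul1l lmul1r lmulDl lmulDr lone_neq0.

Lemma lcoefM f g m : (f * g) m = \sum_(a \in [set: int]) f a * g (m - a).
Proof. by []. Qed.

Definition lder_coef (f : int -> R) (m : int) : R := f (m + 1) *~ (m + 1).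

Lemma lder_subproof f : lder_coef f \in laurent_supp.
Proof.
apply/asboolP; have [N Nf] := laurent_bnd f; exists (N - 1) => m f'm.
have /Nf : f (m + 1) != 0.
  by apply: contraNneq f'm => f0; rewrite /lder_coef f0 mul0rz.
by rewrite /bounded; case: e; lia.
Qed.

Definition lder f : laurent := Laurent (lder_subproof f).

Lemma lderD : {morph lder : f g / f + g}.
Proof. by move=> f g; apply: laurentP => m; rewrite /= /lder_coef mulrzDl. Qed.

Lemma lderM f g : lder (f * g) = lder f * g + f * lder g.
Proof.
apply: laurentP => m; rewrite lcoefD /= /lder_coef /lmul_coef /=.
have [N Nf] := laurent_bnd f; have [M Mg] := laurent_bnd g.
rewrite [X in _ = X + _](reindex_fsbigT (fun a => a - 1)); last first.
  by exists (fun a => a + 1) => a; rewrite ?addrK ?subrK.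
have fgr a : f a * g (m + 1 - a) != 0 ->
    bounded e N a /\ bounded e a (m + 1 - M).
  move=> /mulr_neq0[/Nf fa /Mg ga]; split=> //.
  by move: ga; rewrite /bounded; case: e; lia.
rewrite !(@fsum_erange _ N (m + 1 - M)) //; last 2 first.
- move=> a; rewrite /= /lder_coef mulrzAr => fga; apply: fgr.
  apply: contraNneq fga; rewrite (_ : m - a + 1 = m + 1 - a); last by lia.
  by move=> ->; rewrite mul0rz.
- move=> a; rewrite /= /lder_coef mulrzAl subrK => fga; apply: fgr.
  apply: contraNneq fga; rewrite (_ : m - (a - 1) = m + 1 - a); last by lia.
  by move=> ->; rewrite mul0rz.
rewrite mulrz_suml -big_split /=; apply: eq_bigr => a _.
rewrite /= /lder_coef subrK (_ : m - (a - 1) = m + 1 - a); last by lia.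
rewrite (_ : m - a + 1 = m + 1 - a); last by lia.
by rewrite mulrzAl mulrzAr -mulrzDr; congr (_ *~ _); lia.
Qed.

HB.instance Definition _ :=
  NzRing_hasDerivation.Build laurent lderD lderM.

End Laurent.

(* A function F : int -> int -> R is the series \sum_(a, b) F a b * u^a * v^b,
   in independent commuting variables u and v. *)
Section FormalCommutation.
Variables (e : expansion) (R : nzRingType).

Definition series_u (f : laurent e R) : int -> int -> R :=
  fun a b => f a *+ (b == 0).

Definition series_v (f : laurent e R) : int -> int -> R :=
  fun a b => f b *+ (a == 0).

Definition series_comm (f g : laurent e R) : int -> int -> R :=
  fun a b => f a * g b - g b * f a.

Definition umv_mul (F : int -> int -> R) : int -> int -> R :=
  fun a b => F (a - 1) b - F a (b - 1).

(* F = G / (u - v) is read as (u - v) F = G: the supports of the series at hand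
   are bounded in both variables, below for at_zero and above for at_infinity.
   Multiplication by u - v is injective on such series, and G vanishes on u = v,
   so that no choice of expansion of 1 / (u - v) is involved. *)
Definition series_gaudin n (L : 'M[laurent e R]_n) : Prop :=
  forall i j k l : 'I_n, forall a b : int,
    umv_mul (series_comm (L i j) (L k l)) a b =
      series_v (L i l) a b *+ (j == k) - series_u (L i l) a b *+ (j == k)
      - series_v (L k j) a b *+ (l == i) + series_u (L k j) a b *+ (l == i).

Definition series_commute (f g : laurent e R) : Prop :=
  forall a b : int, series_comm f g a b = 0.

End FormalCommutation.

(* ratfun R is the algebra of rational functions with coefficients in R, that
   is R (x)_F F(z): its elements are the fractions P / d with P in R[z] and d in
   F[z] nonzero, z being central. *)
Section RatFun.
Variables (F : fieldType) (R : algType F).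

Definition polyA (d : {poly F}) : {poly R} := map_poly (in_alg R) d.

HB.instance Definition _ := GRing.RMorphism.copy polyA (map_poly (in_alg R)).

Lemma polyAM d1 d2 : polyA (d1 * d2) = polyA d1 * polyA d2.
Proof. exact: rmorphM. Qed.

Lemma polyA_comm d (p : {poly R}) : polyA d * p = p * polyA d.
Proof.
apply/polyP => i; rewrite coefM coefMr; apply: eq_bigr => j _.
by rewrite coef_map /= mulr_algl mulr_algr.
Qed.

Lemma polyA_lreg d : d != 0 -> GRing.lreg (polyA d).
Proof.
move=> d0; apply: lreg_lead; rewrite lead_coef_map /= => x y /=.
by rewrite !mulr_algl; apply: scalerI; rewrite lead_coef_eq0.
Qed.

Lemma polyAM_comm d (p q : {poly R}) : p * (polyA d * q) = polyA d * (p * q).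
Proof. by rewrite !mulrA polyA_comm. Qed.

Record ratio := Ratio { ratnd :> {poly R} * {poly F}; _ : ratnd.2 != 0 }.
HB.instance Definition _ := [isSub for ratnd].
HB.instance Definition _ := [Choice of ratio by <:].

Implicit Types x y : ratio.
Local Notation num x := (ratnd x).1.
Local Notation den x := (ratnd x).2.

Lemma den_neq0 x : den x != 0. Proof. by case: x. Qed.

Definition eqrat x y := polyA (den y) * num x == polyA (den x) * num y.

Lemma eqrat_refl : reflexive eqrat.
Proof. by move=> x; apply: eqxx. Qed.

Lemma eqrat_sym : symmetric eqrat.
Proof. by move=> x y; rewrite /eqrat eq_sym. Qed.

Lemma eqrat_trans : transitive eqrat.
Proof.
move=> y x z /eqP xy /eqP yz; apply/eqP/(polyA_lreg (den_neq0 y)).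
have -> : polyA (den y) * (polyA (den z) * num x)
  = polyA (den z) * (polyA (den y) * num x) by rewrite !mulrA polyA_comm.
have -> : polyA (den y) * (polyA (den x) * num z)
  = polyA (den x) * (polyA (den y) * num z) by rewrite !mulrA polyA_comm.
by rewrite xy -yz !mulrA polyA_comm.
Qed.

Canonical eqrat_equiv := EquivRel eqrat eqrat_refl eqrat_sym eqrat_trans.

Definition ratfun := {eq_quot eqrat}.
HB.instance Definition _ : EqQuotient _ eqrat ratfun := EqQuotient.on ratfun.
HB.instance Definition _ := Choice.on ratfun.


Lemma ratfunP x y : polyA (den y) * num x = polyA (den x) * num y ->
  \pi_ratfun x = \pi_ratfun y.
Proof. by move=> xy; apply/eqmodP/eqP. Qed.

Lemma ratfunE x y : \pi_ratfun x = \pi_ratfun y ->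
  polyA (den y) * num x = polyA (den x) * num y.
Proof. by move=> /eqmodP/eqP. Qed.

Lemma ratfun_repr x : polyA (den (repr (\pi_ratfun x))) * num x =
  polyA (den x) * num (repr (\pi_ratfun x)).
Proof. by apply: ratfunE; rewrite reprK. Qed.

Lemma polyAA d1 d2 (p : {poly R}) :
  polyA d1 * (polyA d2 * p) = polyA (d1 * d2) * p.
Proof. by rewrite polyAM mulrA. Qed.

Lemma polyAN d (p : {poly R}) : - (polyA d * p) = polyA (- d) * p.
Proof. by rewrite rmorphN mulNr. Qed.

Lemma polyADl d1 d2 (p : {poly R}) :
  polyA d1 * p + polyA d2 * p = polyA (d1 + d2) * p.
Proof. by rewrite -mulrDl -rmorphD. Qed.

Lemma polyA_mul d1 d2 (p q : {poly R}) :
  polyA (d1 * d2) * (p * q) = (polyA d1 * p) * (polyA d2 * q).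
Proof. by rewrite polyAM_comm !mulrA -polyAM [d2 * d1]mulrC. Qed.

Definition rat_zero : ratio := @Ratio (0, 1) (oner_neq0 _).
Definition rat_one : ratio := @Ratio (1, 1) (oner_neq0 _).
Definition rat_opp x : ratio := @Ratio (- num x, den x) (den_neq0 x).
Definition rat_add x y : ratio :=
  @Ratio (polyA (den y) * num x + polyA (den x) * num y, den x * den y)
    (mulf_neq0 (den_neq0 x) (den_neq0 y)).
Definition rat_mul x y : ratio :=
  @Ratio (num x * num y, den x * den y)
    (mulf_neq0 (den_neq0 x) (den_neq0 y)).
Definition rat_der x : ratio :=
  @Ratio (polyA (den x) * (num x)^`() - polyA (den x)^`() * num x,
          den x * den x)
    (mulf_neq0 (den_neq0 x) (den_neq0 x)).

Definition ratfun_opp := lift_op1 ratfun rat_opp.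
Definition ratfun_add := lift_op2 ratfun rat_add.
Definition ratfun_mul := lift_op2 ratfun rat_mul.
Definition ratfun_der := lift_op1 ratfun rat_der.

Lemma pi_opp : {morph \pi_ratfun : x / rat_opp x >-> ratfun_opp x}.
Proof.
move=> x; unlock ratfun_opp; apply: ratfunP => /=.
by rewrite !mulrN ratfun_repr.
Qed.

Lemma pi_add : {morph \pi_ratfun : x y / rat_add x y >-> ratfun_add x y}.
Proof.
move=> x y; unlock ratfun_add; apply: ratfunP => /=.
set x' := repr _; set y' := repr _.
have xx' : polyA (den x') * num x = polyA (den x) * num x' := ratfun_repr x.
have yy' : polyA (den y') * num y = polyA (den y) * num y' := ratfun_repr y.
rewrite !mulrDr !polyAA; congr (_ + _).
  rewrite (_ : _ * _ = den y' * den y * den x'); last by ring.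
  by rewrite -polyAA xx' polyAA; congr (polyA _ * _); ring.
rewrite (_ : _ * _ = den x' * den x * den y'); last by ring.
by rewrite -polyAA yy' polyAA; congr (polyA _ * _); ring.
Qed.

Lemma pi_mul : {morph \pi_ratfun : x y / rat_mul x y >-> ratfun_mul x y}.
Proof.
move=> x y; unlock ratfun_mul; apply: ratfunP => /=.
set x' := repr _; set y' := repr _.
have xx' : polyA (den x') * num x = polyA (den x) * num x' := ratfun_repr x.
have yy' : polyA (den y') * num y = polyA (den y) * num y' := ratfun_repr y.
by rewrite !polyA_mul xx' yy'.
Qed.

Lemma polyA_deriv d : (polyA d)^`() = polyA d^`().
Proof. exact: deriv_map. Qed.

Lemma pi_der : {morph \pi_ratfun : x / rat_der x >-> ratfun_der x}.
Proof.
move=> x; unlock ratfun_der; apply: ratfunP => /=; set y := repr _.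
have xy : polyA (den y) * num x = polyA (den x) * num y := ratfun_repr x.
have := congr1 (@deriv R) xy; rewrite !derivM !polyA_deriv => xy'.
have {xy'} xy' : polyA (den y) * (num x)^`() =
    polyA (den x)^`() * num y + polyA (den x) * (num y)^`()
    - polyA (den y)^`() * num x by rewrite -xy' addrC addKr.
set a := den x in xy xy' *; set b := den y in xy xy' *.
have e1 : polyA (b * b * a) * (num x)^`() = polyA (a * b * a^`()) * num y
    + polyA (a * a * b) * (num y)^`() - polyA (a * b * b^`()) * num x.
  rewrite (_ : b * b * a = a * b * b); last by ring.
  by rewrite -[LHS]polyAA xy' mulrBr mulrDr !polyAA [a * b * a]mulrAC.
have e2 : polyA (b * b * a^`()) * num x = polyA (a * b * a^`()) * num y.
  rewrite (_ : b * b * a^`() = b * a^`() * b); last by ring.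
  by rewrite -polyAA xy polyAA; congr (polyA _ * _); ring.
have e3 : polyA (a * b * b^`()) * num x = polyA (a * a * b^`()) * num y.
  rewrite (_ : a * b * b^`() = a * b^`() * b); last by ring.
  by rewrite -polyAA xy polyAA; congr (polyA _ * _); ring.
rewrite !mulrBr !polyAA e1 e2 e3.
by rewrite [X in X - _ - _]addrC addrAC addrK.
Qed.


Canonical pi_opp_morph := PiMorph1 pi_opp.
Canonical pi_add_morph := PiMorph2 pi_add.
Canonical pi_mul_morph := PiMorph2 pi_mul.
Canonical pi_der_morph := PiMorph1 pi_der.

Lemma ratfun_addA : associative ratfun_add.
Proof.
elim/quotW=> x; elim/quotW=> y; elim/quotW=> z; rewrite !piE.
apply: ratfunP => /=; rewrite mulrA; congr (_ * _).
rewrite !mulrDr !polyAA addrA [den y * den z]mulrC.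
by congr (_ + _); congr (_ + _); congr (polyA _ * _); ring.
Qed.

Lemma ratfun_addC : commutative ratfun_add.
Proof.
elim/quotW=> x; elim/quotW=> y; rewrite !piE.
by apply: ratfunP => /=; rewrite mulrC addrC.
Qed.

Lemma ratfun_add0 : left_id (\pi_ratfun rat_zero) ratfun_add.
Proof.
elim/quotW=> x; rewrite !piE; apply: ratfunP => /=.
by rewrite mulr0 add0r rmorph1 !mul1r.
Qed.

Lemma ratfun_addN : left_inverse (\pi_ratfun rat_zero) ratfun_opp ratfun_add.
Proof.
elim/quotW=> x; rewrite !piE; apply: ratfunP => /=.
by rewrite mulrN addNr !mulr0.
Qed.

HB.instance Definition _ := GRing.isZmodule.Build ratfun
  ratfun_addA ratfun_addC ratfun_add0 ratfun_addN.

Lemma ratfun_mulA : associative ratfun_mul.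
Proof.
elim/quotW=> x; elim/quotW=> y; elim/quotW=> z; rewrite !piE.
by apply: ratfunP => /=; rewrite !mulrA.
Qed.

Lemma ratfun_mul1 : left_id (\pi_ratfun rat_one) ratfun_mul.
Proof.
by elim/quotW=> x; rewrite !piE; apply: ratfunP => /=; rewrite !mul1r.
Qed.

Lemma ratfun_mulr1 : right_id (\pi_ratfun rat_one) ratfun_mul.
Proof.
by elim/quotW=> x; rewrite !piE; apply: ratfunP => /=; rewrite !mulr1.
Qed.

Lemma ratfun_mulDl : left_distributive ratfun_mul ratfun_add.
Proof.
elim/quotW=> x; elim/quotW=> y; elim/quotW=> z; rewrite !piE.
apply: ratfunP => /=.
rewrite !mulrDl -!mulrA !mulrDr !polyAA.
by congr (_ + _); congr (polyA _ * _); ring.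
Qed.

Lemma ratfun_mulDr : right_distributive ratfun_mul ratfun_add.
Proof.
elim/quotW=> x; elim/quotW=> y; elim/quotW=> z; rewrite !piE.
apply: ratfunP => /=.
rewrite !mulrDr ![num x * (polyA _ * _)]polyAM_comm !polyAA.
by congr (_ + _); congr (polyA _ * _); ring.
Qed.

Lemma ratfun_one_neq0 : \pi_ratfun rat_one != 0.
Proof.
apply/eqP => /ratfunE /= /eqP.
by rewrite rmorph1 !mul1r oner_eq0.
Qed.

HB.instance Definition _ := GRing.Zmodule_isNzRing.Build ratfun
  ratfun_mulA ratfun_mul1 ratfun_mulr1 ratfun_mulDl ratfun_mulDr
  ratfun_one_neq0.

Lemma ratfun_derD : {morph ratfun_der : f g / f + g}.
Proof.
elim/quotW=> x; elim/quotW=> y; rewrite /GRing.add /= !piE.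
apply: ratfunP => /=.
set a := den x; set b := den y; set p := num x; set q := num y.
rewrite !(derivD, derivM) !polyA_deriv !(mulrDr, mulrBr, opprD).
rewrite !(polyAN, polyAA) addrACA.
rewrite [X in X + _ = _]addrAC [X in _ + X = _]addrAC !polyADl.
rewrite [X in _ = X + _]addrC [X in _ = _ + X]addrC.
by congr (_ + _); congr (_ + _); congr (polyA _ * _); ring.
Qed.

Lemma ratfun_derM f g :
  ratfun_der (f * g) = ratfun_der f * g + f * ratfun_der g.
Proof.
elim/quotW: f => x; elim/quotW: g => y.
rewrite /GRing.mul /GRing.add /= !piE; apply: ratfunP => /=.
set a := den x; set b := den y; set p := num x; set q := num y.
rewrite derivM !(mulrDl, mulNr, mulrDr, mulrN, opprD) -!mulrA.
rewrite ![p * (polyA _ * _)]polyAM_comm !(polyAN, polyAA).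
rewrite [RHS]addrACA polyADl derivM.
by congr (_ + _ + _); congr (polyA _ * _); ring.
Qed.

HB.instance Definition _ :=
  NzRing_hasDerivation.Build ratfun ratfun_derD ratfun_derM.

(* f is regular at u, with value r *)
Definition has_value (f : ratfun) (u : F) (r : R) : Prop :=
  exists P : {poly R}, exists d : {poly F}, exists d0 : d != 0,
    [/\ f = \pi_ratfun (@Ratio (P, d) d0), d.[u] != 0
      & r = d.[u]^-1 *: P.[u%:A]].

Lemma horner_polyAM d (P : {poly R}) u :
  (polyA d * P).[u%:A] = d.[u] *: P.[u%:A].
Proof.
rewrite polyA_comm hornerM_comm.
  by rewrite /polyA -[u%:A]/(in_alg R u) horner_map mulr_algr.
by rewrite /comm_poly /polyA -[u%:A]/(in_alg R u) horner_map mulr_algr mulr_algl.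
Qed.

Lemma has_value_inj f u r1 r2 : has_value f u r1 -> has_value f u r2 -> r1 = r2.
Proof.
move=> [P [d [d0 [-> du ->]]]] [Q [e [e0 [/ratfunE /= ePdQ eu ->]]]].
have := congr1 (fun S => S.[u%:A]) ePdQ; rewrite !horner_polyAM => edPQ.
apply: (scalerI du); apply: (scalerI eu).
rewrite [d.[u] *: (_^-1 *: P.[_])]scalerA mulfV // scale1r edPQ.
by rewrite [RHS]scalerA [_ * d.[u]]mulrC -scalerA [e.[u] *: _]scalerA mulfV // scale1r.
Qed.

Definition mx_value n (L : 'M[ratfun]_n) (u : F) (Lu : 'M[R]_n) : Prop :=
  forall i j, has_value (L i j) u (Lu i j).

Definition rational_gaudin n (L : 'M[ratfun]_n) : Prop :=
  forall (u v : F) (Lu Lv : 'M[R]_n),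
    u != v -> mx_value L u Lu -> mx_value L v Lv ->
  forall i j k l : 'I_n,
    Lu i j * Lv k l - Lv k l * Lu i j =
      (u - v)^-1 *: (Lv i l *+ (j == k) - Lu i l *+ (j == k)
                     - Lv k j *+ (l == i) + Lu k j *+ (l == i)).

(* [f(u), g(v)] = 0 for all u and v outside the poles of f and g *)
Definition rational_commute (f g : ratfun) : Prop :=
  forall (u v : F) (fu gv : R),
    has_value f u fu -> has_value g v gv -> fu * gv = gv * fu.

End RatFun.

(* Main.v *)
Require Import Defs.
From HB Require Import structures.
From mathcomp Require Import all_boot all_order all_algebra all_fingroup.
From mathcomp Require Import reals complex generic_quotient zify.
From mathcomp Require Import boolp classical_sets fsbigop.

(* Write D(y) for the column determinant of d_y - L(y). Fermionic variables turn
   column determinants into products of linear forms. The Gaudin relation says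
   exactly that M = d_y - L(y) and W = d_z + L^T(z) are Manin matrices with
   (y - z) [M_ij, W_kl] = d_ik (M_lj + W_jl) - d_jl (M_ik + W_ki), and correcting
   the linear forms of M and W by multiples of (y - z)^-1 makes them anticommute
   up to terms that cancel on the vacuum; hence det M and det W commute, i.e.
   every QH_i(y) commutes with the coefficients of det (d_z + L^T(z)).

   Next, the coefficients of Lambda = sum psi_i zeta_j L_ij commute with each
   other, so the formal adjoint maps (theta d + Lambda)^n to
   (- theta d + Lambda)^n, where theta = sum psi_i zeta_i. These powers are n!
   times the determinants of d + L^T and d - L, up to the sign and the top
   fermionic monomial: the coefficients of either determinant are differential
   polynomials in those of the other, and [QH_i(y), QH_j(z)] = 0.

   Finally the column cofactors B of M satisfy B M = D and tr B = [D, z]. As the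
   remainder of d^i by d - L is L^[i], the first identity gives B from the
   quotients of the d^i and yields sum_i QH_i L^[i] = 0; the second expresses
   Tr L^[m], recursively for m < n, as a differential polynomial in the QH_i and
   the Tr L^[j] with j < m, and the traces commute with whatever commutes with
   all QH_i. Rational matrices are treated by expansion at infinity. *)

Set Implicit Arguments.
Unset Strict Implicit.
Unset Printing Implicit Defensive.

Import GRing.Theory Num.Theory.

Local Open Scope ring_scope.
Local Open Scope quotient_scope.

(** The transpose in W is what makes the correction possible. In the relation between M and W the
    row index of M is contracted with the row index of W, so y - z times the anticommutator of the
    linear forms phi_j and chi_l is theta (M_lj + W_jl), with theta = sum psi_i eta_i, plus a term
    present only for j = l. Subtracting (y - z)^-1 theta times an annihilation operator absorbs the
    first part. The second part is handled by keeping a factor y - z between the two products of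
    forms: next to it the defect at j = l becomes a combination that vanishes inside the product.
    This factor is also the natural one, since on a filled fermionic level each corrected form acts
    as (y - z) phi_j (y - z)^-1, and the inverse on the right meets the factor y - z. The detour
    through powers of theta d + Lambda is forced by noncommutative coefficients: the formal adjoint
    then fails to reverse products, and it is only applied to an operator whose coefficients commute
    with each other at independent points. Recovering a determinant from its power cancels n!, which
    uses characteristic zero. *)

(** * Anticommuting elements *)

Section Anticommuting.
Variable F : nzRingType.
Implicit Types (a b c : F).

Definition anticomm a b := a * b = - (b * a).

Lemma anticomm_sym a b : anticomm a b -> anticomm b a.
Proof. by rewrite /anticomm => ->; rewrite opprK. Qed.

Lemma anticomm_suml (I : Type) (r : seq I) (P : pred I) (E : I -> F) b :
  (forall i, P i -> anticomm (E i) b) -> anticomm (\sum_(i <- r | P i) E i) b.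
Proof.
move=> h; rewrite /anticomm mulr_suml mulr_sumr -sumrN.
by apply: eq_bigr => i /h.
Qed.

Lemma anticomm_sumr (I : Type) (r : seq I) (P : pred I) (E : I -> F) b :
  (forall i, P i -> anticomm b (E i)) -> anticomm b (\sum_(i <- r | P i) E i).
Proof.
by move=> h; apply/anticomm_sym/anticomm_suml => i Pi; apply/anticomm_sym/h.
Qed.

Lemma anticommMr a b c : anticomm c a -> GRing.comm c b -> anticomm c (a * b).
Proof.
by move=> ca cb; rewrite /anticomm mulrA ca mulNr -[a * c * b]mulrA cb mulrA.
Qed.

Lemma anticomm_prod (I : eqType) (r : seq I) (E : I -> F) a :
    {in r, forall i, anticomm a (E i)} ->
  a * \prod_(i <- r) E i = (-1) ^+ size r * (\prod_(i <- r) E i * a).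
Proof.
elim: r => [|i r IHr] h; first by rewrite big_nil mulr1 !mul1r.
rewrite big_cons mulrA h ?mem_head // mulNr -[E i * a * _]mulrA IHr => [|j jr]; last first.
  by apply: h; rewrite inE jr orbT.
rewrite exprS mulN1r mulNr; congr (- _).
by rewrite mulrA commr_sign -!mulrA.
Qed.

Lemma prod_anticomm_mem (I : eqType) (r : seq I) (E : I -> F) k :
    k \in r -> {in r, forall i, anticomm (E k) (E i)} -> E k * E k = 0 ->
  E k * \prod_(i <- r) E i = 0 /\ \prod_(i <- r) E i * E k = 0.
Proof.
move=> kr h Ek0.
suff l0 : E k * \prod_(i <- r) E i = 0.
  by split=> //; apply: (@lreg_sign _ (size r)); rewrite -anticomm_prod // l0 mulr0.
case/splitPr: kr h => r1 r2 h; rewrite big_cat big_cons /= mulrA anticomm_prod.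
  by rewrite -!mulrA [E k * (E k * _)]mulrA Ek0 mul0r !mulr0.
by move=> i ir; apply: h; rewrite mem_cat ir.
Qed.

(** Moving the left factor of the pair through [r2] costs the same sign on both sides; only the
    exchange of the two neighbours leaves a minus. *)
Lemma prod_anticomm_swap (I : eqType) (r1 r2 r3 : seq I) (E : I -> F) (a b : I) :
    (forall i j, i != j -> anticomm (E i) (E j)) -> uniq (r1 ++ a :: r2 ++ b :: r3) ->
  \prod_(i <- r1 ++ a :: r2 ++ b :: r3) E i =
  - \prod_(i <- r1 ++ b :: r2 ++ a :: r3) E i.
Proof.
move=> h; rewrite cat_uniq => /and3P[_ _]; rewrite cons_uniq mem_cat inE !negb_or.
rewrite cat_uniq => /andP[/and3P[ar2 ab ar3] /and3P[_ /hasPn br2 _]].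
have /= br2' := br2 b (mem_head _ _).
rewrite !big_cat !big_cons !big_cat !big_cons /= -mulrN; congr (_ * _).
have move_prod (c : I) : c \notin r2 ->
    E c * \prod_(i <- r2) E i = (-1) ^+ size r2 * (\prod_(i <- r2) E i * E c).
  move=> cr2; apply: anticomm_prod => i ir; apply: h.
  by apply: contraNneq cr2 => ->.
rewrite ![E _ * (\prod_(i <- r2) E i * _)]mulrA !move_prod // -!mulrA -mulrN.
by congr (_ * _); rewrite -mulrN; congr (_ * _); rewrite !mulrA h // mulNr.
Qed.

End Anticommuting.

Lemma prod_tperm (F : nzRingType) n (g : 'I_n -> F) (a b : 'I_n) :
    (forall i j, i != j -> anticomm (g i) (g j)) -> a != b ->
  \prod_j g (tperm a b j) = - \prod_j g j.
Proof.
move=> h neab.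
have uI := index_enum_uniq 'I_n.
have swapE (c d : 'I_n) r1 r2 r3 : index_enum 'I_n = r1 ++ c :: r2 ++ d :: r3 ->
    map (tperm c d) (index_enum 'I_n) = r1 ++ d :: r2 ++ c :: r3.
  move=> er; move: uI; rewrite er => u.
  have idr r : c \notin r -> d \notin r -> map (tperm c d) r = r.
    move=> cr dr; rewrite -[RHS]map_id; apply/eq_in_map => i ir.
    by rewrite tpermD //; [apply: contraNneq cr => ->|apply: contraNneq dr => ->].
  have {u}:= u; rewrite cat_uniq cons_uniq => /and3P[_ hr1 /andP[]].
  rewrite mem_cat inE !negb_or cat_uniq => /and3P[cr2 ncd cr3].
  case/and3P=> _ /hasPn/(_ d (mem_head _ _)) dr2 /andP[dr3 _].
  have /hasPn/= := hr1 => hr1'.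
  have cr1 : c \notin r1 by apply: hr1'; rewrite mem_head.
  have dr1 : d \notin r1 by apply: hr1'; rewrite inE mem_cat mem_head !orbT.
  by rewrite map_cat /= map_cat /= tpermL tpermR !idr.
have key (c d : 'I_n) r1 r2 r3 : index_enum 'I_n = r1 ++ c :: r2 ++ d :: r3 ->
    \prod_j g (tperm c d j) = - \prod_j g j.
  move=> er; rewrite -(big_map (tperm c d) xpredT) (swapE _ _ _ _ _ er) er.
  by apply: (prod_anticomm_swap (E := g)) => //; rewrite -swapE// map_inj_uniq //; exact: perm_inj.
have split_at (T : eqType) (r : seq T) c : c \in r -> exists r1 r2, r = r1 ++ c :: r2.
  by case/path.splitPr => r1 r2; exists r1, r2.
have [r1 [r er]] := split_at _ _ _ (mem_index_enum a).
have : b \in r1 ++ a :: r by rewrite -er mem_index_enum.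
rewrite mem_cat inE eq_sym (negPf neab) /=.
case/orP => /split_at[q1 [q2 eq]].
  by rewrite tpermC; apply: (key _ _ q1 q2 r); rewrite er eq -catA.
by apply: (key _ _ r1 q1 q2); rewrite er eq.
Qed.

Lemma prod_perm (F : nzRingType) n (g : 'I_n -> F) (s : 'S_n) :
    (forall i j, i != j -> anticomm (g i) (g j)) ->
  \prod_j g (s j) = (-1) ^+ s * \prod_j g j.
Proof.
have [ts -> /allP] := prod_tpermP s; elim: ts g => [|t ts IHts] g dts h.
  by rewrite big_nil odd_perm1 mul1r; apply: eq_bigr => j _; rewrite perm1.
have neqt : t.1 != t.2 := dts t (mem_head _ _).
rewrite big_cons odd_permM odd_tperm neqt signr_addb expr1 -mulrA.
rewrite -IHts // => [|u uts]; last by rewrite dts // inE uts orbT.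
under eq_bigr do rewrite permM.
rewrite (prod_tperm (g := fun j => g ((\prod_(i <- ts) tperm i.1 i.2)%g j))) ?mulN1r //.
  by move=> i j ij; apply: h; rewrite (inj_eq perm_inj).
Qed.

(** The expansion has one term per map of the columns to the rows. A repeated row repeats a
    square-zero [e i], so permutations alone survive, and sorting the [e] produces the sign. The
    entries of [M] keep the order of their columns, hence a column determinant. *)
Lemma prod_sum_det (F : nzRingType) n (e : 'I_n -> F) (M : 'M[F]_n) :
    (forall i j, anticomm (e i) (e j)) -> (forall i, e i * e i = 0) ->
    (forall i j k, GRing.comm (M i j) (e k)) ->
  \prod_j (\sum_i e i * M i j) = \prod_j e j * (\sum_(s : 'S_n) (-1) ^+ s * \prod_j M (s j) j).
Proof.
move=> ea e0 Me; rewrite bigA_distr_bigA /=.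
have prodM (f : {ffun 'I_n -> 'I_n}) :
    \prod_j (e (f j) * M (f j) j) = \prod_j e (f j) * \prod_j M (f j) j.
  elim: (index_enum _) => [|j r IHr]; first by rewrite !big_nil mulr1.
  rewrite !big_cons IHr -!mulrA; congr (_ * _); rewrite !mulrA; congr (_ * _).
  by apply: commr_prod => k _; apply: Me.
rewrite mulr_sumr (bigID (fun f : {ffun 'I_n -> 'I_n} => injectiveb f)) /=.
rewrite [X in _ + X]big1 ?addr0 => [|f /injectivePn[a [b nab fab]]]; last first.
  rewrite prodM; suff -> : \prod_j e (f j) = 0 by rewrite mul0r.
  have [r1 [r2 er]] : exists r1 r2, index_enum 'I_n = r1 ++ a :: r2.
    by case/path.splitPr: (mem_index_enum a) => r1 r2; exists r1, r2.
  have : b \in r1 ++ a :: r2 by rewrite -er mem_index_enum.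
  rewrite mem_cat inE eq_sym (negPf nab) /= er big_cat big_cons /= => /orP[] br.
    rewrite mulrA fab (prod_anticomm_mem (E := fun j => e (f j)) br _ (e0 _)).2.
      by rewrite mul0r.
    by move=> i _; apply: ea.
  rewrite fab (prod_anticomm_mem (E := fun j => e (f j)) br _ (e0 _)).1 ?mulr0 //.
rewrite (reindex (@pval _)) /=; last first.
  pose in_Sn := insubd (1%g : 'S_n).
  exists in_Sn; last exact: insubdK.
  by move=> s _; apply: valKd.
apply: eq_big => [s|s _]; first by rewrite (valP s).
rewrite prodM; under eq_bigr do rewrite pvalE.
under [X in _ * X = _]eq_bigr do rewrite pvalE.
rewrite prod_perm // mulrA; congr (_ * _); exact/esym/commr_sign.
Qed.

Lemma prod_anticomm_ord (F : nzRingType) n (a b : 'I_n -> F) :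
    (forall i j, anticomm (a i) (b j)) ->
  \prod_i a i * \prod_i b i = (-1) ^+ n * (\prod_i b i * \prod_i a i).
Proof.
move=> ab; pose bt := \prod_i b i.
have sz : size (index_enum 'I_n) = n by rewrite /index_enum -enumT size_enum_ord.
have h r : \prod_(i <- r) a i * bt = ((-1) ^+ n) ^+ size r * (bt * \prod_(i <- r) a i).
  elim: r => [|i r IHr]; first by rewrite !big_nil !mul1r mulr1.
  have abt : a i * bt = (-1) ^+ n * (bt * a i).
    rewrite /bt anticomm_prod ?sz // => k _; exact: ab.
  have aS m : a i * ((-1) ^+ n) ^+ m = ((-1) ^+ n) ^+ m * a i.
    by apply: commrX; apply: commr_sign.
  rewrite !big_cons -mulrA IHr (mulrA (a i)) aS -(mulrA _ (a i)) (mulrA (a i)).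
  by rewrite abt /= exprSr -!mulrA.
by rewrite -/bt h sz -exprM -signr_odd oddM andbb signr_odd.
Qed.

(** * Exchange of two families of anticommuting elements *)

Section CliffordPair.
Variables (F : nzRingType) (n : nat).
Variables (Xi Ch psi eta : 'I_n -> F) (x th N p : F).
Hypothesis XiXi : forall i j, anticomm (Xi i) (Xi j).
Hypothesis Xi2 : forall i, Xi i * Xi i = 0.
Hypothesis ChCh : forall i j, anticomm (Ch i) (Ch j).
Hypothesis Ch2 : forall i, Ch i * Ch i = 0.
Hypothesis XiCh : forall i j, i != j -> anticomm (Xi i) (Ch j).
Hypothesis XixCh : forall k,
  Xi k * x * Ch k + Ch k * x * Xi k =
  psi k * Ch k - eta k * Xi k - \sum_i psi i * Ch i + \sum_i eta i * Xi i - th * N.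
Hypothesis psiCh : forall i, psi i * Ch i = - (Ch i * psi i) - th.
Hypothesis etaXi : forall i, eta i * Xi i = - (Xi i * eta i) - th.
Hypothesis thXi : forall i, GRing.comm th (Xi i).
Hypothesis thCh : forall i, GRing.comm th (Ch i).
Hypothesis NXi : forall i, N * Xi i = Xi i * (N + 1).
Hypothesis NCh : forall i, N * Ch i = Ch i * (N - 1).
Hypothesis Np : N * p = 0.

Local Notation PXi s := (\prod_(i <- s) Xi i).
Local Notation PCh s := (\prod_(i <- s) Ch i).

(** [N] kills [p]; each [Xi] raises the weight by one and each [Ch] lowers it by one. *)
Lemma weight_prod (s t : seq 'I_n) :
  N * (PCh t * PXi s * p) = ((size s)%:R - (size t)%:R) * (PCh t * PXi s * p).
Proof.
have cent (a : int) y w : y * (a%:~R * w) = a%:~R * (y * w).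
  by rewrite mulrA commr_int -mulrA.
have weightXi (a : int) r q : N * q = a%:~R * q ->
    N * (PXi r * q) = (a + (size r)%:Z)%:~R * (PXi r * q).
  move=> Nq; elim: r => [|i r IH]; first by rewrite big_nil mul1r addr0.
  rewrite big_cons -mulrA mulrA NXi -mulrA mulrDl IH mul1r mulrDr cent.
  by rewrite /= -addn1 PoszD addrA [X in _ = X * _]intrD mulrDl mul1r.
have weightCh (a : int) r q : N * q = a%:~R * q ->
    N * (PCh r * q) = (a - (size r)%:Z)%:~R * (PCh r * q).
  move=> Nq; elim: r => [|i r IH]; first by rewrite big_nil mul1r subr0.
  rewrite big_cons -mulrA mulrA NCh -mulrA mulrBl IH mul1r mulrBr cent.
  by rewrite /= -addn1 PoszD opprD addrA [X in _ = X * _]intrB mulrBl mul1r.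
rewrite -!mulrA (weightCh (size s)%:Z) ?intrB //.
by rewrite (weightXi 0) ?add0r // Np mul0r.
Qed.

Lemma PXi_mem s i : i \in s -> Xi i * PXi s = 0 /\ PXi s * Xi i = 0.
Proof. by move=> si; apply: prod_anticomm_mem => // j _; apply: XiXi. Qed.

Lemma PCh_mem s i : i \in s -> Ch i * PCh s = 0 /\ PCh s * Ch i = 0.
Proof. by move=> si; apply: prod_anticomm_mem => // j _; apply: ChCh. Qed.

Lemma Xi_PCh s i : i \notin s -> Xi i * PCh s = (-1) ^+ size s * (PCh s * Xi i).
Proof.
move=> si; apply: anticomm_prod => j js; apply: XiCh.
by apply: contraNneq si => ->.
Qed.

Lemma Ch_PXi s i : i \notin s -> Ch i * PXi s = (-1) ^+ size s * (PXi s * Ch i).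
Proof.
move=> si; apply: anticomm_prod => j js; apply/anticomm_sym/XiCh.
by apply: contraNneq si => <-.
Qed.

Lemma Xi_PXi s i : Xi i * PXi s = (-1) ^+ size s * (PXi s * Xi i).
Proof. by apply: anticomm_prod => j _; apply: XiXi. Qed.

(* N acts on the last factor by |s| - |t|, which compensates the |s| copies of th
   coming from psi and the |t| copies coming from eta. *)
Lemma exchange_error (s t : seq 'I_n) (k : 'I_n) :
    uniq (s ++ k :: t) -> perm_eq (s ++ k :: t) (index_enum 'I_n) ->
  PCh s * PXi t * (Xi k * x * Ch k + Ch k * x * Xi k) * (PCh t * PXi s * p) = 0.
Proof.
move=> u pst; set U := PCh s * PXi t; set V := PCh t * PXi s * p.
have disj i : i \in s -> i \notin t.
  move: u; rewrite cat_uniq => /and3P[_ /hasPn h _] si.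
  by apply/negP => ti; have := h i; rewrite inE ti orbT /= si => /(_ isT).
have thU : GRing.comm th U.
  by apply: commrM; apply: commr_prod => i _; [apply: thCh | apply: thXi].
(* Pushed to the left through [PXi t], the factor [Ch i] meets [PCh s], which already contains it;
   only the [th] of [psiCh] is left. For [i] in [t] it is instead the [PCh t] on the right that
   kills [Ch i]. The terms in [eta] behave symmetrically. *)
have psis i : i \in s -> U * (psi i * Ch i) * V = - (th * U * V).
  move=> si; rewrite psiCh mulrBr mulrN [U * (Ch i * _)]mulrA -[U * Ch i]mulrA.
  have := Ch_PXi (disj i si); rewrite -/U => eCh.
  have -> : PXi t * Ch i = (-1) ^+ size t * (Ch i * PXi t).
    by rewrite eCh mulrA -exprD -signr_odd addnn odd_double mul1r.
  rewrite [PCh s * _]mulrA commr_sign -[_ * PCh s * _]mulrA [PCh s * (Ch i * _)]mulrA.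
  by rewrite (PCh_mem si).2 mul0r mulr0 mul0r oppr0 sub0r mulNr -thU.
have etat i : i \in t -> U * (eta i * Xi i) * V = - (th * U * V).
  move=> ti; rewrite etaXi mulrBr mulrN [U * (Xi i * _)]mulrA -[U * Xi i]mulrA.
  by rewrite (PXi_mem ti).2 mulr0 mul0r oppr0 sub0r mulNr -thU.
have psit i : i \in t -> psi i * Ch i * V = 0.
  by move=> ti; rewrite /V -!mulrA [Ch i * (_ * _)]mulrA (PCh_mem ti).1 mul0r mulr0.
have etas i : i \in s -> eta i * Xi i * V = 0.
  move=> si; rewrite /V -!mulrA [Xi i * (_ * _)]mulrA Xi_PCh ?disj // -!mulrA.
  by rewrite [Xi i * (_ * _)]mulrA (PXi_mem si).1 mul0r !mulr0.
rewrite XixCh -!(perm_big _ pst) /= !big_cat !big_cons /=.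
(* The two isolated terms at [k] cancel the [k]-th summands of the two sums. *)
have cancel_ab (a b c d e f g : F) :
    a - b - (c + (a + d)) + (e + (b + f)) - g = - (c + d) + (e + f) - g.
  rewrite (addrCA c) (addrCA e) (opprD a) (addrA (a - b)) (addrAC a) subrr sub0r.
  by rewrite (addrC (- b)) (addrA _ b) addrNK.
rewrite {}cancel_ab !(mulrDr, mulrDl, mulrN, mulNr).
have sum_const (r : seq 'I_n) (E : 'I_n -> F) w :
    {in r, forall i, U * E i * V = w} -> U * (\sum_(i <- r) E i) * V = (size r)%:R * w.
  move=> Ew; rewrite mulr_sumr mulr_suml (eq_big_seq _ Ew) big_const_seq count_predT.
  by rewrite iter_addr_0 mulr_natl.
rewrite (sum_const _ _ _ psis) (sum_const _ _ _ etat).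
rewrite (sum_const _ _ 0) => [|i ti]; last by rewrite -mulrA psit ?mulr0.
rewrite (sum_const _ _ 0) => [|i si]; last by rewrite -mulrA etas ?mulr0.
have -> : U * (th * N) * V = ((size s)%:R - (size t)%:R) * (th * U * V).
  have NV : N * V = ((size s)%:R - (size t)%:R) * V := weight_prod s t.
  rewrite -[U * _ * V]mulrA -[th * N * V]mulrA NV !mulrA -thU.
  by rewrite mulrBr !commr_nat -mulrBl -!mulrA.
by rewrite mulrBl !(mulrN, mulr0, addr0, oppr0, add0r) opprK subrr.
Qed.

(** By [exchange_error], [Xi k * x * Ch k] may be replaced by [- (Ch k * x * Xi k)] inside the word.
    Bringing [Ch k] and [Xi k] to the ends of the products over [s] then yields signs that combine
    to [(-1) ^+ n], because [n] is [size s + size t + 1]. *)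
Lemma exchange_step (s t : seq 'I_n) (k : 'I_n) :
    uniq (s ++ k :: t) -> perm_eq (s ++ k :: t) (index_enum 'I_n) ->
  PCh s * PXi (k :: t) * x * PCh (k :: t) * PXi s * p =
  (-1) ^+ n * (PCh (rcons s k) * PXi t * x * PCh t * PXi (rcons s k) * p).
Proof.
move=> u pst; have := exchange_error u pst.
have sz : n = (size s + size t).+1.
  by have := perm_size pst; rewrite size_cat /= /index_enum -enumT size_enum_ord addnS.
have [ks kt] : k \notin s /\ k \notin t.
  move: u; rewrite cat_uniq => /and3P[_ /hasPn h /andP[-> _]]; split=> //.
  exact: h (mem_head _ _).
rewrite mulrDr mulrDl => /eqP; rewrite addr_eq0 => /eqP e.
have XiPXi : PXi (k :: t) = (-1) ^+ size t * (PXi t * Xi k) by rewrite big_cons Xi_PXi.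
rewrite XiPXi [PCh (k :: t)]big_cons -cats1 !big_cat !big_seq1 /=.
have eCh : Ch k * PXi t = (-1) ^+ size t * (PXi t * Ch k) by apply: Ch_PXi.
have eXi : PXi s * Xi k = (-1) ^+ size s * (Xi k * PXi s).
  by rewrite Xi_PXi mulrA -exprD -signr_odd addnn odd_double mul1r.
have eXi' : PCh t * Xi k = (-1) ^+ size t * (Xi k * PCh t).
  by rewrite Xi_PCh // mulrA -exprD -signr_odd addnn odd_double mul1r.
transitivity ((-1) ^+ size t * (PCh s * PXi t * (Xi k * x * Ch k) * (PCh t * PXi s * p))).
  by rewrite [PCh s * (_ * _)]mulrA commr_sign -!mulrA.
have sgnA (a : F) m b : a * ((-1) ^+ m * b) = (-1) ^+ m * (a * b).
  by rewrite mulrA commr_sign mulrA.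
pose sgn := (sgnA (PCh s), sgnA (PXi t), sgnA (PCh t), sgnA x, sgnA (Ch k)).
rewrite e mulrN -!mulrA [Ch k * (PXi t * _)]mulrA eCh [PXi s * (Xi k * _)]mulrA eXi.
rewrite -!mulrA !sgn [PCh t * (Xi k * _)]mulrA eXi' -!mulrA !sgn.
have -> : (-1) ^+ n = (-1) ^+ (size s + size t).+1 :> F by rewrite -sz.
set w := PCh s * _; rewrite 3!mulrA -!exprD -mulNr -mulN1r -exprS; congr (_ * _).
rewrite -signr_odd -[RHS]signr_odd; congr (_ ^+ nat_of_bool _).
by rewrite /= !oddD; do 2!case: odd.
Qed.

(** The indices change sides one at a time, [s] collecting those already exchanged. Each of the [n]
    steps costs [(-1) ^+ n], and [n * n] has the parity of [n]. *)
Lemma clifford_exchange :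
  \prod_i Xi i * x * \prod_i Ch i * p = (-1) ^+ n * (\prod_i Ch i * x * \prod_i Xi i * p).
Proof.
have T t s : uniq (s ++ t) -> perm_eq (s ++ t) (index_enum 'I_n) ->
    PCh s * PXi t * x * PCh t * PXi s * p =
    ((-1) ^+ n) ^+ size t * (PCh (s ++ t) * x * PXi (s ++ t) * p).
  elim: t s => [|k t IHt] s u pst.
    by rewrite !big_nil cats0 !mulr1 mul1r.
  by rewrite exchange_step // IHt ?cat_rcons // mulrA -exprS.
have := T (index_enum 'I_n) [::] (index_enum_uniq _) (perm_refl _).
rewrite !big_nil mul1r mulr1 => ->; rewrite /index_enum -enumT size_enum_ord.
by rewrite -exprM -signr_odd oddM andbb signr_odd.
Qed.

End CliffordPair.

(* Canonical anticommutation relations: creation operators e, annihilation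
   operators d and vacuum p. *)
Record car (F : nzRingType) (T : eqType) (e d : T -> F) (p : F) : Prop := Car {
  car_ee : forall i j, anticomm (e i) (e j);
  car_dd : forall i j, anticomm (d i) (d j);
  car_e2 : forall i, e i * e i = 0;
  car_d2 : forall i, d i * d i = 0;
  car_de : forall i j, d i * e j = (i == j)%:R - e j * d i;
  car_dp : forall i, d i * p = 0
}.

Section CarTheory.
Variables (F : nzRingType) (T : finType) (e d : T -> F) (p : F).
Hypothesis edp : car e d p.

Lemma car_de_neq i j : i != j -> anticomm (d i) (e j).
Proof. by move=> ij; rewrite /anticomm (car_de edp) (negPf ij) sub0r. Qed.

Lemma car_ed_neq i j : i != j -> anticomm (e i) (d j).
Proof. by move=> ij; apply/anticomm_sym/car_de_neq; rewrite eq_sym. Qed.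

Lemma car_annihilate r i : i \notin r -> d i * (\prod_(j <- r) e j * p) = 0.
Proof.
move=> ir; rewrite mulrA anticomm_prod => [|j jr]; last first.
  by apply: car_de_neq; apply: contraNneq ir => ->.
by rewrite -!mulrA (car_dp edp) !mulr0.
Qed.

(** Annihilation operators strip the creation operators one by one: [d i * e i] is [1 - e i * d i],
    and [d i] kills the remaining product on the vacuum. This brings a fermionic identity back to an
    identity without fermions. *)
Lemma car_cancel r a : uniq r -> (forall i, GRing.comm a (d i)) ->
  a * (\prod_(j <- r) e j * p) = 0 -> a * p = 0.
Proof.
move=> + ad; elim: r => [|i r IHr] /=; first by rewrite big_nil mul1r.
case/andP=> ir ur; rewrite big_cons -mulrA => h; apply: IHr => //.
have := congr1 ( *%R (d i)) h; rewrite mulr0 mulrA -ad -mulrA.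
rewrite [d i * (e i * _)]mulrA (car_de edp) eqxx mulrBl mul1r -[e i * _ * _]mulrA.
by rewrite car_annihilate // mulr0 subr0.
Qed.

End CarTheory.

(** * Fermions over an arbitrary ring *)

Definition mx22 (F : nzRingType) (a b c d : F) : 'M[F]_2 :=
  \matrix_(i, j) if i == 0 then if j == 0 then a else b
                 else if j == 0 then c else d.

Section Mx22.
Variable F : nzRingType.
Implicit Types a b c d : F.

Lemma mx22M a b c d a' b' c' d' : mx22 a b c d * mx22 a' b' c' d' =
  mx22 (a * a' + b * c') (a * b' + b * d') (c * a' + d * c') (c * b' + d * d').
Proof.
apply/matrixP => i j; rewrite !mxE !big_ord_recl big_ord0 !mxE /= addr0.
by case: (i == 0); case: (j == 0).
Qed.

Lemma mx22D a b c d a' b' c' d' : mx22 a b c d + mx22 a' b' c' d' =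
  mx22 (a + a') (b + b') (c + c') (d + d').
Proof. by apply/matrixP => i j; rewrite !mxE; case: ifP; case: ifP. Qed.

Lemma mx22N a b c d : - mx22 a b c d = mx22 (- a) (- b) (- c) (- d).
Proof. by apply/matrixP => i j; rewrite !mxE; case: ifP; case: ifP. Qed.

Lemma mx22_scalar a : a%:M = mx22 a 0 0 a.
Proof.
apply/matrixP => i j; rewrite !mxE.
by case: i => [[|[|?]] ?] //; case: j => [[|[|?]] ?].
Qed.

End Mx22.

(** Jordan-Wigner construction: a new mode acts by elementary 2 x 2 matrices, and an old mode
    becomes diagonal with opposite signs, so that it anticommutes with the new one. The vacuum is
    encoded as an element of the ring, with [p] in a corner, rather than as a vector; the last
    clause says that it detects zero in [A]. *)
Lemma car_exists_ord (A : nzRingType) (m : nat) :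
  exists (F : nzRingType) (f : {rmorphism A -> F}) (e d : 'I_m -> F) (p : F),
  [/\ car e d p, forall a i, GRing.comm (f a) (e i), forall a i, GRing.comm (f a) (d i)
    & forall a, f a * p = 0 -> a = 0].
Proof.
elim: m => [|m [F [f [e [d [p [edp fe fd fp]]]]]]].
  exists A, idfun, (fun=> 0), (fun=> 0), 1; split.
  - by split=> -[].
  - by move=> a [].
  - by move=> a [].
  - by move=> a /=; rewrite mulr1.
pose e' (i : 'I_m.+1) : 'M[F]_2 :=
  if unlift ord0 i is Some j then mx22 (e j) 0 0 (- e j) else mx22 0 0 1 0.
pose d' (i : 'I_m.+1) : 'M[F]_2 :=
  if unlift ord0 i is Some j then mx22 (d j) 0 0 (- d j) else mx22 0 1 0 0.
pose simp := (@mulr0, @mul0r, @mulr1, @mul1r, @addr0, @add0r, @oppr0,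
  @subr0, @sub0r, @mulrN, @mulNr, @opprK).
have mx0 : 0 = mx22 (0 : F) 0 0 0 by rewrite -mx22_scalar raddf0.
have mx1 : 1 = mx22 (1 : F) 0 0 1 by rewrite -mx22_scalar.
exists 'M[F]_2, (scalar_mx \o f), e', d', (mx22 p 0 0 0); split.
- split.
  + move=> i j; rewrite /anticomm /e'; case: unliftP => [i' _|_]; case: unliftP => [j' _|_];
      rewrite !mx22M mx22N !simp.
    * by rewrite (car_ee edp i' j').
    * by [].
    * by [].
    * by [].
  + move=> i j; rewrite /anticomm /d'; case: unliftP => [i' _|_]; case: unliftP => [j' _|_];
      rewrite !mx22M mx22N !simp.
    * by rewrite (car_dd edp i' j').
    * by [].
    * by [].
    * by [].
  + by move=> i; rewrite /e'; case: unliftP => [i' _|_]; rewrite !mx22M !simp mx0 ?(car_e2 edp i').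
  + by move=> i; rewrite /d'; case: unliftP => [i' _|_]; rewrite !mx22M !simp mx0 ?(car_d2 edp i').
  + move=> i j; rewrite /e' /d'; case: unliftP => [i' ->|->]; case: unliftP => [j' ->|->];
      rewrite !mx22M mx22N !simp.
    * rewrite (inj_eq (@lift_inj _ _)) (car_de edp i' j').
      by case: (i' == j'); rewrite ?mulr1n ?mulr0n ?mx0 ?mx1 mx22D !simp.
    * by [].
    * by [].
    * by rewrite eqxx mulr1n mx1 mx22D !simp subrr.
  + by move=> i; rewrite /d'; case: unliftP => [i' _|_]; rewrite !mx22M !simp mx0 ?(car_dp edp i').
- by move=> a i; rewrite /GRing.comm /= mx22_scalar /e'; case: unliftP => [i' _|_];
    rewrite !mx22M !simp // (fe a i').
- by move=> a i; rewrite /GRing.comm /= mx22_scalar /d'; case: unliftP => [i' _|_];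
    rewrite !mx22M !simp // (fd a i').
- move=> a /=; rewrite mx22_scalar mx22M !simp => /matrixP/(_ 0 0).
  by rewrite !mxE => /fp.
Qed.

Lemma car_exists (A : nzRingType) (T : finType) :
  exists (F : nzRingType) (f : {rmorphism A -> F}) (e d : T -> F) (p : F),
  [/\ car e d p, forall a i, GRing.comm (f a) (e i), forall a i, GRing.comm (f a) (d i)
    & forall a, f a * p = 0 -> a = 0].
Proof.
have [F [f [e [d [p [edp fe fd fp]]]]]] := car_exists_ord A #|T|.
exists F, f, (fun t => e (enum_rank t)), (fun t => d (enum_rank t)), p.
split; [|by move=> a i; apply: fe|by move=> a i; apply: fd|exact: fp].
split.
- by move=> i j; apply: (car_ee edp).
- by move=> i j; apply: (car_dd edp).
- by move=> i; apply: (car_e2 edp).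
- by move=> i; apply: (car_d2 edp).
- by move=> i j; rewrite (car_de edp) (inj_eq enum_rank_inj).
- by move=> i; apply: (car_dp edp).
Qed.

(** The terms at (i, j) and (j, i) cancel in pairs, which avoids a division by 2. *)
Lemma sum_anticomm_sym (F : nzRingType) n (e : 'I_n -> F) (X : 'I_n -> 'I_n -> F) :
    (forall i j, anticomm (e i) (e j)) -> (forall i, e i * e i = 0) ->
    (forall i j, X i j = X j i) ->
  \sum_i \sum_j e i * e j * X i j = 0.
Proof.
move=> ea e2 Xs; rewrite pair_big /=.
rewrite (bigID (fun ij : 'I_n * 'I_n => (ij.1 < ij.2)%N)) /=.
rewrite [X in _ + X](bigID (fun ij : 'I_n * 'I_n => (ij.1 == ij.2))) /=.
rewrite [X in _ + (X + _)]big1 ?add0r => [|[i j] /= /andP[_ /eqP<-]]; last by rewrite e2 mul0r.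
rewrite (reindex (fun ij : 'I_n * 'I_n => (ij.2, ij.1))) /=; last first.
  by exists (fun ij => (ij.2, ij.1)) => -[].
rewrite [X in X + _](eq_bigl (fun ij : 'I_n * 'I_n => ~~ (ij.1 < ij.2)%N && (ij.1 != ij.2))).
  rewrite -big_split big1 // => -[i j] _ /=.
  by rewrite Xs ea mulNr addNr.
by move=> [i j] /=; rewrite -leqNgt ltn_neqAle eq_sym andbC.
Qed.

(** * Commuting column determinants *)

Section CoreIdentities.
Variables (F : nzRingType) (n : nat) (e d : 'I_n + 'I_n -> F) (p x s : F).
Variables (M W : 'M[F]_n).
Hypothesis edp : car e d p.
Local Notation psi i := (e (inl i)).
Local Notation eta i := (e (inr i)).
Local Notation dpsi i := (d (inl i)).
Local Notation deta i := (d (inr i)).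
Hypothesis xe : forall i, GRing.comm x (e i).
Hypothesis xd : forall i, GRing.comm x (d i).
Hypothesis se : forall i, GRing.comm s (e i).
Hypothesis sd : forall i, GRing.comm s (d i).
Hypothesis Me : forall i j k, GRing.comm (M i j) (e k).
Hypothesis Md : forall i j k, GRing.comm (M i j) (d k).
Hypothesis We : forall i j k, GRing.comm (W i j) (e k).
Hypothesis Wd : forall i j k, GRing.comm (W i j) (d k).
Hypothesis xs : x * s = 1.
Hypothesis sx : s * x = 1.
Hypothesis Mx : forall i j, M i j * x = x * M i j + (i == j)%:R.
Hypothesis Wx : forall i j, W i j * x = x * W i j - (i == j)%:R.
Hypothesis MM : forall i j k l, M i j * M k l - M k l * M i j = M k j * M i l - M i l * M k j.
Hypothesis MM2 : forall i j k, M i j * M k j = M k j * M i j.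
Hypothesis WW : forall i j k l, W i j * W k l - W k l * W i j = W k j * W i l - W i l * W k j.
Hypothesis WW2 : forall i j k, W i j * W k j = W k j * W i j.
Hypothesis MW : forall i j k l, x * (M i j * W k l - W k l * M i j) =
  (M l j + W j l) *+ (i == k) - (M i k + W k i) *+ (j == l).

Let ee := car_ee edp. Let dd := car_dd edp. Let e2 := car_e2 edp. Let d2 := car_d2 edp.

(** The columns of [M] and [W] as linear forms in two sets of fermions. In the application [x] is y
    - z, [s] its inverse, [M] is d_y - L(y) and [W] is d_z + L^T(z). *)
Definition phi j := \sum_i psi i * M i j.
Definition chi j := \sum_i eta i * W i j.
Definition theta := \sum_i psi i * eta i.
Variable th : F.
Hypothesis thE : th = s * theta.

Lemma anticommMr2 (a b c : F) : GRing.comm c a -> anticomm c b -> anticomm c (a * b).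
Proof. by move=> ca cb; rewrite /anticomm mulrA ca -mulrA cb mulrN mulrA. Qed.

Lemma dpsi_psi i j : dpsi i * psi j = (i == j)%:R - psi j * dpsi i.
Proof. exact: (car_de edp). Qed.
Lemma deta_eta i j : deta i * eta j = (i == j)%:R - eta j * deta i.
Proof. exact: (car_de edp). Qed.

Lemma psi_phi i j : anticomm (psi i) (phi j).
Proof. by apply: anticomm_sumr => k _; apply: anticommMr; [apply: ee | apply/commr_sym/Me]. Qed.
Lemma eta_phi i j : anticomm (eta i) (phi j).
Proof. by apply: anticomm_sumr => k _; apply: anticommMr; [apply: ee | apply/commr_sym/Me]. Qed.
Lemma psi_chi i j : anticomm (psi i) (chi j).
Proof. by apply: anticomm_sumr => k _; apply: anticommMr; [apply: ee | apply/commr_sym/We]. Qed.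
Lemma eta_chi i j : anticomm (eta i) (chi j).
Proof. by apply: anticomm_sumr => k _; apply: anticommMr; [apply: ee | apply/commr_sym/We]. Qed.
Lemma deta_phi i j : anticomm (deta i) (phi j).
Proof.
by apply: anticomm_sumr => k _; apply: anticommMr; [apply: (car_de_neq edp) | apply/commr_sym/Md].
Qed.
Lemma dpsi_chi i j : anticomm (dpsi i) (chi j).
Proof.
by apply: anticomm_sumr => k _; apply: anticommMr; [apply: (car_de_neq edp) | apply/commr_sym/Wd].
Qed.

Lemma sum_delta (a : 'I_n -> F) i : \sum_j (i == j)%:R * a j = a i.
Proof.
rewrite (bigD1 i) //= eqxx mul1r big1 ?addr0 // => j.
by rewrite eq_sym => /negPf->; rewrite mul0r.
Qed.

Lemma dpsi_phi i j : dpsi i * phi j = M i j - phi j * dpsi i.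
Proof.
rewrite mulr_sumr; under eq_bigr do rewrite mulrA dpsi_psi mulrBl.
rewrite sumrB (sum_delta (M^~ j)) mulr_suml; congr (_ - _).
by apply: eq_bigr => k _; rewrite -!mulrA Md.
Qed.
Lemma deta_chi i j : deta i * chi j = W i j - chi j * deta i.
Proof.
rewrite mulr_sumr; under eq_bigr do rewrite mulrA deta_eta mulrBl.
rewrite sumrB (sum_delta (W^~ j)) mulr_suml; congr (_ - _).
by apply: eq_bigr => k _; rewrite -!mulrA Wd.
Qed.

Lemma e_theta k : GRing.comm (e k) theta.
Proof.
apply: commr_sum => i _; rewrite /GRing.comm mulrA (ee k) mulNr -[_ * e k * _]mulrA (ee k).
by rewrite mulrN opprK mulrA.
Qed.

Lemma deta_theta j : deta j * theta = theta * deta j - psi j.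
Proof.
rewrite mulr_sumr; under eq_bigr => i _.
  rewrite mulrA (car_de_neq edp) // mulNr -mulrA deta_eta mulrBr opprB commr_nat.
  over.
rewrite sumrB mulr_suml (sum_delta (fun i => psi i)); congr (_ - _).
by apply: eq_bigr => i _; rewrite mulrA.
Qed.

Lemma dpsi_theta j : dpsi j * theta = theta * dpsi j + eta j.
Proof.
rewrite mulr_sumr; under eq_bigr => i _.
  rewrite mulrA dpsi_psi mulrBl -mulrA (car_de_neq edp) // mulrN opprK mulrA.
  over.
by rewrite big_split (sum_delta (fun i => eta i)) mulr_suml addrC.
Qed.

Lemma Ms i j : M i j * s = s * M i j - (i == j)%:R * (s * s).
Proof.
have : s * (M i j * x) * s = s * (x * M i j + (i == j)%:R) * s by rewrite Mx.
rewrite -mulrA -(mulrA (M i j)) xs mulr1 mulrDr mulrDl (mulrA s x) sx mul1r => ->.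
by rewrite commr_nat -!mulrA addrK.
Qed.

Lemma Ws i j : W i j * s = s * W i j + (i == j)%:R * (s * s).
Proof.
have : s * (W i j * x) * s = s * (x * W i j - (i == j)%:R) * s by rewrite Wx.
rewrite -mulrA -(mulrA (W i j)) xs mulr1 mulrBr mulrBl (mulrA s x) sx mul1r => ->.
by rewrite commr_nat -!mulrA subrK.
Qed.

Lemma phi_s j : phi j * s = s * phi j - s * (s * psi j).
Proof.
rewrite mulr_suml mulr_sumr -[psi j](sum_delta (fun i => psi i)) !mulr_sumr -sumrB.
apply: eq_bigr => i _; rewrite -mulrA Ms mulrBr !mulrA -se; congr (_ - _).
rewrite eq_sym; case: (j == i); rewrite ?(mulr0, mul0r) ?mulr1 ?mul1r //.
by rewrite -se -!mulrA -se.
Qed.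

Lemma chi_s j : chi j * s = s * chi j + s * (s * eta j).
Proof.
rewrite mulr_suml mulr_sumr -[eta j](sum_delta (fun i => eta i)) !mulr_sumr -big_split.
apply: eq_bigr => i _; rewrite -mulrA Ws mulrDr !mulrA -se; congr (_ + _).
rewrite eq_sym; case: (j == i); rewrite ?(mulr0, mul0r) ?mulr1 ?mul1r //.
by rewrite -se -!mulrA -se.
Qed.

Lemma phi_x j : phi j * x = x * phi j + psi j.
Proof.
rewrite mulr_suml mulr_sumr -[psi j](sum_delta (fun i => psi i)) -big_split.
apply: eq_bigr => i _; rewrite -mulrA Mx mulrDr !mulrA -xe; congr (_ + _).
by rewrite eq_sym commr_nat.
Qed.

Lemma chi_x j : chi j * x = x * chi j - eta j.
Proof.
rewrite mulr_suml mulr_sumr -[eta j](sum_delta (fun i => eta i)) -sumrB.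
apply: eq_bigr => i _; rewrite -mulrA Wx mulrBr !mulrA -xe; congr (_ - _).
by rewrite eq_sym commr_nat.
Qed.

Lemma phi_theta j : phi j * theta = theta * phi j.
Proof.
suff h : GRing.comm theta (phi j) by [].
apply: commr_sum => i _; apply: commrM; first exact/commr_sym/e_theta.
by apply/commr_sym/commr_sum => k _; apply: commrM.
Qed.

Lemma chi_theta j : chi j * theta = theta * chi j.
Proof.
suff h : GRing.comm theta (chi j) by [].
apply: commr_sum => i _; apply: commrM; first exact/commr_sym/e_theta.
by apply/commr_sym/commr_sum => k _; apply: commrM.
Qed.

Lemma s_theta : GRing.comm s theta.
Proof. by apply: commr_sum => i _; apply: commrM. Qed.

Lemma e_th k : e k * th = th * e k.
Proof. by rewrite thE mulrA -se -mulrA e_theta mulrA. Qed.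

Lemma phi_th j : phi j * th = th * phi j - s * psi j * th.
Proof.
rewrite {1}thE mulrA phi_s mulrBl -(mulrA s (phi j)) phi_theta (mulrA s theta) -thE; congr (_ - _).
by rewrite thE [RHS]mulrA -(mulrA s (psi j)) -se.
Qed.

Lemma chi_th j : chi j * th = th * chi j + s * eta j * th.
Proof.
rewrite {1}thE mulrA chi_s mulrDl -(mulrA s (chi j)) chi_theta (mulrA s theta) -thE; congr (_ + _).
by rewrite thE [RHS]mulrA -(mulrA s (eta j)) -se.
Qed.

Lemma deta_th j : deta j * th = th * deta j - s * psi j.
Proof. by rewrite thE mulrA -sd -mulrA deta_theta mulrBr mulrA. Qed.

Lemma dpsi_th j : dpsi j * th = th * dpsi j + s * eta j.
Proof. by rewrite thE mulrA -sd -mulrA dpsi_theta mulrDr mulrA. Qed.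

(* The correction terms make Xi j and Ch l anticommute for j != l; they act
   trivially on the vacuum. *)
Definition Xi j := phi j - th * deta j.
Definition Ch j := chi j - th * dpsi j.

Lemma s_th : s * th = th * s.
Proof. by rewrite thE -[RHS]mulrA -s_theta. Qed.

Lemma Xi_th j : Xi j * th = th * Xi j.
Proof.
rewrite /Xi mulrBl phi_th -(mulrA th (deta j)) deta_th !mulrBr opprB.
by rewrite (mulrA th s) -s_th -(mulrA s th) -e_th mulrA addrA subrK.
Qed.

Lemma Ch_th j : Ch j * th = th * Ch j.
Proof.
rewrite /Ch mulrBl chi_th -(mulrA th (dpsi j)) dpsi_th mulrBr mulrDr opprD.
by rewrite (mulrA th s) -s_th -(mulrA s th) -e_th (mulrA s) addrA addrAC addrK.
Qed.

(** The last hypothesis makes the commutator of [a i j] and [a k l] symmetric in [i] and [k], and it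
    is summed against the antisymmetric [e1 i * e1 k]. *)
Lemma sum_comm_anti (a : 'I_n -> 'I_n -> F) j l (e1 : 'I_n -> F) :
    (forall i k, anticomm (e1 i) (e1 k)) -> (forall i, e1 i * e1 i = 0) ->
    (forall i k m, GRing.comm (a i k) (e1 m)) ->
    (forall i j k l, a i j * a k l - a k l * a i j = a k j * a i l - a i l * a k j) ->
  anticomm (\sum_i e1 i * a i j) (\sum_i e1 i * a i l).
Proof.
move=> ea e20 ae aa; apply/eqP; rewrite -addr_eq0; apply/eqP.
rewrite !mulr_suml.
under eq_bigr do rewrite mulr_sumr.
under [X in _ + X]eq_bigr do rewrite mulr_sumr.
rewrite [X in _ + X]exchange_big -big_split /=.
rewrite -[RHS](@sum_anticomm_sym _ _ e1 (fun i k => a i j * a k l - a k l * a i j)) //.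
apply: eq_bigr => i _; rewrite -big_split; apply: eq_bigr => k _ /=.
have swap (u v w z : F) : GRing.comm v w -> u * v * (w * z) = u * w * (v * z).
  by move=> vw; rewrite -!mulrA (mulrA v) vw -mulrA.
by rewrite swap // [X in _ + X]swap // (ea k) mulNr -mulrBr.
Qed.

Lemma phi_phi j l : anticomm (phi j) (phi l).
Proof. exact: sum_comm_anti. Qed.

Lemma chi_chi j l : anticomm (chi j) (chi l).
Proof. exact: sum_comm_anti. Qed.

Lemma anti_Xi j k : Xi j * Xi k =
  phi j * phi k + th * (phi k * deta j) - th * (phi j * deta k) + th * th * (deta j * deta k).
Proof.
rewrite [Xi k]/Xi mulrBr (mulrA (Xi j)) Xi_th -(mulrA th (Xi j)) /Xi !mulrBl.
rewrite -(mulrA th (deta j)) deta_phi mulrN opprK mulrBr opprB.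
rewrite -(mulrA th (deta j)) !mulrA addrA.
by rewrite [LHS]addrAC.
Qed.

Lemma Xi_Xi j k : anticomm (Xi j) (Xi k).
Proof.
rewrite /anticomm !anti_Xi phi_phi dd !opprD !opprK !mulrN -!addrA; congr (_ + _).
by rewrite addrCA.
Qed.

Lemma sum_comm_sq (a : 'I_n -> 'I_n -> F) j (e1 : 'I_n -> F) :
    (forall i k, anticomm (e1 i) (e1 k)) -> (forall i, e1 i * e1 i = 0) ->
    (forall i k m, GRing.comm (a i k) (e1 m)) ->
    (forall i j k, a i j * a k j = a k j * a i j) ->
  (\sum_i e1 i * a i j) * (\sum_i e1 i * a i j) = 0.
Proof.
move=> ea e20 ae aa; rewrite mulr_suml; under eq_bigr do rewrite mulr_sumr.
rewrite -[RHS](@sum_anticomm_sym _ _ e1 (fun i k => a i j * a k j)) //.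
apply: eq_bigr => i _; apply: eq_bigr => k _.
by rewrite -!mulrA (mulrA (a i j)) ae -mulrA.
Qed.

Lemma Xi2 j : Xi j * Xi j = 0.
Proof. by rewrite anti_Xi d2 mulr0 addr0 addrK; apply: sum_comm_sq. Qed.

Lemma anti_Ch j k : Ch j * Ch k =
  chi j * chi k + th * (chi k * dpsi j) - th * (chi j * dpsi k) + th * th * (dpsi j * dpsi k).
Proof.
rewrite [Ch k]/Ch mulrBr (mulrA (Ch j)) Ch_th -(mulrA th (Ch j)) /Ch !mulrBl.
rewrite -(mulrA th (dpsi j)) dpsi_chi mulrN opprK mulrBr opprB.
rewrite -(mulrA th (dpsi j)) !mulrA addrA.
by rewrite [LHS]addrAC.
Qed.

Lemma Ch_Ch j k : anticomm (Ch j) (Ch k).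
Proof.
rewrite /anticomm !anti_Ch chi_chi dd !opprD !opprK !mulrN -!addrA; congr (_ + _).
by rewrite addrCA.
Qed.

Lemma Ch2 j : Ch j * Ch j = 0.
Proof. by rewrite anti_Ch d2 mulr0 addr0 addrK; apply: sum_comm_sq. Qed.

Definition psichi := \sum_i psi i * chi i.
Definition etaphi := \sum_i eta i * phi i.

(** Contraction of [MW] with [psi i * eta k]: the Kronecker symbol in the row indices assembles
    [theta], the one in the column indices gives the defect at [j = l]. *)
Lemma x_phi_chi j l : x * (phi j * chi l + chi l * phi j) =
  theta * (M l j + W j l) - (psichi - etaphi) *+ (j == l).
Proof.
have -> : phi j * chi l + chi l * phi j =
    \sum_i \sum_k psi i * eta k * (M i j * W k l - W k l * M i j).
  rewrite !mulr_suml; under eq_bigr do rewrite mulr_sumr.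
  under [X in _ + X]eq_bigr do rewrite mulr_sumr.
  rewrite [X in _ + X]exchange_big -big_split /=.
  apply: eq_bigr => i _; rewrite -big_split; apply: eq_bigr => k _ /=.
  have swap (u v w z : F) : GRing.comm v w -> u * v * (w * z) = u * w * (v * z).
    by move=> vw; rewrite -!mulrA (mulrA v) vw -mulrA.
  by rewrite swap // [X in _ + X]swap // (ee (inr k)) mulNr -mulrBr.
rewrite mulr_sumr; under eq_bigr => i _.
  rewrite mulr_sumr; under eq_bigr => k _.
    rewrite mulrA (_ : x * _ = psi i * eta k * x); last by apply: commrM.
    rewrite -mulrA MW mulrBr mulrnAr mulrnAr.
    over.
  rewrite sumrB (bigD1 i) //= eqxx mulr1n big1 ?addr0 => [|k]; last first.
    by rewrite eq_sym => /negPf->.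
  over.
rewrite sumrB -mulr_suml; congr (_ - _).
transitivity ((\sum_i \sum_k psi i * eta k * (M i k + W k i)) *+ (j == l)).
  rewrite -sumrMnl; apply: eq_bigr => i _; rewrite -sumrMnl //.
congr (_ *+ _); under eq_bigr => i _.
  under eq_bigr do rewrite mulrDr.
  rewrite big_split. over.
rewrite big_split addrC /psichi /etaphi; congr (_ + _) => /=; last first.
  by apply: eq_bigr => i _; rewrite mulr_sumr; apply: eq_bigr => k _; rewrite mulrA.
rewrite -sumrN exchange_big; apply: eq_bigr => k _ /=.
rewrite mulr_sumr -sumrN; apply: eq_bigr => i _.
by rewrite (ee (inl i)) mulNr mulrA.
Qed.

(** As [th] commutes with [Xi] and [Ch], the terms with an annihilation operator cancel in pairs.
    What remains of the corrections are the entries of [W] and [M] released by [deta_chi] and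
    [dpsi_phi]. *)
Lemma Xi_Ch j l :
  Xi j * Ch l + Ch l * Xi j = phi j * chi l + chi l * phi j - th * (M l j + W j l).
Proof.
have -> : Xi j * Ch l = phi j * chi l - th * W j l + th * (chi l * deta j)
    - (th * (phi j * dpsi l) - th * (th * (deta j * dpsi l))).
  rewrite [Ch l]/Ch mulrBr (mulrA (Xi j)) Xi_th -(mulrA th (Xi j)) /Xi !mulrBl.
  rewrite -(mulrA th (deta j)) deta_chi -(mulrA th (deta j)) (mulrBr th (W j l)) opprB.
  by rewrite (mulrBr th (phi j * _)) addrA [_ + _ - th * W j l]addrAC.
have -> : Ch l * Xi j = chi l * phi j - th * M l j + th * (phi j * dpsi l)
    - (th * (chi l * deta j) - th * (th * (dpsi l * deta j))).
  rewrite [Xi j]/Xi mulrBr (mulrA (Ch l)) Ch_th -(mulrA th (Ch l)) /Ch !mulrBl.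
  rewrite -(mulrA th (dpsi l)) dpsi_phi -(mulrA th (dpsi l)) (mulrBr th (M l j)) opprB.
  by rewrite (mulrBr th (chi l * _)) addrA [_ + _ - th * M l j]addrAC.
have -> : deta j * dpsi l = - (dpsi l * deta j) by apply: dd.
have cancel (a b c d' f g h : F) :
    a - b + c - (d' - - h) + (f - g + d' - (c - h)) = a + f - (g + b).
  rewrite !opprK !opprD !opprK !addrA.
  by rewrite [LHS](ACl (1*6*7*2*3*9*4*8*5*10))%AC /= addrK !addrNK.
by rewrite !mulrN cancel mulrDr.
Qed.

Lemma Xi_Ch_neq j l : j != l -> anticomm (Xi j) (Ch l).
Proof.
move=> jl; apply/eqP; rewrite -addr_eq0 Xi_Ch; apply/eqP.
rewrite -[LHS]mul1r -sx -mulrA mulrBr x_phi_chi (negPf jl) mulr0n subr0.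
by rewrite thE !mulrA xs mul1r subrr mulr0.
Qed.

(** The number of [psi] fermions minus the number of [eta] fermions. The element [th] has weight
    zero, so [Xi] has weight 1 and [Ch] weight -1. *)
Definition weight := \sum_i psi i * dpsi i - \sum_i eta i * deta i.

(** Carrying [x] to the left of [Xi k] and [Ch k] creates [psi k * Ch k] and [- eta k * Xi k]; then
    [x] times the anticommutator is the defect of [x_phi_chi]. Writing [phi] and [chi] through [Xi]
    and [Ch] turns this defect into the two sums and the weight. *)
Lemma Xi_x_Ch k : Xi k * x * Ch k + Ch k * x * Xi k =
  psi k * Ch k - eta k * Xi k - \sum_i psi i * Ch i + \sum_i eta i * Xi i - th * weight.
Proof.
have thx : th * x = x * th.
  by rewrite thE -mulrA (_ : theta * x = x * theta) ?mulrA ?sx ?xs //;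
    apply/commr_sym/commr_sum => i _; apply: commrM.
have -> : Xi k * x = x * Xi k + psi k.
  by rewrite /Xi mulrBl mulrBr phi_x -mulrA -xd (mulrA th) thx -(mulrA x th) addrAC.
have -> : Ch k * x = x * Ch k - eta k.
  by rewrite /Ch mulrBl mulrBr chi_x -mulrA -xd (mulrA th) thx -(mulrA x th) addrAC.
rewrite mulrDl mulrBl -!mulrA addrACA -mulrDr.
have -> : x * (Xi k * Ch k + Ch k * Xi k) = - psichi + etaphi.
  rewrite Xi_Ch mulrBr x_phi_chi eqxx mulr1n thE mulrA mulrA xs mul1r.
  by rewrite addrAC subrr sub0r opprB addrC.
have -> : psichi = \sum_i psi i * Ch i + th * \sum_i psi i * dpsi i.
  rewrite mulr_sumr -big_split; apply: eq_bigr => i _ /=.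
  by rewrite /Ch mulrBr [psi i * (th * _)]mulrA e_th -mulrA subrK.
have -> : etaphi = \sum_i eta i * Xi i + th * \sum_i eta i * deta i.
  rewrite mulr_sumr -big_split; apply: eq_bigr => i _ /=.
  by rewrite /Xi mulrBr [eta i * (th * _)]mulrA e_th -mulrA subrK.
rewrite /weight (mulrBr th) opprB !opprD !addrA.
by rewrite [LHS](ACl (5*6*1*3*4*2))%AC.
Qed.

Lemma psi_Ch i : psi i * Ch i = - (Ch i * psi i) - th.
Proof.
rewrite /Ch mulrBr mulrBl psi_chi [psi i * (th * _)]mulrA e_th -!mulrA.
by rewrite dpsi_psi eqxx mulrBr mulr1 opprB [RHS](ACl (3*2*1*4))%AC /= addrK.
Qed.

Lemma eta_Xi i : eta i * Xi i = - (Xi i * eta i) - th.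
Proof.
rewrite /Xi mulrBr mulrBl eta_phi [eta i * (th * _)]mulrA e_th -!mulrA.
by rewrite deta_eta eqxx mulrBr mulr1 opprB [RHS](ACl (3*2*1*4))%AC /= addrK.
Qed.

Let npsi := \sum_i psi i * dpsi i.
Let neta := \sum_i eta i * deta i.

Lemma commManti (a b c : F) : anticomm a c -> anticomm b c -> GRing.comm (a * b) c.
Proof. by move=> ac bc; rewrite /GRing.comm -mulrA bc mulrN (mulrA a) ac mulNr opprK mulrA. Qed.

Lemma npsi_phi j : npsi * phi j = phi j * npsi + phi j.
Proof.
rewrite mulr_suml mulr_sumr -big_split; apply: eq_bigr => i _ /=.
by rewrite -mulrA dpsi_phi mulrBr [LHS]addrC (mulrA (psi i) (phi j)) psi_phi mulNr opprK mulrA.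
Qed.

Lemma neta_chi j : neta * chi j = chi j * neta + chi j.
Proof.
rewrite mulr_suml mulr_sumr -big_split; apply: eq_bigr => i _ /=.
by rewrite -mulrA deta_chi mulrBr [LHS]addrC (mulrA (eta i) (chi j)) eta_chi mulNr opprK mulrA.
Qed.

Lemma neta_phi j : GRing.comm neta (phi j).
Proof.
rewrite /neta; apply/commr_sym/commr_sum => i _; apply/commr_sym/commManti.
  exact: eta_phi.
exact: deta_phi.
Qed.

Lemma npsi_chi j : GRing.comm npsi (chi j).
Proof.
rewrite /npsi; apply/commr_sym/commr_sum => i _; apply/commr_sym/commManti.
  exact: psi_chi.
exact: dpsi_chi.
Qed.

Lemma npsi_th : npsi * th = th * npsi + th.
Proof.
rewrite [X in _ + X]thE mulr_suml !mulr_sumr -big_split; apply: eq_bigr => i _ /=.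
rewrite -mulrA dpsi_th mulrDr; congr (_ + _).
  by rewrite (mulrA (psi i)) e_th -mulrA.
by rewrite (mulrA (psi i)) -se -mulrA.
Qed.

Lemma neta_th : neta * th = th * neta + th.
Proof.
rewrite [X in _ + X]thE mulr_suml !mulr_sumr -big_split; apply: eq_bigr => i _ /=.
rewrite -mulrA deta_th mulrBr; congr (_ + _).
  by rewrite (mulrA (eta i)) e_th -mulrA.
by rewrite (mulrA (eta i)) -se -mulrA (ee (inr i)) mulrN opprK.
Qed.

Lemma npsi_dpsi j : npsi * dpsi j = dpsi j * npsi - dpsi j.
Proof.
apply/eqP; rewrite eq_sym subr_eq addrC; apply/eqP.
rewrite mulr_suml mulr_sumr -[X in X + _](sum_delta (fun i => dpsi i)) -big_split.
apply: eq_bigr => i _ /=; rewrite mulrA dpsi_psi mulrBl eq_sym; congr (_ + _).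
by rewrite -!mulrA (dd (inl j)) mulrN opprK.
Qed.

Lemma neta_deta j : neta * deta j = deta j * neta - deta j.
Proof.
apply/eqP; rewrite eq_sym subr_eq addrC; apply/eqP.
rewrite mulr_suml mulr_sumr -[X in X + _](sum_delta (fun i => deta i)) -big_split.
apply: eq_bigr => i _ /=; rewrite mulrA deta_eta mulrBl eq_sym; congr (_ + _).
by rewrite -!mulrA (dd (inr j)) mulrN opprK.
Qed.

Lemma npsi_deta j : GRing.comm npsi (deta j).
Proof.
rewrite /npsi; apply/commr_sym/commr_sum => i _; apply/commr_sym/commManti; last exact: dd.
exact: (car_ed_neq edp).
Qed.

Lemma neta_dpsi j : GRing.comm neta (dpsi j).
Proof.
rewrite /neta; apply/commr_sym/commr_sum => i _; apply/commr_sym/commManti; last exact: dd.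
exact: (car_ed_neq edp).
Qed.

Lemma weight_th : weight * th = th * weight.
Proof. by rewrite mulrBl npsi_th neta_th mulrBr opprD addrACA subrr addr0. Qed.

Lemma weight_Xi j : weight * Xi j = Xi j * (weight + 1).
Proof.
have wphi : weight * phi j = phi j * weight + phi j.
  by rewrite mulrBl npsi_phi neta_phi mulrBr addrAC.
have wdeta : weight * deta j = deta j * weight + deta j.
  by rewrite mulrBl npsi_deta neta_deta mulrBr opprB addrA addrAC.
rewrite (mulrDr (Xi j)) mulr1 /Xi (mulrBr weight) wphi (mulrA weight) weight_th -(mulrA th weight).
by rewrite wdeta (mulrDr th) opprD mulrBl addrACA (mulrA th).
Qed.

Lemma weight_Ch j : weight * Ch j = Ch j * (weight - 1).
Proof.
have wchi : weight * chi j = chi j * weight - chi j.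
  by rewrite mulrBl npsi_chi neta_chi mulrBr opprD addrA.
have wdpsi : weight * dpsi j = dpsi j * weight - dpsi j.
  by rewrite mulrBl npsi_dpsi neta_dpsi mulrBr addrAC.
rewrite (mulrBr (Ch j)) mulr1 /Ch (mulrBr weight) wchi (mulrA weight) weight_th -(mulrA th weight).
by rewrite wdpsi (mulrBr th) opprB mulrBl opprB (mulrA th) !addrA [LHS](ACl (1*4*3*2))%AC.
Qed.

Lemma weight_p : weight * p = 0.
Proof.
rewrite mulrBl !mulr_suml !big1 ?subr0 // => i _.
  by rewrite -mulrA (car_dp edp) mulr0.
by rewrite -mulrA (car_dp edp) mulr0.
Qed.

Lemma Xi_Ch_exchange : \prod_i Xi i * x * \prod_i Ch i * p =
  (-1) ^+ n * (\prod_i Ch i * x * \prod_i Xi i * p).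
Proof.
apply: (@clifford_exchange _ _ Xi Ch (fun i => psi i) (fun i => eta i) x th weight).
- exact: Xi_Xi.
- exact: Xi2.
- exact: Ch_Ch.
- exact: Ch2.
- exact: Xi_Ch_neq.
- exact: Xi_x_Ch.
- exact: psi_Ch.
- exact: eta_Xi.
- by move=> i; apply/commr_sym/Xi_th.
- by move=> i; apply/commr_sym/Ch_th.
- exact: weight_Xi.
- exact: weight_Ch.
- exact: weight_p.
Qed.

(** * Corrected forms on the vacuum and on filled levels *)

Local Notation psitop := (\prod_i psi i).
Local Notation etatop := (\prod_i eta i).

Lemma prod_Xi_vacuum r : \prod_(i <- r) Xi i * p = \prod_(i <- r) phi i * p.
Proof.
elim: r => [|i r IHr]; first by rewrite !big_nil.
rewrite !big_cons -!mulrA IHr /Xi mulrBl -mulrA [deta i * _]mulrA anticomm_prod.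
  by rewrite -!mulrA (car_dp edp) !mulr0 subr0.
by move=> j _; apply: deta_phi.
Qed.

Lemma prod_Ch_vacuum r : \prod_(i <- r) Ch i * p = \prod_(i <- r) chi i * p.
Proof.
elim: r => [|i r IHr]; first by rewrite !big_nil.
rewrite !big_cons -!mulrA IHr /Ch mulrBl -mulrA [dpsi i * _]mulrA anticomm_prod.
  by rewrite -!mulrA (car_dp edp) !mulr0 subr0.
by move=> j _; apply: dpsi_chi.
Qed.

Lemma psi_top k : psi k * psitop = 0.
Proof.
by apply: (proj1 (prod_anticomm_mem (E := fun i => psi i) (mem_index_enum k) _ (e2 _))).
Qed.

Lemma eta_top k : eta k * etatop = 0.
Proof.
by apply: (proj1 (prod_anticomm_mem (E := fun i => eta i) (mem_index_enum k) _ (e2 _))).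
Qed.

Lemma psi_dpsi_top k j : psi k * dpsi j * psitop = (k == j)%:R * psitop.
Proof.
have -> : psi k * dpsi j = (k == j)%:R - dpsi j * psi k by rewrite dpsi_psi eq_sym subKr.
by rewrite mulrBl -mulrA psi_top mulr0 subr0.
Qed.

Lemma eta_deta_top k j : eta k * deta j * etatop = (k == j)%:R * etatop.
Proof.
have -> : eta k * deta j = (k == j)%:R - deta j * eta k by rewrite deta_eta eq_sym subKr.
by rewrite mulrBl -mulrA eta_top mulr0 subr0.
Qed.

Lemma Xi_etatop j Y : (forall k, GRing.comm (eta k * deta j) Y) ->
  Xi j * (Y * etatop) = (phi j - s * psi j) * (Y * etatop).
Proof.
move=> hY; rewrite /Xi !mulrBl; congr (_ - _).
rewrite thE -!mulrA; congr (_ * _); rewrite mulr_suml -[psi j](sum_delta (fun i => psi i)).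
rewrite mulr_suml; apply: eq_bigr => k _.
have -> : psi k * eta k * (deta j * (Y * etatop)) = psi k * (eta k * deta j * Y * etatop).
  by rewrite -!mulrA.
by rewrite hY -mulrA eta_deta_top eq_sym; case: (j == k); rewrite ?mul1r ?mul0r ?mulr0.
Qed.

Lemma Ch_psitop j Y : (forall k, GRing.comm (psi k * dpsi j) Y) ->
  Ch j * (Y * psitop) = (chi j + s * eta j) * (Y * psitop).
Proof.
move=> hY; rewrite /Ch mulrBl mulrDl; congr (_ + _).
rewrite thE -!mulrA -mulrN; congr (_ * _); rewrite mulr_suml -[eta j](sum_delta (fun i => eta i)).
rewrite mulr_suml -sumrN; apply: eq_bigr => k _.
have -> : psi k * eta k * (dpsi j * (Y * psitop)) = - (eta k * (psi k * dpsi j * Y * psitop)).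
  by rewrite (ee (inl k)) mulNr -!mulrA.
by rewrite opprK hY -mulrA psi_dpsi_top eq_sym; case: (j == k); rewrite ?mul1r ?mul0r ?mulr0.
Qed.

Lemma anticommB (a b c : F) : anticomm a b -> anticomm a c -> anticomm a (b - c).
Proof. by rewrite /anticomm mulrBr mulrBl => -> ->; rewrite opprB opprK addrC. Qed.

Lemma anticommD (a b c : F) : anticomm a b -> anticomm a c -> anticomm a (b + c).
Proof. by rewrite /anticomm mulrDr mulrDl => -> ->; rewrite opprD. Qed.

Lemma prod_conj_x (a : 'I_n -> F) r : \prod_(i <- r) (x * a i * s) = x * \prod_(i <- r) a i * s.
Proof.
elim: r => [|i r IHr]; first by rewrite !big_nil mulr1.
by rewrite !big_cons IHr !mulrA -[_ * s * x]mulrA sx mulr1.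
Qed.

Lemma phi_conj j : phi j - s * psi j = x * phi j * s.
Proof. by rewrite -mulrA phi_s mulrBr !mulrA xs !mul1r. Qed.

Lemma chi_conj j : chi j + s * eta j = x * chi j * s.
Proof. by rewrite -mulrA chi_s mulrDr !mulrA xs !mul1r. Qed.

(** By [phi_conj] each corrected form acts as [x * phi i * s], and the inner factors [s * x]
    cancel. *)
Lemma prod_Xi_etatop r y : (forall k, GRing.comm y (eta k)) -> (forall k, GRing.comm y (deta k)) ->
  \prod_(i <- r) Xi i * (y * etatop) = x * \prod_(i <- r) phi i * s * (y * etatop).
Proof.
move=> ye yd; rewrite -prod_conj_x; under [in RHS]eq_bigr do rewrite -phi_conj.
elim: r => [|i r IHr]; first by rewrite !big_nil.
rewrite !big_cons -mulrA IHr [X in Xi i * X]mulrA Xi_etatop; first by rewrite !mulrA.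
move=> k.
apply: commrM; last by apply/commr_sym/commrM.
apply: commr_prod => j _; apply: commManti; apply: anticommB.
- exact: eta_phi.
- by apply: anticommMr2; [apply/commr_sym/se | apply: ee].
- exact: deta_phi.
- by apply: anticommMr2; [apply/commr_sym/sd | apply: (car_de_neq edp)].
Qed.

Lemma prod_Ch_psitop r y : (forall k, GRing.comm y (psi k)) -> (forall k, GRing.comm y (dpsi k)) ->
  \prod_(i <- r) Ch i * (y * psitop) = x * \prod_(i <- r) chi i * s * (y * psitop).
Proof.
move=> ye yd; rewrite -prod_conj_x; under [in RHS]eq_bigr do rewrite -chi_conj.
elim: r => [|i r IHr]; first by rewrite !big_nil.
rewrite !big_cons -mulrA IHr [X in Ch i * X]mulrA Ch_psitop; first by rewrite !mulrA.
move=> k.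
apply: commrM; last by apply/commr_sym/commrM.
apply: commr_prod => j _; apply: commManti; apply: anticommD.
- exact: psi_chi.
- by apply: anticommMr2; [apply/commr_sym/se | apply: ee].
- exact: dpsi_chi.
- by apply: anticommMr2; [apply/commr_sym/sd | apply: (car_de_neq edp)].
Qed.

Lemma comm_det_column (a : F) (N : 'M[F]_n) :
  (forall i j, GRing.comm a (N i j)) -> GRing.comm a (det_column N).
Proof.
move=> aN; apply: commr_sum => t _; apply: commrM; first exact: commr_sign.
by apply: commr_prod => j _.
Qed.

Lemma etatop_psitop : etatop * psitop = (-1) ^+ n * (psitop * etatop).
Proof. by apply: prod_anticomm_ord => i j; apply: ee. Qed.

(** In each word of the exchange the right product meets the vacuum and becomes a determinant times
    a filled level; the left product then acts on this level through conjugation by [x], whose [s]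
    cancels the [x] in the middle. The sign of the exchange is undone by reordering the two top
    monomials. *)
Lemma det_column_exchange :
  (det_column M * det_column W - det_column W * det_column M) * p = 0.
Proof.
set D := det_column M; set E := det_column W.
have De i : GRing.comm D (e i) by apply/commr_sym/comm_det_column => *; apply/commr_sym.
have Dd i : GRing.comm D (d i) by apply/commr_sym/comm_det_column => *; apply/commr_sym.
have Ee i : GRing.comm E (e i) by apply/commr_sym/comm_det_column => *; apply/commr_sym.
have Ed i : GRing.comm E (d i) by apply/commr_sym/comm_det_column => *; apply/commr_sym.
have phiD : \prod_i phi i = psitop * D by apply: prod_sum_det.
have chiE : \prod_i chi i = etatop * E by apply: prod_sum_det.
have Dpsi : psitop * D = D * psitop by apply/commr_sym/commr_prod.
have Dpe : etatop * D = D * etatop by apply/commr_sym/commr_prod.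
have Epsi : psitop * E = E * psitop by apply/commr_sym/commr_prod.
have Eeta : etatop * E = E * etatop by apply/commr_sym/commr_prod.
have := Xi_Ch_exchange.
have -> : \prod_i Xi i * x * \prod_i Ch i * p = x * (D * E * (psitop * etatop * p)).
  rewrite -mulrA prod_Ch_vacuum chiE Eeta -!mulrA (mulrA x) (mulrA (x * E)) (mulrA _ _ p).
  rewrite prod_Xi_etatop => [|k|k]; first 1 last.
  - by apply/commr_sym/commrM; apply: commr_sym.
  - by apply/commr_sym/commrM; apply: commr_sym.
  rewrite phiD Dpsi -!mulrA (mulrA s) sx mul1r; congr (_ * (_ * _)).
  by rewrite (mulrA psitop) Epsi -!mulrA.
have -> : \prod_i Ch i * x * \prod_i Xi i * p = x * (E * D * (etatop * psitop * p)).
  rewrite -mulrA prod_Xi_vacuum phiD Dpsi -!mulrA (mulrA x) (mulrA (x * D)) (mulrA _ _ p).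
  rewrite prod_Ch_psitop => [|k|k]; first 1 last.
  - by apply/commr_sym/commrM; apply: commr_sym.
  - by apply/commr_sym/commrM; apply: commr_sym.
  rewrite chiE Eeta -!mulrA (mulrA s) sx mul1r; congr (_ * (_ * _)).
  by rewrite (mulrA etatop) Dpe -!mulrA.
rewrite etatop_psitop; set w := psitop * etatop.
have sgn (a b : F) : a * ((-1) ^+ n * b) = (-1) ^+ n * (a * b).
  by rewrite mulrA commr_sign -mulrA.
rewrite -(mulrA _ w) sgn sgn (mulrA ((-1) ^+ n)) -exprD addnn.
rewrite -signr_odd odd_double mul1r => /(congr1 ( *%R s)).
rewrite !(mulrA s) sx !mul1r => /eqP; rewrite -subr_eq0 -mulrBl => /eqP eDE.
pose r := map inl (index_enum 'I_n) ++ map inr (index_enum 'I_n) : seq ('I_n + 'I_n).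
apply: (car_cancel edp (r := r)).
- rewrite /r cat_uniq !map_inj_uniq ?index_enum_uniq ?andbT //; try by move=> i j [].
  by apply/hasPn => _ /mapP[i _ ->]; apply/mapP => -[].
- by move=> i; apply/commr_sym/commrB; apply: commrM; apply: commr_sym.
- by rewrite /r big_cat !big_map.
Qed.

End CoreIdentities.

Lemma det_column_map (A B : nzRingType) (f : {rmorphism A -> B}) n (M : 'M[A]_n) :
  f (det_column M) = det_column (map_mx f M).
Proof.
rewrite rmorph_sum; apply: eq_bigr => t _; rewrite rmorphM rmorph_sign rmorph_prod.
by congr (_ * _); apply: eq_bigr => j _; rewrite mxE.
Qed.

Theorem det_column_commute (A : nzRingType) n (x s : A) (M W : 'M[A]_n) :
    x * s = 1 -> s * x = 1 ->
    (forall i j, M i j * x = x * M i j + (i == j)%:R) ->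
    (forall i j, W i j * x = x * W i j - (i == j)%:R) ->
    (forall i j k l, M i j * M k l - M k l * M i j = M k j * M i l - M i l * M k j) ->
    (forall i j k, M i j * M k j = M k j * M i j) ->
    (forall i j k l, W i j * W k l - W k l * W i j = W k j * W i l - W i l * W k j) ->
    (forall i j k, W i j * W k j = W k j * W i j) ->
    (forall i j k l, x * (M i j * W k l - W k l * M i j) =
       (M l j + W j l) *+ (i == k) - (M i k + W k i) *+ (j == l)) ->
  det_column M * det_column W = det_column W * det_column M.
Proof.
move=> xs sx Mx Wx MM M2 WW W2 MW.
have [F [f [e [d [p [edp fe fd fp]]]]]] := car_exists A ('I_n + 'I_n)%type.
apply/eqP; rewrite -subr_eq0; apply/eqP/fp.
rewrite rmorphB !rmorphM !det_column_map.
apply: (@det_column_exchange _ _ e d p (f x) (f s) (map_mx f M) (map_mx f W) edp) => //.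
- by move=> i j k; rewrite mxE.
- by move=> i j k; rewrite mxE.
- by move=> i j k; rewrite mxE.
- by move=> i j k; rewrite mxE.
- by rewrite -rmorphM xs rmorph1.
- by rewrite -rmorphM sx rmorph1.
- by move=> i j; rewrite mxE -!rmorphM Mx rmorphD rmorph_nat.
- by move=> i j; rewrite mxE -!rmorphM Wx rmorphB rmorph_nat.
- by move=> i j k l; rewrite !mxE -!rmorphM -!rmorphB MM.
- by move=> i j k; rewrite !mxE -!rmorphM M2.
- by move=> i j k l; rewrite !mxE -!rmorphM -!rmorphB WW.
- by move=> i j k; rewrite !mxE -!rmorphM W2.
- by move=> i j k l; rewrite !mxE -!rmorphM -!rmorphB -rmorphM MW rmorphB !rmorphMn !rmorphD.
Qed.

(** * Manin matrices *)

Section ManinPower.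
Variables (F : nzRingType) (n : nat) (e1 e2 : 'I_n -> F) (M : 'M[F]_n).
Hypothesis e11 : forall i j, anticomm (e1 i) (e1 j).
Hypothesis e22 : forall i j, anticomm (e2 i) (e2 j).
Hypothesis e12 : forall i j, anticomm (e1 i) (e2 j).
Hypothesis e1_sq : forall i, e1 i * e1 i = 0.
Hypothesis e2_sq : forall i, e2 i * e2 i = 0.
Hypothesis Me1 : forall i j k, GRing.comm (M i j) (e1 k).
Hypothesis Me2 : forall i j k, GRing.comm (M i j) (e2 k).
Hypothesis MM : forall i j k l, M i j * M k l - M k l * M i j = M k j * M i l - M i l * M k j.
Hypothesis MM2 : forall i j k, M i j * M k j = M k j * M i j.

(** The vanishing of the next power is carried along because it removes, in the inductive step, the
    term of the binomial expansion that is free of [t i]. *)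
Lemma exp_sum_sq0 (t : 'I_n -> F) (r : seq 'I_n) :
    (forall i j, GRing.comm (t i) (t j)) -> (forall i, t i * t i = 0) ->
  (\sum_(i <- r) t i) ^+ size r = ((size r)`!)%:R * \prod_(i <- r) t i /\
  (\sum_(i <- r) t i) ^+ (size r).+1 = 0.
Proof.
move=> tc t0; elim: r => [|i r [IH1 IH2]]; first by rewrite !big_nil !expr0 mulr1 expr1.
have ct : GRing.comm (t i) (\sum_(j <- r) t j) by apply: commr_sum.
have expS m : (t i + \sum_(j <- r) t j) ^+ m.+1 =
    (\sum_(j <- r) t j) ^+ m.+1 + t i * (\sum_(j <- r) t j) ^+ m *+ m.+1.
  elim: m => [|m IHm]; first by rewrite !expr1 expr0 mulr1 addrC.
  set S := \sum_(j <- r) t j in ct IHm *.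
  have h1 : t i * (t i * S ^+ m *+ m.+1) = 0 by rewrite mulrnAr (mulrA (t i)) t0 mul0r mul0rn.
  have h2 : S * (t i * S ^+ m *+ m.+1) = t i * S ^+ m.+1 *+ m.+1.
    by rewrite mulrnAr (mulrA S) -ct -(mulrA (t i)) -exprS.
  by rewrite exprS IHm mulrDl !mulrDr h1 h2 addr0 -exprS addrCA -mulrS.
rewrite !big_cons /=; split.
  rewrite expS IH2 IH1 add0r factS natrM -[LHS]mulr_natl -!mulrA; congr (_ * _).
  by rewrite !mulrA; congr (_ * _); apply/commr_nat.
by rewrite expS exprS IH2 !mulr0 mul0rn addr0.
Qed.

Lemma prod_anticomm_pair (a b : 'I_n -> F) (r : seq 'I_n) :
    (forall i j, anticomm (b i) (a j)) ->
  \prod_(i <- r) (a i * b i) =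
  (-1) ^+ 'C(size r, 2) * (\prod_(i <- r) a i * \prod_(i <- r) b i).
Proof.
move=> ba; elim: r => [|i r IHr]; first by rewrite !big_nil !mulr1.
have bi : b i * \prod_(j <- r) a j = (-1) ^+ size r * (\prod_(j <- r) a j * b i).
  by apply: anticomm_prod => j _; apply: ba.
rewrite !big_cons IHr /= binS bin1 exprD [LHS]mulrA (commr_sign (a i * b i)).
by rewrite -!mulrA (mulrA (b i)) bi -!mulrA (mulrA (a i)) (commr_sign (a i)) -!mulrA.
Qed.

(** Grouped by columns, the sum consists of the commuting square-zero elements [ph j * e2 j], so its
    [n]-th power is [n!] times their product. The binomial exponent counts the transpositions that
    separate the two kinds of fermions. *)
Lemma manin_power : (\sum_i \sum_j e1 i * e2 j * M i j) ^+ n =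
  (n`!)%:R * ((-1) ^+ 'C(n, 2) * (\prod_j e1 j * det_column M * \prod_j e2 j)).
Proof.
pose ph j := \sum_i e1 i * M i j.
have ph_e2 i j : anticomm (e2 i) (ph j).
  by apply: anticomm_sumr => k _; apply: anticommMr; [apply/anticomm_sym/e12 | apply/commr_sym/Me2].
have phph i j : anticomm (ph i) (ph j) by apply: sum_comm_anti.
have ph0 i : ph i * ph i = 0 by apply: sum_comm_sq.
have -> : \sum_i \sum_j e1 i * e2 j * M i j = \sum_j ph j * e2 j.
  rewrite exchange_big; apply: eq_bigr => j _; rewrite mulr_suml.
  by apply: eq_bigr => i _; rewrite -!mulrA Me2.
have sz : size (index_enum 'I_n) = n by rewrite /index_enum -enumT size_enum_ord.
have tt0 i : ph i * e2 i * (ph i * e2 i) = 0.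
  by rewrite -mulrA (mulrA (e2 i)) ph_e2 mulNr -(mulrA (ph i)) e2_sq !mulr0 oppr0 mulr0.
have ttc i j : GRing.comm (ph i * e2 i) (ph j * e2 j).
  rewrite /GRing.comm -!mulrA (mulrA (e2 i)) (mulrA (e2 j)) !ph_e2 !mulNr !mulrN -!mulrA.
  by rewrite (e22 i) !mulrN opprK !(mulrA (ph _) (ph _)) phph mulNr.
have [/= + _] := exp_sum_sq0 (index_enum 'I_n) ttc tt0.
by rewrite sz => ->; rewrite prod_anticomm_pair // sz prod_sum_det.
Qed.

End ManinPower.

(** * Column cofactors of a Manin matrix *)

Section Adjugate.
Variables (A : nzRingType) (n : nat) (M : 'M[A]_n).
Hypothesis MM : forall i j k l, M i j * M k l - M k l * M i j = M k j * M i l - M i l * M k j.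
Hypothesis MM2 : forall i j k, M i j * M k j = M k j * M i j.

(** An entry of the left adjugate; the unit column keeps the place of column [l] in the ordered
    product. *)
Definition col_cofactor l k := det_column (\matrix_(i, j) if j == l then (i == k)%:R else M i j).

Section Fermions.
Variables (F : nzRingType) (f : {rmorphism A -> F}) (e d : 'I_n -> F) (p : F).
Hypothesis edp : car e d p.
Hypothesis fe : forall a i, GRing.comm (f a) (e i).
Hypothesis fd : forall a i, GRing.comm (f a) (d i).
Let ph j := \sum_i e i * f (M i j).
Let etop := \prod_i e i.

Lemma prod_cofactor l k :
  etop * f (col_cofactor l k) = \prod_j (if j == l then e k else ph j).
Proof.
rewrite det_column_map -(@prod_sum_det _ _ e _ (car_ee edp) (car_e2 edp)); last first.
  by move=> i j m; rewrite mxE; apply: fe.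
apply: eq_bigr => j _; case: (altP (j =P l)) => [->|jl].
  rewrite (bigD1 k) //= !mxE !eqxx rmorph1 mulr1 big1 ?addr0 // => i ik.
  by rewrite !mxE eqxx (negPf ik) rmorph0 mulr0.
by apply: eq_bigr => i _; rewrite !mxE (negPf jl).
Qed.

Lemma ph_anti i j : anticomm (ph i) (ph j).
Proof.
apply: (@sum_comm_anti _ _ (fun i j => f (M i j)) _ _ e (car_ee edp) (car_e2 edp)) => [a b c|].
  exact: fe.
by move=> a b c g; rewrite -!rmorphM -!rmorphB MM.
Qed.

Lemma ph_sq i : ph i * ph i = 0.
Proof.
apply: (@sum_comm_sq _ _ (fun i j => f (M i j)) _ e (car_ee edp) (car_e2 edp)) => [a b c|].
  exact: fe.
by move=> a b c; rewrite -!rmorphM MM2.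
Qed.

Lemma prod_ph : \prod_j ph j = etop * f (det_column M).
Proof.
rewrite det_column_map -(@prod_sum_det _ _ e _ (car_ee edp) (car_e2 edp)); last first.
  by move=> i j m; rewrite mxE; apply: fe.
by apply: eq_bigr => j _; apply: eq_bigr => i _; rewrite mxE.
Qed.

Lemma e_ph i j : anticomm (e i) (ph j).
Proof.
by apply: anticomm_sumr => k _; apply: anticommMr; [apply: (car_ee edp) | apply/commr_sym/fe].
Qed.

(** The [e k] standing at place [l] is moved to the right end, where the sum over [k] rebuilds
    [ph m]. If [m = l], moving it back restores the determinant; otherwise [ph m] occurs twice and
    the product vanishes. *)
Lemma cofactor_top l m :
  etop * f (\sum_k col_cofactor l k * M k m) = etop * f (det_column M *+ (l == m)).
Proof.
have [r1 [r2 er]] : exists r1 r2, index_enum 'I_n = r1 ++ l :: r2.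
  by case/path.splitPr: (mem_index_enum l) => r1 r2; exists r1, r2.
have : uniq (r1 ++ l :: r2) by rewrite -er index_enum_uniq.
rewrite cat_uniq /= negb_or.
case/and3P=> _ /andP[lr1 _] /andP[lr2 _].
have ne' k r : l \notin r ->
    \prod_(j <- r) (if j == l then e k else ph j) = \prod_(j <- r) ph j.
  by move=> lr; apply: eq_big_seq => j jr; case: eqP lr jr => // -> /negPf->.
have H k : etop * f (col_cofactor l k * M k m) =
    (-1) ^+ size r2 * (\prod_(j <- r1 ++ r2) ph j * (e k * f (M k m))).
  rewrite rmorphM mulrA prod_cofactor er !big_cat big_cons /= eqxx !ne' //.
  rewrite (anticomm_prod (a := e k)) => [|j _]; last exact: e_ph.
  by rewrite -!mulrA (mulrA (\prod_(j <- r1) ph j)) commr_sign -!mulrA.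
have prE : etop * f (det_column M) =
    \prod_(j <- r1) ph j * (ph l * \prod_(j <- r2) ph j).
  by rewrite -prod_ph er big_cat big_cons.
have -> : etop * f (\sum_k col_cofactor l k * M k m) =
    (-1) ^+ size r2 * (\prod_(j <- r1 ++ r2) ph j * ph m).
  by rewrite rmorph_sum !mulr_sumr; apply: eq_bigr => k _; apply: H.
rewrite rmorphMn mulrnAr prE.
case: (altP (l =P m)) => [<-|lm].
  have swap : ph l * \prod_(j <- r2) ph j = (-1) ^+ size r2 * (\prod_(j <- r2) ph j * ph l).
    by apply: anticomm_prod => j _; apply: ph_anti.
  by rewrite mulr1n swap big_cat /= [RHS]mulrA commr_sign -!mulrA.
have mr : m \in r1 ++ r2.
  by have := mem_index_enum m; rewrite er !mem_cat inE eq_sym (negPf lm).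
have anti : {in r1 ++ r2, forall i, anticomm (ph m) (ph i)} by move=> i _; apply: ph_anti.
by rewrite (prod_anticomm_mem mr anti (ph_sq m)).2 mulr0.
Qed.

End Fermions.

Lemma sum_col_cofactor l m : \sum_k col_cofactor l k * M k m = det_column M *+ (l == m).
Proof.
have [F [f [e [d [p [edp fe fd fp]]]]]] := car_exists A 'I_n.
apply/eqP; rewrite -subr_eq0; apply/eqP/fp/(car_cancel edp (index_enum_uniq _)).
  by move=> i; apply: fd.
have ce a : f a * (\prod_(j <- index_enum 'I_n) e j * p) = \prod_j e j * f a * p.
  by rewrite mulrA; congr (_ * p); apply: commr_prod => i _; apply: fe.
by rewrite ce rmorphB mulrBr (cofactor_top edp fe) subrr mul0r.
Qed.

(** The commutator with [z] is a derivation sending [ph j] to [e j]. Applied to the product of the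
    forms, it replaces one factor at a time, and each replacement is a diagonal cofactor. *)
Lemma tr_col_cofactor (z : A) : (forall i j, M i j * z = z * M i j + (i == j)%:R) ->
  \sum_l col_cofactor l l = det_column M * z - z * det_column M.
Proof.
move=> Mz.
have [F [f [e [d [p [edp fe fd fp]]]]]] := car_exists A 'I_n.
apply/eqP; rewrite -subr_eq0; apply/eqP/fp/(car_cancel edp (index_enum_uniq _)).
  by move=> i; apply: fd.
have ce a : f a * (\prod_(j <- index_enum 'I_n) e j * p) = \prod_j e j * f a * p.
  by rewrite mulrA; congr (_ * p); apply: commr_prod => i _; apply: fe.
pose ph j := \sum_i e i * f (M i j).
have phz j : ph j * f z = f z * ph j + e j.
  rewrite mulr_suml mulr_sumr (bigD1 j) //= [X in _ = X + _](bigD1 j) //=.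
  rewrite -mulrA -rmorphM Mz eqxx rmorphD rmorph1 mulrDr mulr1 rmorphM mulrA -fe -mulrA.
  rewrite addrAC; congr (_ + _ + _); apply: eq_bigr => i ij.
  by rewrite -mulrA -rmorphM Mz (negPf ij) addr0 rmorphM mulrA -fe -mulrA.
have prz r : uniq r -> \prod_(j <- r) ph j * f z =
    f z * \prod_(j <- r) ph j + \sum_(l <- r) \prod_(j <- r) (if j == l then e l else ph j).
  elim: r => [|k r IHr]; first by rewrite !big_nil mulr1 mul1r addr0.
  rewrite [uniq _]/= => /andP[kr ur]; rewrite !big_cons eqxx -mulrA IHr // mulrDr.
  rewrite !mulrA phz mulrDl -!addrA -!mulrA; congr (_ + _).
  congr (_ * _ + _).
    by apply: eq_big_seq => j jr; case: eqP jr kr => // -> ->.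
  rewrite mulr_sumr; apply: eq_big_seq => l lr; rewrite big_cons.
  by case: eqP lr kr => // -> ->.
have := prz _ (index_enum_uniq 'I_n); rewrite (prod_ph edp fe) => h.
have cof : \prod_i e i * f (\sum_l col_cofactor l l) =
    \sum_l \prod_j (if j == l then e l else ph j).
  by rewrite rmorph_sum mulr_sumr; apply: eq_bigr => l _; rewrite (prod_cofactor edp fe).
rewrite ce rmorphB mulrBr cof rmorphB !rmorphM mulrBr (mulrA _ (f (det_column M))) h.
have -> : \prod_i e i * (f z * f (det_column M)) = f z * (\prod_i e i * f (det_column M)).
  by rewrite !mulrA; congr (_ * _); apply/esym/commr_prod => i _; apply: fe.
by rewrite addrAC subrr add0r subrr mul0r.
Qed.

End Adjugate.

(** * Laurent series and differential operators *)

Section LaurentConstants.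
Variables (e : expansion) (S : nzRingType).
Implicit Types (f g : laurent e S) (a : S).

Lemma lmonom_subproof (k : int) a : (fun m : int => a *+ (m == k)) \in @laurent_supp e S.
Proof.
apply/asboolP; exists k => m; have [->|] := eqVneq m k; first by move=> _; apply: bounded_refl.
by rewrite mulr0n eqxx.
Qed.

Definition lmonom k a : laurent e S := Laurent (lmonom_subproof k a).
Definition lconst := lmonom 0.
Definition lvar := lmonom 1 1.

Lemma lmonomMl k a f m : (lmonom k a * f) m = a * f (m - k).
Proof.
rewrite lcoefM (@fsum_seq _ _ [:: k]) // => [|b]; first by rewrite big_seq1 /= eqxx.
by rewrite inE /= => /negPf->; rewrite mul0r.
Qed.

Lemma lmonomMr k a f m : (f * lmonom k a) m = f (m - k) * a.
Proof.
rewrite lcoefM (@fsum_seq _ _ [:: m - k]) // => [|b].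
  by rewrite big_seq1 /= (_ : m - (m - k) = k) ?eqxx //; lia.
rewrite inE /= => bmk; have /negPf-> : m - b != k by apply: contraNneq bmk => <-; lia.
by rewrite mulr0.
Qed.

Lemma lconstMl a f m : (lconst a * f) m = a * f m.
Proof. by rewrite lmonomMl subr0. Qed.

Lemma lconstMr a f m : (f * lconst a) m = f m * a.
Proof. by rewrite lmonomMr subr0. Qed.

Lemma lvarMl f m : (lvar * f) m = f (m - 1).
Proof. by rewrite lmonomMl mul1r. Qed.

Lemma lvarMr f m : (f * lvar) m = f (m - 1).
Proof. by rewrite lmonomMr mulr1. Qed.

Lemma lvar_comm f : lvar * f = f * lvar.
Proof. by apply: laurentP => m; rewrite lvarMl lvarMr. Qed.

Lemma lconst_is_zmod_morphism : zmod_morphism lconst.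
Proof. by move=> a b; apply: laurentP => m; rewrite /= mulrnBl. Qed.

Lemma lconst_is_monoid_morphism : monoid_morphism lconst.
Proof.
split=> [|a b]; first exact: laurentP.
by apply: laurentP => m; rewrite lconstMl /= mulrnAr.
Qed.

HB.instance Definition _ :=
  GRing.isZmodMorphism.Build S (laurent e S) lconst lconst_is_zmod_morphism.
HB.instance Definition _ :=
  GRing.isMonoidMorphism.Build S (laurent e S) lconst lconst_is_monoid_morphism.

Lemma der_lconst a : der (lconst a) = 0.
Proof.
apply: laurentP => m; rewrite /= /lder_coef /=.
by have [->|] := eqVneq (m + 1) 0; rewrite ?mulr0z ?mulr0n ?mul0rz.
Qed.

Lemma der_lvar : der lvar = 1.
Proof.
apply: laurentP => m; rewrite /= /lder_coef /=.
have -> : (m + 1 == 1) = (m == 0) by lia.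
by have [->|] := eqVneq m 0; rewrite ?add0r ?mulr1z ?mul0rz.
Qed.

Lemma lvar_subC_unit a b : a * b = 1 -> b * a = 1 ->
  exists s, (lvar - lconst a) * s = 1 /\ s * (lvar - lconst a) = 1.
Proof.
move=> ab ba.
(* Geometric series for the inverse of z - a: minus the sum of b^(k+1) z^k at zero, the sum of a^k
   z^(-k-1) at infinity. [Negz k] is the exponent -(k+1). *)
pose sc (m : int) : S := match e with
  | at_zero => if m is Posz k then - b ^+ k.+1 else 0
  | at_infinity => if m is Negz k then a ^+ k else 0 end.
have scP : sc \in @laurent_supp e S.
  by apply/asboolP; exists 0; rewrite /sc /bounded; case: e => -[k|k]; rewrite ?eqxx //; lia.
have sr m : sc (m - 1) - sc m * a = (m == 0)%:R.
  rewrite /sc; case: (e); case: m => [[|k]|k].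
  - by rewrite /= expr1 mulNr ba opprK add0r.
  - rewrite (_ : k.+1%:Z - 1 = k); last by lia.
    by rewrite mulNr [b ^+ k.+2]exprSr -mulrA ba mulr1 opprK addNr.
  - rewrite (_ : Negz k - 1 = Negz k.+1); last by lia.
    by rewrite mul0r subr0.
  - by rewrite /= mul0r subr0.
  - rewrite (_ : k.+1%:Z - 1 = k); last by lia.
    by rewrite mul0r subr0.
  - rewrite (_ : Negz k - 1 = Negz k.+1); last by lia.
    by rewrite -exprSr subrr.
have sl m : sc (m - 1) - a * sc m = (m == 0)%:R.
  rewrite -sr; congr (_ - _); rewrite /sc; case: (e); case: m => [k|k].
  - by rewrite mulNr mulrN exprSr -mulrA ba mulr1 -exprSr exprS mulrA ab mul1r.
  - by rewrite mul0r mulr0.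
  - by rewrite mul0r mulr0.
  - by rewrite -exprS exprSr.
exists (Laurent scP); split; apply: laurentP => m.
  by rewrite mulrBl lcoefD lcoefN lvarMl lconstMl /= sl.
by rewrite mulrBr lcoefD lcoefN lvarMr lconstMr /= sr.
Qed.

End LaurentConstants.
Arguments lconst {e S}.
Arguments lvar {e S}.

Lemma lvar_unit e (S : nzRingType) :
  exists s : laurent e S, lvar * s = 1 /\ s * lvar = 1.
Proof.
exists (lmonom e (-1) 1); split; apply: laurentP => m.
  by rewrite lvarMl /= (_ : (m - 1 == -1) = (m == 0)) //; lia.
by rewrite lvarMr /= (_ : (m - 1 == -1) = (m == 0)) //; lia.
Qed.

Section LaurentMap.
Variables (e : expansion) (R S : nzRingType) (g : {rmorphism R -> S}).
Implicit Types f h : laurent e R.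

Lemma lmap_subproof f : (fun m : int => g (f m)) \in @laurent_supp e S.
Proof.
have [N Nf] := laurent_bnd f; apply/asboolP; exists N => m gf; apply: Nf.
by apply: contraNneq gf => ->; rewrite rmorph0.
Qed.

Definition lmap f : laurent e S := Laurent (lmap_subproof f).

Lemma lmap_is_zmod_morphism : zmod_morphism lmap.
Proof. by move=> f h; apply: laurentP => m; rewrite /= rmorphB. Qed.

Lemma lmap_is_monoid_morphism : monoid_morphism lmap.
Proof.
split=> [|f h]; apply: laurentP => m; first by rewrite /= rmorph_nat.
have [N Nf] := laurent_bnd f; have [M Mh] := laurent_bnd h.
have fh a : f a * h (m - a) != 0 -> bounded e N a /\ bounded e a (m - M).
  move=> /mulr_neq0[/Nf fa /Mh ha]; split=> //.
  by move: ha; rewrite /bounded; case: e; lia.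
transitivity (g (\sum_(a <- erange e N (m - M)) f a * h (m - a))).
  by congr (g _); apply: fsum_erange.
rewrite rmorph_sum; apply/esym; rewrite [LHS](@fsum_erange e _ _ N (m - M)).
  by apply: eq_bigr => a _; rewrite rmorphM.
move=> a gfh; apply: fh; apply: contraNneq gfh => fh0.
by rewrite /= -rmorphM fh0 rmorph0.
Qed.

HB.instance Definition _ :=
  GRing.isZmodMorphism.Build (laurent e R) (laurent e S) lmap lmap_is_zmod_morphism.
HB.instance Definition _ :=
  GRing.isMonoidMorphism.Build (laurent e R) (laurent e S) lmap lmap_is_monoid_morphism.

Lemma der_lmap f : der (lmap f) = lmap (der f).
Proof. by apply: laurentP => m; rewrite /= /lder_coef /= rmorphMz. Qed.

End LaurentMap.

Section DiffOpTools.
Variable A : diffRingType.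
Implicit Types (a : A) (p q : diffop A).

Lemma dopcoefD p q i : dopcoef (p + q) i = dopcoef p i + dopcoef q i.
Proof. exact: coefD. Qed.

Lemma dopcoefB p q i : dopcoef (p - q) i = dopcoef p i - dopcoef q i.
Proof. exact: coefB. Qed.

Lemma dopcoef_sum (I : Type) (r : seq I) (P : pred I) (E : I -> diffop A) i :
  dopcoef (\sum_(k <- r | P k) E k) i = \sum_(k <- r | P k) dopcoef (E k) i.
Proof. exact: coef_sum. Qed.

Lemma dopcoefC a i : dopcoef (dopC a) i = a *+ (i == 0%N).
Proof. by rewrite /dopcoef coefC; case: eqP. Qed.

Lemma dopP p q : dopcoef p =1 dopcoef q -> p = q.
Proof. by move=> pq; apply/polyP. Qed.

Lemma dopcoef_CM a p i : dopcoef (dopC a * p) i = a * dopcoef p i.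
Proof. by rewrite /GRing.mul /= dopmulCl /dopcoef coefZ. Qed.

Lemma dopC_is_zmod_morphism : zmod_morphism (@dopC A).
Proof. by move=> a b; apply: polyCB. Qed.

Lemma dopC_is_monoid_morphism : monoid_morphism (@dopC A).
Proof.
split=> // a b; apply: dopP => i; rewrite dopcoef_CM !dopcoefC.
by rewrite mulrnAr.
Qed.

HB.instance Definition _ :=
  GRing.isZmodMorphism.Build A (diffop A) (@dopC A) dopC_is_zmod_morphism.
HB.instance Definition _ :=
  GRing.isMonoidMorphism.Build A (diffop A) (@dopC A) dopC_is_monoid_morphism.

Lemma dopcoef_ddM p i : dopcoef (ddz A * p) i =
  (if i is j.+1 then dopcoef p j else 0) + der (dopcoef p i).
Proof.
rewrite /GRing.mul /= (@dopmulE _ 2) ?size_polyX // !big_ord_recl big_ord0 !coefX /=.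
rewrite scale0r add0r scale1r addr0 /ddmul /dopcoef coefD coefMX coef_map_der.
by case: i.
Qed.

Lemma dopcoef_ddX i j : dopcoef (ddz A ^+ j) i = (i == j)%:R.
Proof.
have -> : ddz A ^+ j = dopC 1 * ddz A ^+ j by rewrite mul1r.
by rewrite dopC_ddzX /dopcoef coefZ coefXn mul1r.
Qed.

Lemma ddz_comm_dopC a : der a = 0 -> GRing.comm (ddz A) (dopC a).
Proof. by move=> a0; rewrite /GRing.comm ddz_dopC a0 rmorph0 addr0. Qed.

Lemma dopcoef_MC a p i : der a = 0 -> dopcoef (p * dopC a) i = dopcoef p i * a.
Proof.
move=> a0; rewrite {1}(@dopE _ (maxn (size (p : {poly A})) i.+1) p) ?leq_maxl //.
rewrite mulr_suml dopcoef_sum.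
have ii : (i < maxn (size (p : {poly A})) i.+1)%N by rewrite leq_maxr.
rewrite (bigD1 (Ordinal ii)) //= big1 => [|k ki].
  rewrite addr0 -mulrA (commr_sym (commrX i (commr_sym (ddz_comm_dopC a0)))) mulrA.
  rewrite -rmorphM dopcoef_CM dopcoef_ddX.
  by rewrite eqxx mulr1.
rewrite -mulrA (commr_sym (commrX k (commr_sym (ddz_comm_dopC a0)))) mulrA.
rewrite -rmorphM dopcoef_CM dopcoef_ddX.
by rewrite eq_sym -val_eqE /= in ki; rewrite (negPf ki) mulr0.
Qed.

End DiffOpTools.

Lemma dopcoef_M_lconst e (S : nzRingType) (p : diffop (laurent e S)) (c : S) i m :
  dopcoef (p * dopC (lconst c)) i m = dopcoef p i m * c.
Proof. by rewrite dopcoef_MC ?lconstMr // der_lconst. Qed.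

Lemma dopcoef_lconst_M e (S : nzRingType) (p : diffop (laurent e S)) (c : S) i m :
  dopcoef (dopC (lconst c) * p) i m = c * dopcoef p i m.
Proof. by rewrite dopcoef_CM lconstMl. Qed.

Section DiffOpMap.
Variables (A B : diffRingType) (g : {rmorphism A -> B}).
Hypothesis gder : forall a, der (g a) = g (der a).

(** The compatibility with [der] is an argument so that the ring morphism structure can be attached
    to [dopmap gder]. *)
Definition dopmap of (forall a, der (g a) = g (der a)) := fun p : diffop A =>
  (map_poly g p : diffop B).

Local Notation h := (dopmap gder).

Lemma dopcoef_map p i : dopcoef (h p) i = g (dopcoef p i).
Proof. exact: coef_map. Qed.

Lemma dopmap_is_zmod_morphism : zmod_morphism h.
Proof. by move=> p q; apply: dopP => i; rewrite !(dopcoef_map, dopcoefB) rmorphB. Qed.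

Lemma dopmap_is_monoid_morphism : monoid_morphism h.
Proof.
split=> [|p q]; first by apply: dopP => i; rewrite dopcoef_map !dopcoefC rmorphMn rmorph1.
have hdd (r : {poly A}) : map_poly g (ddmul r) = ddmul (map_poly g r).
  apply/polyP => i; rewrite /ddmul rmorphD rmorphM /= map_polyX !coefD coef_map_der.
  by rewrite !coef_map /= coef_map_der gder.
rewrite /GRing.mul /= [LHS]raddf_sum (@dopmulE _ (size (p : {poly A}))) ?size_poly //.
apply: eq_bigr => i _; rewrite [LHS]linearZ_LR /= coef_map; congr (_ *: _).
by elim: (i : nat) => //= k; rewrite hdd => ->.
Qed.

HB.instance Definition _ :=
  GRing.isZmodMorphism.Build (diffop A) (diffop B) h dopmap_is_zmod_morphism.
HB.instance Definition _ :=
  GRing.isMonoidMorphism.Build (diffop A) (diffop B) h dopmap_is_monoid_morphism.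

Lemma dopmapC a : h (dopC a) = dopC (g a).
Proof. exact: map_polyC. Qed.

Lemma dopmap_ddz : h (ddz A) = ddz B.
Proof. exact: map_polyX. Qed.

Lemma ddz_sub_map n (L : 'M[A]_n) : ddz_sub (map_mx g L) = map_mx h (ddz_sub L).
Proof. by apply/matrixP => i j; rewrite !mxE rmorphB rmorphMn /= dopmapC dopmap_ddz. Qed.

Lemma det_ddz_sub_map n (L : 'M[A]_n) :
  det_column (ddz_sub (map_mx g L)) = h (det_column (ddz_sub L)).
Proof. by rewrite ddz_sub_map -det_column_map. Qed.

Lemma QH_map n (L : 'M[A]_n) i : QH (map_mx g L) i = g (QH L i).
Proof. by rewrite /QH det_ddz_sub_map dopcoef_map. Qed.

Lemma qpow_map n (L : 'M[A]_n) i : qpow (map_mx g L) i = map_mx g (qpow L i).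
Proof.
elim: i => [|i IHi] /=; first by rewrite map_mx1.
rewrite IHi map_mxD map_mxM; congr (_ + _).
by apply/matrixP => k l; rewrite !mxE gder.
Qed.

End DiffOpMap.

(** * The Gaudin relation *)

Lemma abel_summation (V : zmodType) (F : int -> V) (N : int) (k : nat) :
  \sum_(i < k) (F (N + i - 1) - F (N + i)) *~ (N + i) =
  \sum_(i < k) F (N + i - 1) + F (N - 1) *~ (N - 1) - F (N + k - 1) *~ (N + k - 1).
Proof.
elim: k => [|k IHk]; first by rewrite !big_ord0 !addr0 add0r subrr.
rewrite !big_ord_recr /= IHk (_ : N + k.+1 - 1 = N + k); last by lia.
set x := F (N + k - 1); set y := F (N + k).
have xE : x *~ (N + k) = x *~ (N + k - 1) + x by rewrite -{3}(mulr1z x) -mulrzDr subrK.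
rewrite mulrzBl xE [LHS]addrA; congr (_ - _).
by rewrite -[LHS]addrA addKr addrAC.
Qed.

(** The booleans are the Kronecker symbols of two entries of d - L. *)
Lemma ddz_sub_commutator (A : diffRingType) (b c : bool) (f h : A) :
  (ddz A *+ b - dopC f) * (ddz A *+ c - dopC h) - (ddz A *+ c - dopC h) * (ddz A *+ b - dopC f) =
  dopC (der f *+ c - der h *+ b + (f * h - h * f)).
Proof.
rewrite !mulrBr !mulrBl !mulrnAl !mulrnAr !ddz_dopC.
rewrite !rmorphD !rmorphN !rmorphMn !rmorphM !mulrnDl !opprD !opprK -!addrA.
rewrite mulrnAC.
case: b; case: c; rewrite ?mulr0n ?mulr1n ?oppr0 ?add0r ?addr0 //.
- rewrite !addrA [LHS](ACl ((1*6)*((8*2)*((7*3)*(9*4*5*10)))))%AC /=.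
  by rewrite !subrr !add0r.
- by rewrite !addrA [LHS](ACl ((4*1)*(2*3*5)))%AC /= subrr add0r ?addrA.
- by rewrite !addrA [LHS](ACl ((3*1)*(4*2*5)))%AC /= subrr add0r ?addrA.
Qed.

(* the Gaudin relation at coinciding points *)
Definition same_point (A : diffRingType) n (L : 'M[A]_n) :=
  forall i j k l, L i j * L k l - L k l * L i j =
    der (L k j) *+ (l == i) - der (L i l) *+ (j == k).

(** For [j = l] the first identity only gives twice the second, hence the separate clause over an
    arbitrary ring. *)
Definition manin (A : nzRingType) n (M : 'M[A]_n) :=
  (forall i j k l, M i j * M k l - M k l * M i j = M k j * M i l - M i l * M k j) /\
  (forall i j k, M i j * M k j = M k j * M i j).

Lemma manin_map (A B : nzRingType) (f : {rmorphism A -> B}) n (M : 'M[A]_n) :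
  manin M -> manin (map_mx f M).
Proof.
case=> MM MM2; split=> [i j k l|i j k]; rewrite !mxE -!(rmorphM f).
  by rewrite -!(rmorphB f) MM.
by rewrite MM2.
Qed.

(** By the diagonal Gaudin relation the commutator of two entries is a combination of four
    derivatives that is invariant under the exchange of the row indices, and zero within a
    column. *)
Lemma manin_ddz_sub (A : diffRingType) n (L : 'M[A]_n) : same_point L -> manin (ddz_sub L).
Proof.
move=> spL; set D := ddz_sub L.
have DD i j k l : D i j * D k l - D k l * D i j =
    dopC (der (L i j) *+ (k == l) - der (L k l) *+ (i == j)
          + (der (L k j) *+ (l == i) - der (L i l) *+ (j == k))).
  by rewrite -spL /D !mxE ddz_sub_commutator.
split=> [i j k l|i j k].
  rewrite !DD; congr (dopC _).
  rewrite [k == j]eq_sym [i == l]eq_sym [l == k]eq_sym [j == i]eq_sym.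
  by rewrite !addrA [LHS](ACl (3*4*1*2))%AC.
apply/eqP; rewrite -subr_eq0; apply/eqP; rewrite DD [k == j]eq_sym [j == i]eq_sym.
by rewrite !addrA [X in dopC X](ACl ((1*4)*(3*2)))%AC /= !subrr addr0 rmorph0.
Qed.

Section SamePoint.
Variables (e : expansion) (R : nzRingType) (n : nat) (L : 'M[laurent e R]_n).
Hypothesis gL : series_gaudin L.

Lemma series_gaudin_same_point : same_point L.
Proof.
(* Multiply the coefficient of u^a v^(m + 1 - a) in the Gaudin relation by a and
   sum over a: the left-hand side telescopes to the coefficient of z^m in
   [L_ij(z), L_kl(z)]. *)
move=> i j k l; apply: laurentP => m.
have [N Nf] := laurent_bnd (L i j); have [M Mh] := laurent_bnd (L k l).
pose f := L i j; pose h := L k l.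
pose F a := f a * h (m - a) - h (m - a) * f a.
have [lo [hi supp]] : exists lo hi : int, forall a,
    f a != 0 -> h (m - a) != 0 -> (lo <= a)%R /\ (a <= hi)%R.
  exists (if e is at_zero then N else m - M), (if e is at_zero then m - M else N).
  by move=> a /Nf fa /Mh ha; move: fa ha; rewrite /bounded; case: e; lia.
(* The window of length [p] starting at [K] is wide enough to contain the support of [F] and the
   index [m + 1]; the boundary terms of the summation by parts then vanish. *)
pose K : int := - (`|lo| + `|m| + 1)%N%:Z.
pose p := ((`|lo| + `|m| + `|hi| + 5) * 2)%N.
have supp0 a (ins : (K <= a)%R && (a < K + p - 1)%R = false) : f a = 0 \/ h (m - a) = 0.
  have [|/supp fa] := eqVneq (f a) 0; first by left.
  have [|/fa ha] := eqVneq (h (m - a)) 0; first by right.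
  by move: ins ha; rewrite /K /p; lia.
have F0 a : (K <= a)%R && (a < K + p - 1)%R = false -> F a = 0.
  by move=> /supp0[] z; rewrite /F z mulr0 mul0r subrr.
pose r : seq int := [seq K + i%:Z - 1 | i <- iota 0 p].
have ur : uniq r by rewrite map_inj_uniq ?iota_uniq // => i1 i2; lia.
have inr a : a \notin r -> (K <= a)%R && (a < K + p - 1)%R = false.
  move=> /mapP h0; apply/negP => h1; apply: h0; exists (absz (a - K + 1)); last by lia.
  by rewrite mem_iota; lia.
have sumF : (f * h - h * f) m = \sum_(i < p) F (K + i - 1).
  rewrite lcoefD lcoefN !lcoefM [X in _ - X](reindex_fsbigT (fun a => m - a)); last first.
    by exists (fun a => m - a) => a; lia.
  have z1 a : a \notin r -> f a * h (m - a) = 0.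
    by move=> /inr/supp0[] ->; rewrite ?mulr0 ?mul0r.
  have z2 a : a \notin r -> h (m - a) * f (m - (m - a)) = 0.
    rewrite (_ : m - (m - a) = a); last by lia.
    by move=> /inr/supp0[] ->; rewrite ?mulr0 ?mul0r.
  rewrite [X in X - _](fsum_seq ur z1) [X in _ - X](fsum_seq ur z2).
  rewrite -sumrB big_map -[p in iota 0 p]subn0 -/(index_iota 0 p) big_mkord; apply: eq_bigr => b _.
  by rewrite /F /=; congr (_ - _ * f _); lia.
have G (a : int) : F (a - 1) - F a =
    (L i l (m + 1 - a) *+ (a == 0) - L i l a *+ (m + 1 - a == 0)) *+ (j == k)
    - (L k j (m + 1 - a) *+ (a == 0) - L k j a *+ (m + 1 - a == 0)) *+ (l == i).
  have := gL i j k l a (m + 1 - a); rewrite /umv_mul /series_comm /series_u /series_v.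
  rewrite (_ : m + 1 - a - 1 = m - a); last by lia.
  rewrite /F (_ : m - (a - 1) = m + 1 - a) => [->|]; last by lia.
  by rewrite !mulrnBl opprD opprK !addrA.
have := abel_summation F K p; rewrite !F0; try lia.
rewrite !mul0rz addr0 subr0 -sumF => <-; under eq_bigr do rewrite G.
(* The term at index 0 is killed by its weight; the one at index [m + 1] gives the coefficient of
   the derivative. *)
have E (q : laurent e R) : \sum_(i < p)
    (q (m + 1 - (K + i)) *+ (K + i == 0) - q (K + i) *+ (m + 1 - (K + i) == 0)) *~ (K + i)
    = - lder q m.
  have hp : (absz (m + 1 - K)%R < p)%N by rewrite /K /p; lia.
  have -> : lder q m = q (m + 1) *~ (m + 1) by [].
  rewrite (bigD1 (Ordinal hp)) //= big1 => [|i' /eqP ne].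
    rewrite addr0 (_ : K + absz (m + 1 - K)%R = m + 1); last by rewrite /K; lia.
    by rewrite subrr eqxx; have [->|] := eqVneq (m + 1) 0; rewrite ?mulr0z ?oppr0 // sub0r mulNrz.
  have [->|_] := eqVneq (K + i') 0; first by rewrite mulr0z.
  rewrite (_ : (m + 1 - (K + i') == 0) = false) ?subrr ?mul0rz //.
  by apply/negP => /eqP z; apply: ne; apply: val_inj => /=; lia.
have D (V : zmodType) (X Y : 'I_p -> V) (c : 'I_p -> int) (b1 b2 : bool) :
    \sum_i (X i *+ b1 - Y i *+ b2) *~ c i = (\sum_i X i *~ c i) *+ b1 - (\sum_i Y i *~ c i) *+ b2.
  rewrite -!sumrMnl -sumrB; apply: eq_bigr => i' _.
  by rewrite mulrzBl; case: b1; case: b2; rewrite ?mulr0n ?mul0rz ?mulr1n.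
rewrite [LHS]D !E !mulNrn opprK addrC lcoefD lcoefN.
have mn (q : laurent e R) (b : bool) : (q *+ b) m = q m *+ b by case: b.
by rewrite !mn.
Qed.

(** Reflects the automorphism of gl_n that sends a matrix to minus its transpose. Hence d + L^T is
    of the form [ddz_sub] of a Lax matrix and inherits the Manin property. *)
Lemma series_gaudin_opp_tr : series_gaudin (- L^T).
Proof.
move=> i j k l a b; have := gL j i l k a b.
rewrite /umv_mul /series_comm /series_u /series_v !mxE !lcoefN !mulrNN.
rewrite ![j == k]eq_sym ![l == i]eq_sym => ->.
rewrite !mulNrn !opprK.
by rewrite [LHS](ACl (3*4*1*2))%AC.
Qed.
End SamePoint.

(** * Two independent points *)

Section TwoPoints.
Variables (e : expansion) (R : nzRingType).
Local Notation Y := (lmap (e := e) (@lconst e R)).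
Local Notation Z := (@lconst e (laurent e R)).
(* u - v in R((v))((u)), the outer variable being u *)
Definition uv : laurent e (laurent e R) := lvar - Z lvar.

Lemma lcoefB2 (F G : laurent e (laurent e R)) a b : (F - G) a b = F a b - G a b.
Proof. by []. Qed.

Lemma coef_two_point_comm (f g : laurent e R) a b :
  (Y f * Z g - Z g * Y f) a b = series_comm f g a b.
Proof. by rewrite lcoefB2 lconstMr lconstMl lconstMl lconstMr. Qed.

Lemma coef_uv_comm (f g : laurent e R) a b :
  (uv * (Y f * Z g - Z g * Y f)) a b = umv_mul (series_comm f g) a b.
Proof. by rewrite mulrBl lcoefB2 lvarMl lconstMl lvarMl !coef_two_point_comm. Qed.

(** With [Y f] for f(u) and [Z f] for f(v), the coefficientwise relation becomes an identity in an
    iterated Laurent ring, where u - v turns out to be invertible. *)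
Lemma series_gaudinE n (L : 'M[laurent e R]_n) : series_gaudin L <->
  forall i j k l, uv * (Y (L i j) * Z (L k l) - Z (L k l) * Y (L i j)) =
    (Z (L i l) - Y (L i l)) *+ (j == k) - (Z (L k j) - Y (L k j)) *+ (l == i).
Proof.
have E i j k l a b : ((Z (L i l) - Y (L i l)) *+ (j == k)
      - (Z (L k j) - Y (L k j)) *+ (l == i)) a b =
    series_v (L i l) a b *+ (j == k) - series_u (L i l) a b *+ (j == k)
      - series_v (L k j) a b *+ (l == i) + series_u (L k j) a b *+ (l == i).
  have vE f : (Z f - Y f) a b = series_v f a b - series_u f a b.
    by rewrite lcoefB2 /= /series_v /series_u; case: (a == 0).
  have mn (q : laurent e (laurent e R)) (c : bool) : (q *+ c) a b = q a b *+ c by case: c.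
  by rewrite lcoefB2 !mn !vE !mulrnBl opprD opprK !addrA.
split=> [gL i j k l|gL i j k l a b].
  by apply: laurentP => a; apply: laurentP => b; rewrite coef_uv_comm E; apply: gL.
by rewrite -E -gL coef_uv_comm.
Qed.

End TwoPoints.

Section LaxPair.
Variables (A : nzRingType) (n : nat) (x s X K : A) (y z M W : 'M[A]_n).
Hypothesis xs : x * s = 1.
Hypothesis sx : s * x = 1.
Hypothesis ME : forall i j, M i j = X *+ (i == j) - y i j.
Hypothesis WE : forall i j, W i j = K *+ (i == j) + z j i.
Hypothesis Xx : X * x = x * X + 1.
Hypothesis Kx : K * x = x * K - 1.
Hypothesis XK : GRing.comm X K.
Hypothesis Xz : forall i j, GRing.comm X (z i j).
Hypothesis Ky : forall i j, GRing.comm K (y i j).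
Hypothesis xy : forall i j, GRing.comm x (y i j).
Hypothesis xz : forall i j, GRing.comm x (z i j).
Hypothesis yz : forall i j k l, x * (y i j * z k l - z k l * y i j) =
  (z i l - y i l) *+ (j == k) - (z k j - y k j) *+ (l == i).

Lemma lax_Mx i j : M i j * x = x * M i j + (i == j)%:R.
Proof.
rewrite ME mulrBl mulrBr -xy addrAC; congr (_ - _).
by rewrite mulrnAl mulrnAr Xx mulrnDl.
Qed.

Lemma lax_Wx i j : W i j * x = x * W i j - (i == j)%:R.
Proof.
rewrite WE mulrDl mulrDr -xz addrAC; congr (_ + _).
by rewrite mulrnAl mulrnAr Kx mulrnBl.
Qed.

(** The derivations contribute nothing to the commutator. On the right, [M a b + W b a] is a
    diagonal term [U] plus [z a b - y a b], and the two occurrences of [U] cancel. *)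
Lemma lax_MW i j p q : x * (M i j * W p q - W p q * M i j) =
  (M q j + W j q) *+ (i == p) - (M i p + W p i) *+ (j == q).
Proof.
have [U MWE] : exists U, forall a b, M a b + W b a = U *+ (a == b) + (z a b - y a b).
  by exists (X + K) => a b; rewrite ME WE [b == a]eq_sym mulrnDl addrACA [- _ + _]addrC.
rewrite !MWE [q == j]eq_sym.
have cancelU (a b : A) : (U *+ (j == q) + a) *+ (i == p) - (U *+ (i == p) + b) *+ (j == q) =
    a *+ (i == p) - b *+ (j == q).
  by rewrite !mulrnDl mulrnAC opprD addrACA subrr add0r.
rewrite cancelU.
have cW : GRing.comm (X *+ (i == j)) (W p q).
  rewrite WE; apply/commr_sym/commrMn/commr_sym/commrD; last exact: Xz.
  exact: commrMn.
have cy : GRing.comm (y i j) (K *+ (p == q)) by apply/commrMn/commr_sym.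
have -> : M i j * W p q - W p q * M i j = - (y i j * z q p - z q p * y i j).
  rewrite ME mulrBl mulrBr cW opprB addrC addrA subrK.
  by rewrite WE mulrDl mulrDr cy opprD addrACA subrr add0r opprB.
by rewrite mulrN yz opprB [p == i]eq_sym.
Qed.

End LaxPair.

Lemma lconst_lvar_sub e (S : nzRingType) (w c d : S) : w * c = c * w + d ->
  lconst w * (lvar - lconst c) = (lvar - lconst c) * lconst w - lconst d :> laurent e S.
Proof. by move=> wc; rewrite mulrBr mulrBl -lvar_comm -!rmorphM wc rmorphD opprD addrA. Qed.

Section DualHamiltonians.
Variables (e : expansion) (R S : nzRingType) (dC : {rmorphism laurent e R -> S}) (D : S).
Hypothesis DdC : forall f, D * dC f = dC f * D + dC (der f).
Local Notation Y := (lmap (e := e) (@lconst e R)).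
Local Notation Z := (@lconst e (laurent e R)).
(** The two derivations live in nested rings: differential operators in u over Laurent series in u
    with coefficients in [S], where [S] already contains d_v as [D]. The map [T] embeds the series
    in u and v. *)
Let T : {rmorphism laurent e (laurent e R) -> diffop (laurent e S)} :=
  @dopC (laurent e S) \o lmap dC.
Let K : diffop (laurent e S) := dopC (lconst D).
Let X := ddz (laurent e S).

Lemma uv_unit : exists s : laurent e (laurent e R), uv e R * s = 1 /\ s * uv e R = 1.
Proof. by have [t [h1 h2]] := lvar_unit e R; apply: lvar_subC_unit h1 h2. Qed.

Lemma uv_commE (F : laurent e (laurent e R)) :
  lconst lvar * F = F * lconst lvar -> uv e R * F = F * uv e R.
Proof. by move=> h; rewrite mulrBl mulrBr h lvar_comm. Qed.

Lemma uv_Y f : uv e R * Y f = Y f * uv e R.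
Proof. by apply/uv_commE/laurentP => m; rewrite lconstMl lconstMr lvar_comm. Qed.

Lemma uv_Z f : uv e R * Z f = Z f * uv e R.
Proof. by apply/uv_commE/laurentP => m; rewrite lconstMl lconstMr /= mulrnAl mulrnAr lvar_comm. Qed.

Lemma X_T F : X * T F = T F * X + T (der F).
Proof. by rewrite /T /= -der_lmap; apply: ddz_dopC. Qed.

Lemma K_Y f : GRing.comm K (T (Y f)).
Proof.
suff h : GRing.comm (lconst D) (lmap dC (Y f)) by rewrite /GRing.comm /K /T /= -!rmorphM h.
apply: laurentP => m; rewrite lconstMl lconstMr /= DdC der_lconst.
by rewrite rmorph0 addr0.
Qed.

Lemma K_uv : K * T (uv e R) = T (uv e R) * K - 1.
Proof.
have E : lmap dC (uv e R) = lvar - lconst (dC lvar).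
  apply: laurentP => m; rewrite /= rmorphB !rmorphMn !rmorph1.
  by [].
have L : lconst D * lmap dC (uv e R) = lmap dC (uv e R) * lconst D - 1.
  rewrite E (@lconst_lvar_sub _ _ D (dC lvar) 1) ?rmorph1 //.
  by rewrite DdC der_lvar rmorph1.
by rewrite /K /T /= -rmorphM L rmorphB rmorphM rmorph1.
Qed.

Variables (n : nat) (L : 'M[laurent e R]_n).
Hypothesis gL : series_gaudin L.

Variables (A B : nzRingType) (f : {rmorphism A -> diffop (laurent e S)}).
Variables (h : {rmorphism B -> diffop (laurent e S)}) (N : 'M[A]_n) (N' : 'M[B]_n).

Lemma det_column_commute_two_points :
    (forall i j, f (N i j) = X *+ (i == j) - T (Y (L i j))) ->
    (forall i j, h (N' i j) = K *+ (i == j) + T (Z (L j i))) ->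
    manin N -> manin N' ->
  f (det_column N) * h (det_column N') = h (det_column N') * f (det_column N).
Proof.
move=> fN hN mN mN'; rewrite !det_column_map.
have [MM MM2] := manin_map f mN; have [WW WW2] := manin_map h mN'.
have ME i j : map_mx f N i j = X *+ (i == j) - T (Y (L i j)) by rewrite mxE.
have WE i j : map_mx h N' i j = K *+ (i == j) + T (Z (L j i)) by rewrite mxE.
move: (map_mx f N) (map_mx h N') ME WE MM MM2 WW WW2 => M W ME WE MM MM2 WW WW2.
have [s [us su]] := uv_unit.
pose y := map_mx (fun f => T (Y f)) L; pose z := map_mx (fun f => T (Z f)) L.
have {}ME i j : M i j = X *+ (i == j) - y i j by rewrite mxE.
have {}WE i j : W i j = K *+ (i == j) + z j i by rewrite mxE.
have Xx : X * T (uv e R) = T (uv e R) * X + 1.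
  by rewrite X_T derD derN der_lvar der_lconst oppr0 addr0 rmorph1.
have xy i j : GRing.comm (T (uv e R)) (y i j) by rewrite /GRing.comm mxE -!rmorphM uv_Y.
have xz i j : GRing.comm (T (uv e R)) (z i j) by rewrite /GRing.comm mxE -!rmorphM uv_Z.
apply: (@det_column_commute _ _ (T (uv e R)) (T s)) => //.
- by rewrite -rmorphM us rmorph1.
- by rewrite -rmorphM su rmorph1.
- exact: lax_Mx ME Xx xy.
- exact: lax_Wx WE K_uv xz.
- apply: (lax_MW ME WE) => [||i j|i j k l].
  + by apply: ddz_comm_dopC; apply: der_lconst.
  + by move=> i j; rewrite /GRing.comm mxE X_T der_lconst rmorph0 addr0.
  + by rewrite mxE; apply: K_Y.
  by rewrite !mxE -!rmorphM -!rmorphB -rmorphM (series_gaudinE L).1 // !rmorphB !rmorphMn !rmorphB.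
Qed.

End DualHamiltonians.

Lemma comm_dopC_lconst e (S : nzRingType) (p : diffop (laurent e S)) (c : S) :
  p * dopC (lconst c) = dopC (lconst c) * p ->
  forall i a, dopcoef p i a * c = c * dopcoef p i a.
Proof.
by move=> C i a; rewrite -dopcoef_M_lconst C dopcoef_lconst_M.
Qed.

Theorem QH_commute_dual e (R : nzRingType) n (L : 'M[laurent e R]_n) i j :
  series_gaudin L -> series_commute (QH L i) (QH (- L^T) j).
Proof.
move=> gL; pose B0 := diffop (laurent e R).
have mD := manin_ddz_sub (series_gaudin_same_point gL).
have mD' := manin_ddz_sub (series_gaudin_same_point (series_gaudin_opp_tr gL)).
pose c0 : {rmorphism R -> diffop (laurent e R)} := @dopC (laurent e R) \o @lconst e R.
have gder f : der (lmap (e := e) c0 f) = lmap c0 (der f) by apply: der_lmap.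
pose k : {rmorphism B0 -> diffop (laurent e (diffop (laurent e R)))} :=
  @dopC (laurent e (diffop (laurent e R))) \o @lconst e (diffop (laurent e R)).
have ME a b : dopmap gder (ddz_sub L a b) =
    ddz _ *+ (a == b) - dopC (lmap (@dopC (laurent e R)) (lmap (@lconst e R) (L a b))).
  rewrite !mxE rmorphB rmorphMn /= dopmapC dopmap_ddz; congr (_ - dopC _).
  exact: laurentP.
have WE a b : k (ddz_sub (- L^T) a b) = dopC (lconst (ddz (laurent e R))) *+ (a == b)
    + dopC (lmap (@dopC (laurent e R)) (lconst (L b a))).
  rewrite !mxE [dopC (- _)]rmorphN opprK rmorphD rmorphMn; congr (_ + dopC _).
  by apply: laurentP => m; rewrite /= rmorphMn.
have C := det_column_commute_two_points (@ddz_dopC (laurent e R)) gL ME WE mD mD'.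
move=> a b; apply/eqP; rewrite subr_eq0; apply/eqP.
(* The determinant at v is constant for u, so it commutes with every coefficient in u of the other
   determinant; the same argument in v then separates its own coefficients. *)
have := comm_dopC_lconst C i a.
rewrite dopcoef_map => /esym C1; exact/esym/(comm_dopC_lconst C1 j b).
Qed.

(** * Commutants *)

Section Commutant.
Variables (e : expansion) (R : nzRingType) (f : laurent e R).
Implicit Types (g h : laurent e R) (X : diffop (laurent e R)).

Lemma series_commuteP g : series_commute f g <-> forall a b, GRing.comm (f a) (g b).
Proof.
split=> h a b; last by apply/eqP; rewrite subr_eq0; apply/eqP/h.
by apply/eqP; rewrite -subr_eq0; apply/eqP/(h a b).
Qed.

Lemma series_commute_sym g : series_commute f g -> series_commute g f.
Proof.
move=> /series_commuteP fg a b; apply/eqP; rewrite subr_eq0; apply/eqP/esym/fg.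
Qed.

Lemma series_commute0 : series_commute f 0.
Proof. by apply/series_commuteP => a b; apply: commr0. Qed.

Lemma series_commute1 : series_commute f 1.
Proof. by apply/series_commuteP => a b; apply/commr_nat. Qed.

Lemma series_commuteD g h : series_commute f g -> series_commute f h -> series_commute f (g + h).
Proof.
move=> /series_commuteP fg /series_commuteP fh; apply/series_commuteP => a b.
by rewrite lcoefD; apply: commrD.
Qed.

Lemma series_commuteN g : series_commute f g -> series_commute f (- g).
Proof.
move=> /series_commuteP fg; apply/series_commuteP => a b.
by rewrite lcoefN; apply: commrN.
Qed.

Lemma series_commuteB g h : series_commute f g -> series_commute f h -> series_commute f (g - h).
Proof. by move=> fg /series_commuteN; apply: series_commuteD. Qed.

Lemma series_commute_sum (I : Type) (r : seq I) (P : pred I) (E : I -> laurent e R) :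
  (forall i, P i -> series_commute f (E i)) -> series_commute f (\sum_(i <- r | P i) E i).
Proof.
move=> fE; elim/big_rec: _ => [|i g Pi]; first exact: series_commute0.
by apply: series_commuteD; apply: fE.
Qed.

Lemma series_commuteMn g n : series_commute f g -> series_commute f (g *+ n).
Proof.
move=> fg; elim: n => [|n IHn]; first exact: series_commute0.
by rewrite mulrS; apply: series_commuteD.
Qed.

(** Each coefficient of a product is a finite sum of products of coefficients. With
    [series_commute_der], what commutes with all coefficients of [f] is closed under differential
    polynomials. *)
Lemma series_commuteM g h : series_commute f g -> series_commute f h -> series_commute f (g * h).
Proof.
move=> /series_commuteP fg /series_commuteP fh; apply/series_commuteP => a m.
have [N Ng] := laurent_bnd g; have [M Mh] := laurent_bnd h.
rewrite [X in GRing.comm _ X](lmul_coefE m Ng Mh).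
by apply: commr_sum => b _; apply: commrM.
Qed.

Lemma series_commute_der g : series_commute f g -> series_commute f (der g).
Proof.
move=> /series_commuteP fg; apply/series_commuteP => a b; rewrite /= /lder_coef -mulrzr.
by apply: commrM => //; apply: commr_int.
Qed.

Lemma series_commute_lconst a : series_commute f (lconst a) <-> forall m, GRing.comm (f m) a.
Proof.
split=> [/series_commuteP fa m|fa]; first exact: (fa m 0).
by apply/series_commuteP => m b /=; apply: commrMn.
Qed.

Lemma series_commute_comm g : series_commute f g -> GRing.comm f g.
Proof.
move=> /series_commuteP fg; apply: laurentP => m.
have [N Nf] := laurent_bnd f; have [M Mg] := laurent_bnd g.
rewrite [RHS]lcoefM [RHS](reindex_fsbigT (fun a => m - a)); last first.
  by exists (fun a => m - a) => a; lia.
apply: eq_fsbigr => a _; rewrite (_ : m - (m - a) = a); last by lia.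
exact: fg.
Qed.

Definition dop_commute X := forall i, series_commute f (dopcoef X i).

Lemma dop_commuteC g : series_commute f g -> dop_commute (dopC g).
Proof. by move=> fg i; rewrite dopcoefC; apply: series_commuteMn. Qed.

Lemma dop_commuteD X Y : dop_commute X -> dop_commute Y -> dop_commute (X + Y).
Proof. by move=> fX fY i; rewrite dopcoefD; apply: series_commuteD. Qed.

Lemma dop_commuteN X : dop_commute X -> dop_commute (- X).
Proof. move=> fX i; have -> : dopcoef (- X) i = - dopcoef X i by apply: coefN.
exact: series_commuteN. Qed.

Lemma dop_commute_sum (I : Type) (r : seq I) (P : pred I) (E : I -> diffop (laurent e R)) :
  (forall i, P i -> dop_commute (E i)) -> dop_commute (\sum_(i <- r | P i) E i).
Proof.
by move=> fE j; rewrite dopcoef_sum; apply: series_commute_sum => i Pi; apply: fE.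
Qed.

Lemma dop_commute_ddM X : dop_commute X -> dop_commute (ddz _ * X).
Proof.
move=> fX i; rewrite dopcoef_ddM; apply: series_commuteD; last exact: series_commute_der.
by case: i => [|i]; [apply: series_commute0 | apply: fX].
Qed.

Lemma dop_commuteM X Y : dop_commute X -> dop_commute Y -> dop_commute (X * Y).
Proof.
move=> fX fY; rewrite (@dopE _ (size (X : {poly _})) X) // mulr_suml.
apply: dop_commute_sum => i _; rewrite -mulrA => j; rewrite dopcoef_CM.
apply: series_commuteM; first exact: fX.
suff h k : dop_commute (ddz _ ^+ k * Y) by apply: h.
by elim: k => [|k IHk]; rewrite ?mul1r // exprS -mulrA; apply: dop_commute_ddM.
Qed.

Lemma dop_commute1 : dop_commute 1.
Proof. exact/dop_commuteC/series_commute1. Qed.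

Lemma dop_commuteX X k : dop_commute X -> dop_commute (X ^+ k).
Proof.
move=> fX; elim: k => [|k IHk]; first exact: dop_commute1.
by rewrite exprS; apply: dop_commuteM.
Qed.

Lemma dop_commute_ddz : dop_commute (ddz _).
Proof. by rewrite -[ddz _]mulr1; apply/dop_commute_ddM/dop_commute1. Qed.

End Commutant.

(** * The determinants of d - L and d + L^T are adjoint *)

(* The exchange of (i, j) and (k, l) swaps the two terms on the right-hand side
   of the Gaudin relation. *)
Lemma weighted_sum_commutator (A : nzRingType) n (x : A) (w y z : 'I_n -> 'I_n -> A) :
    (forall i j k l, GRing.comm (w i j) (w k l)) ->
    (forall i j k l, GRing.comm (w i j) (y k l)) ->
    (forall i j k l, GRing.comm (w i j) (z k l)) ->
    (forall i j, GRing.comm (w i j) x) ->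
    (forall i j k l, x * (y i j * z k l - z k l * y i j) =
       (z i l - y i l) *+ (j == k) - (z k j - y k j) *+ (l == i)) ->
  let Sy := \sum_i \sum_j w i j * y i j in let Sz := \sum_i \sum_j w i j * z i j in
  x * (Sy * Sz - Sz * Sy) = 0.
Proof.
move=> ww wy wz wx yz Sy Sz; pose I := ('I_n * 'I_n)%type.
pose G (p q : I) := w p.1 p.2 * w q.1 q.2 * ((z p.1 q.2 - y p.1 q.2) *+ (p.2 == q.1)).
have yE : Sy = \sum_(p : I) w p.1 p.2 * y p.1 p.2 by rewrite /Sy pair_big.
have zE : Sz = \sum_(p : I) w p.1 p.2 * z p.1 p.2 by rewrite /Sz pair_big.
have -> : x * (Sy * Sz - Sz * Sy) = \sum_(p : I) \sum_(q : I) G p q - \sum_p \sum_q G q p.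
  rewrite yE zE mulr_suml [X in _ - X]mulr_suml.
  rewrite [X in _ - X](eq_bigr _ (fun p _ => mulr_sumr _ _ _ _)).
  rewrite [X in _ - X]exchange_big -sumrB mulr_sumr -sumrB; apply: eq_bigr => p _ /=.
  rewrite mulr_sumr -!sumrB mulr_sumr; apply: eq_bigr => q _.
  have swap (a b c d : A) : GRing.comm b c -> a * b * (c * d) = a * c * (b * d).
    by move=> bc; rewrite -!mulrA (mulrA b) bc -mulrA.
  rewrite swap; last by apply/commr_sym/wy.
  rewrite [X in _ - X]swap; last by apply/commr_sym/wz.
  rewrite -(ww p.1) -mulrBr mulrA (commrM (commr_sym (wx p.1 p.2)) (commr_sym (wx q.1 q.2))).
  by rewrite -mulrA yz mulrBr /G (ww q.1).
rewrite [X in _ - X]exchange_big; exact: subrr.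
Qed.

Section Adjoint.
Variable A : diffRingType.
Implicit Types (X : diffop A) (a : A).

(* the formal adjoint: d is mapped to -d and products are reversed *)
Definition dop_adj X : diffop A :=
  \sum_(i < size (X : {poly A})) (- ddz A) ^+ i * dopC (dopcoef X i).

Lemma dop_adjE m X : (size (X : {poly A}) <= m)%N ->
  dop_adj X = \sum_(i < m) (- ddz A) ^+ i * dopC (dopcoef X i).
Proof.
move=> le_m; rewrite /dop_adj.
rewrite (big_ord_widen m (fun i => (- ddz A) ^+ i * dopC (dopcoef X i)) le_m).
rewrite big_mkcond; apply: eq_bigr => i _; case: ltnP => // le_i.
by rewrite /dopcoef nth_default // rmorph0 mulr0.
Qed.

Lemma dop_adjD X1 X2 : dop_adj (X1 + X2) = dop_adj X1 + dop_adj X2.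
Proof.
pose m := maxn (size (X1 : {poly A})) (size (X2 : {poly A})).
rewrite !(@dop_adjE m) ?leq_maxl ?leq_maxr //; last exact: size_polyD.
by rewrite -big_split; apply: eq_bigr => i _; rewrite dopcoefD rmorphD mulrDr.
Qed.

(** Over noncommutative coefficients the adjoint reverses this product only because [a] commutes
    with the coefficients of [X]. *)
Lemma dop_adj_CM a X : (forall i, GRing.comm a (dopcoef X i)) ->
  dop_adj (dopC a * X) = dop_adj X * dopC a.
Proof.
move=> aX; rewrite (@dop_adjE (size (X : {poly A}))); last first.
  by rewrite /GRing.mul /= dopmulCl size_scale_leq.
rewrite mulr_suml; apply: eq_bigr => i _.
by rewrite dopcoef_CM aX rmorphM mulrA.
Qed.

Lemma dop_adj_ddM X : dop_adj (ddz A * X) = dop_adj X * - ddz A.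
Proof.
pose m := size (X : {poly A}); rewrite (@dop_adjE m.+1); last first.
  apply/leq_sizeP => j mj; have z k : (m <= k)%N -> dopcoef X k = 0 by apply: nth_default.
  rewrite -[LHS]/(dopcoef (ddz A * X) j) dopcoef_ddM z ?der0; last exact: ltnW.
  by case: j mj => // j mj; rewrite z // addr0.
under eq_bigr do rewrite dopcoef_ddM rmorphD mulrDr.
rewrite big_split /= big_ord_recl /= rmorph0 mulr0 add0r [X in _ + X]big_ord_recr /=.
rewrite [X in der X](_ : dopcoef X m = 0) ?der0 ?rmorph0 ?mulr0 ?addr0; last first.
  exact: nth_default.
rewrite -big_split mulr_suml; apply: eq_bigr => i _ /=.
rewrite exprSr -!mulrA -mulrDr; congr (_ * _).
by rewrite mulNr mulrN ddz_dopC opprD addrNK.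
Qed.

Lemma dop_adjMn X m : dop_adj (X *+ m) = dop_adj X *+ m.
Proof.
elim: m => [|m IHm]; last by rewrite !mulrS dop_adjD IHm.
by rewrite !mulr0n /dop_adj size_poly0 big_ord0.
Qed.

Lemma dop_adj_sign k X : dop_adj ((-1) ^+ k * X) = (-1) ^+ k * dop_adj X.
Proof.
elim: k => [|k IHk]; first by rewrite !mul1r.
rewrite !exprS !mulN1r !mulNr -IHk; apply: (addIr (dop_adj ((-1) ^+ k * X))).
by rewrite -dop_adjD !addNr -[0](mulr0n (0 : diffop A)) dop_adjMn.
Qed.

End Adjoint.

Lemma dop_adj_map (A B : diffRingType) (g : {rmorphism A -> B})
    (gder : forall a, der (g a) = g (der a)) X :
  dop_adj (dopmap gder X) = dopmap gder (dop_adj X).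
Proof.
rewrite (@dop_adjE _ (size (X : {poly A}))) ?size_poly // rmorph_sum.
apply: eq_bigr => i _; rewrite rmorphM rmorphXn rmorphN /= dopmap_ddz dopmapC.
by rewrite dopcoef_map.
Qed.

Lemma dop_commute_adj e (R : nzRingType) (f : laurent e R) X :
  dop_commute f X -> dop_commute f (dop_adj X).
Proof.
move=> fX; apply: dop_commute_sum => i _; apply: dop_commuteM; last exact/dop_commuteC.
exact/dop_commuteX/dop_commuteN/dop_commute_ddz.
Qed.

Lemma series_gaudin_map e (R S : nzRingType) (g : {rmorphism R -> S}) n (L : 'M[laurent e R]_n) :
  series_gaudin L -> series_gaudin (map_mx (lmap g) L).
Proof.
move=> gL i j k l a b; have := congr1 g (gL i j k l a b).
rewrite /umv_mul /series_comm /series_u /series_v !mxE /=.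
by rewrite !(rmorphD, rmorphB, rmorphN, rmorphM, rmorphMn).
Qed.

Lemma rmorph_sum2 (A B : nzRingType) (g : {rmorphism A -> B}) n (a b : 'I_n -> 'I_n -> A) :
  g (\sum_i \sum_j a i j * b i j) = \sum_i \sum_j g (a i j) * g (b i j).
Proof.
rewrite rmorph_sum; apply: eq_bigr => i _; rewrite rmorph_sum; apply: eq_bigr => j _.
exact: rmorphM.
Qed.

Lemma sum_delta_sub (A : nzRingType) n (a b : 'I_n -> A) (x : A) (y : 'I_n -> 'I_n -> A) :
  \sum_i \sum_j a i * b j * (x *+ (i == j) - y i j) =
  (\sum_i a i * b i) * x - \sum_i \sum_j a i * b j * y i j.
Proof.
rewrite mulr_suml -sumrB; apply: eq_bigr => i _.
under eq_bigr do rewrite mulrBr.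
rewrite sumrB; congr (_ - _); rewrite (bigD1 i) //= eqxx big1 ?addr0 // => j ji.
by rewrite eq_sym (negPf ji) mulr0n mulr0.
Qed.

(** * Determinants as powers of one fermionic operator *)

Section FermionicPower.
Variables (F : nzRingType) (n : nat) (ep d : 'I_n + 'I_n -> F) (p : F).
Hypothesis edp : car ep d p.
Variables (e : expansion) (L : 'M[laurent e F]_n).
Hypothesis gL : series_gaudin L.
Hypothesis Lep : forall i j m k, GRing.comm (L i j m) (ep k).
Let psi i := ep (inl i).
Let zeta i := ep (inr i).

Lemma even_comm a b c : GRing.comm (ep a * ep b) (ep c).
Proof.
rewrite /GRing.comm -mulrA (car_ee edp b c) mulrN (mulrA (ep a) (ep c)) (car_ee edp a c).
by rewrite mulNr opprK mulrA.
Qed.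

Definition boson : laurent e F := \sum_i \sum_j lconst (psi i * zeta j) * L i j.

(** The weights [psi i * zeta j] are even, so they commute and [weighted_sum_commutator] applies;
    the factor u - v is then cancelled. *)
Lemma boson_self_commute : series_commute boson boson.
Proof.
pose w i j : laurent e (laurent e F) := lconst (lconst (psi i * zeta j)).
pose y i j := lmap (@lconst e F) (L i j); pose z i j : laurent e (laurent e F) := lconst (L i j).
have ww i j k l : GRing.comm (w i j) (w k l).
  rewrite /GRing.comm -!rmorphM; congr (lconst (lconst _)).
  by apply: commrM; apply: even_comm.
have eL i j k l m : GRing.comm (psi i * zeta j) (L k l m).
  by apply/commr_sym/commrM; apply: Lep.
have eLL i j k l : GRing.comm (lconst (psi i * zeta j)) (L k l).
  by apply: laurentP => m; rewrite lconstMl lconstMr eL.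
have wy i j k l : GRing.comm (w i j) (y k l).
  by apply: laurentP => m; rewrite lconstMl lconstMr /= -!rmorphM eL.
have wz i j k l : GRing.comm (w i j) (z k l).
  by rewrite /GRing.comm -!rmorphM eLL.
have wx i j : GRing.comm (w i j) (uv e F).
  apply/esym/uv_commE; rewrite -!rmorphM; congr lconst; exact: lvar_comm.
have := weighted_sum_commutator ww wy wz wx ((series_gaudinE L).1 gL) => /=.
have Ez : lconst boson = \sum_i \sum_j w i j * z i j.
  exact: (rmorph_sum2 (@lconst e (laurent e F))).
have Ey : lmap (@lconst e F) boson = \sum_i \sum_j w i j * y i j.
  rewrite [LHS](rmorph_sum2 (lmap (@lconst e F))).
  have wE i j : lmap (@lconst e F) (lconst (psi i * zeta j)) = w i j.
    by apply: laurentP => m; rewrite /= rmorphMn.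
  apply: eq_bigr => i _.
  apply: eq_bigr => j _.
  exact: (congr1 (fun t => t * y i j) (wE i j)).
rewrite -Ez -Ey.
have [s [us su]] := uv_unit e F.
move=> /(congr1 ( *%R s)); rewrite mulrA su mul1r mulr0 => E a b.
by rewrite -coef_two_point_comm E.
Qed.

Let thF := \sum_i psi i * zeta i.
Let th : laurent e F := lconst thF.
Let X := ddz (laurent e F).

Lemma thF_comm c : GRing.comm thF (ep c).
Proof. by apply/commr_sym/commr_sum => i _; apply/commr_sym/even_comm. Qed.

Lemma th_boson : series_commute th boson.
Proof.
apply: series_commute_sum => i _; apply: series_commute_sum => j _; apply: series_commuteM.
  apply/series_commute_lconst => m; apply/commr_sym/commrMn/commr_sym.
  by apply: commrM; apply: thF_comm.
apply/series_commuteP => a b; apply/commr_sym/commrMn/commr_sum => k _.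
by apply: commrM; apply: Lep.
Qed.

Lemma th_th : series_commute th th.
Proof.
apply/series_commute_lconst => m; apply/commr_sym/commrMn/commr_sum => i _.
by apply: commrM; apply: thF_comm.
Qed.

(** The coefficients of a power are differential polynomials in [th] and [boson], with which both
    series commute, so each factor may be reversed in turn. *)
Lemma dop_adj_power m : dop_adj ((dopC th * X + dopC boson) ^+ m) =
  (- (dopC th * X - dopC boson)) ^+ m.
Proof.
have commP f : series_commute f th -> series_commute f boson ->
    dop_commute f ((dopC th * X + dopC boson) ^+ m).
  move=> fth fb; apply/dop_commuteX/dop_commuteD; last exact: dop_commuteC.
  by apply: dop_commuteM; [apply: dop_commuteC | apply: dop_commute_ddz].
elim: m commP => [|m IHm] commP.
  by rewrite !expr0 /dop_adj size_polyC oner_neq0 big_ord1 dopcoefC mulr1n rmorph1 mul1r.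
have {}commP f : series_commute f th -> series_commute f boson ->
    dop_commute f ((dopC th * X + dopC boson) ^+ m).
  move=> fth fb; apply/dop_commuteX/dop_commuteD; last exact: dop_commuteC.
  by apply: dop_commuteM; [apply: dop_commuteC | apply: dop_commute_ddz].
rewrite exprS mulrDl dop_adjD -mulrA dop_adj_CM; last first.
  move=> i; apply: series_commute_comm; apply: dop_commute_ddM.
  by apply: commP; [apply: th_th | apply: th_boson].
rewrite dop_adj_CM; last first.
  move=> i; apply: series_commute_comm; apply: commP; last exact: boson_self_commute.
  exact/series_commute_sym/th_boson.
rewrite dop_adj_ddM {}IHm // -mulrA -mulrDr [RHS]exprSr; congr (_ * _).
by rewrite mulNr ddz_dopC der_lconst rmorph0 addr0 opprB addrC.
Qed.

Let c1 := \prod_i psi i.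
Let c2 := \prod_i zeta i.

Lemma zeta_psi_top : c2 * c1 = (-1) ^+ n * (c1 * c2).
Proof.
by apply: prod_anticomm_ord => i j; apply: (car_ee edp).
Qed.

Let K : {rmorphism F -> diffop (laurent e F)} := @dopC (laurent e F) \o @lconst e F.

Lemma K_anticomm a b : anticomm (K (ep a)) (K (ep b)).
Proof. by rewrite /anticomm -!(rmorphM K) (car_ee edp) rmorphN. Qed.

Lemma K_sq a : K (ep a) * K (ep a) = 0.
Proof. by rewrite -(rmorphM K) (car_e2 edp) rmorph0. Qed.

Lemma K_ddz_sub (N : 'M[laurent e F]_n) i j c :
  (forall i j m k, GRing.comm (N i j m) (ep k)) -> GRing.comm (ddz_sub N i j) (K (ep c)).
Proof.
move=> Nep; rewrite !mxE; apply/commr_sym/commrB.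
  by apply/commrMn/commr_sym/ddz_comm_dopC/der_lconst.
have h : GRing.comm (lconst (ep c)) (N i j).
  by apply: laurentP => m; rewrite lconstMl lconstMr Nep.
change (dopC (lconst (ep c)) * dopC (N i j) = dopC (N i j) * dopC (lconst (ep c))).
by rewrite -!rmorphM h.
Qed.

Lemma K_boson i j f : K (psi i) * K (zeta j) * dopC f = dopC (lconst (psi i * zeta j) * f).
Proof. by rewrite -(rmorphM K) [RHS]rmorphM. Qed.

Lemma K_th : \sum_i K (psi i) * K (zeta i) = dopC th.
Proof.
by rewrite -[RHS]/(K thF) rmorph_sum; apply: eq_bigr => i _; rewrite [RHS]rmorphM.
Qed.

Lemma K_sum_boson : \sum_i \sum_j K (psi i) * K (zeta j) * dopC (L i j) = dopC boson.
Proof.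
rewrite [RHS]rmorph_sum; apply: eq_bigr => i _; rewrite [RHS]rmorph_sum.
by apply: eq_bigr => j _; rewrite K_boson.
Qed.

Lemma sum_ddz_sub_psi : \sum_i \sum_j K (psi i) * K (zeta j) * ddz_sub L i j =
  dopC th * X - dopC boson.
Proof.
rewrite -K_th -K_sum_boson -sum_delta_sub.
by apply: eq_bigr => i _; apply: eq_bigr => j _; rewrite !mxE.
Qed.

Lemma sum_ddz_sub_zeta : \sum_i \sum_j K (zeta i) * K (psi j) * ddz_sub (- L^T) i j =
  - (dopC th * X + dopC boson).
Proof.
rewrite exchange_big /=.
transitivity (- \sum_i \sum_j K (psi i) * K (zeta j) * (X *+ (i == j) - dopC (- L i j))).
  rewrite -sumrN; apply: eq_bigr => i _; rewrite -sumrN; apply: eq_bigr => j _.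
  by rewrite K_anticomm !mxE [j == i]eq_sym mulNr.
rewrite sum_delta_sub K_th -K_sum_boson; congr (- (_ + _)).
rewrite -sumrN; apply: eq_bigr => i _; rewrite -sumrN; apply: eq_bigr => j _.
by rewrite rmorphN mulrN opprK.
Qed.

Let eps : F := (n`!)%:R * (-1) ^+ 'C(n, 2).

(** The maps [s] and [t] choose the fermions of rows and columns: [psi] carries the rows of d - L
    and [zeta] those of d + L^T, so that both sums involve the same [boson]. *)
Lemma fermion_power (N : 'M[laurent e F]_n) (s t : 'I_n -> 'I_n + 'I_n)
    (w := eps * (\prod_i ep (s i) * \prod_i ep (t i))) :
    manin (ddz_sub N) -> (forall i j m k, GRing.comm (N i j m) (ep k)) ->
  (\sum_i \sum_j K (ep (s i)) * K (ep (t j)) * ddz_sub N i j) ^+ n =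
    K w * det_column (ddz_sub N) /\
  GRing.comm (K w) (det_column (ddz_sub N)).
Proof.
move=> [MM MM2] Nep.
have cK c i j : GRing.comm (ddz_sub N i j) (K (ep c)) by apply: K_ddz_sub.
have cD c : GRing.comm (K (ep c)) (det_column (ddz_sub N)).
  apply: commr_sum => u _; apply: commrM; first exact: commr_sign.
  by apply: commr_prod => j _; apply/commr_sym/cK.
have cP (q : 'I_n -> 'I_n + 'I_n) : GRing.comm (\prod_i K (ep (q i))) (det_column (ddz_sub N)).
  by apply/commr_sym/commr_prod => j _; apply/commr_sym/cD.
have wE : K w = (n`!)%:R * ((-1) ^+ 'C(n, 2) * (\prod_i K (ep (s i)) * \prod_i K (ep (t i)))).
  by rewrite /w /eps !(rmorphM K) !rmorph_prod rmorph_nat rmorph_sign -[LHS]mulrA.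
rewrite wE; split; last first.
  apply/commr_sym/commrM; first exact: commr_nat.
  by apply: commrM; [apply: commr_sign | apply: commrM; apply/commr_sym/cP].
rewrite (@manin_power _ _ (fun i => K (ep (s i))) (fun i => K (ep (t i))) (ddz_sub N)).
- by rewrite -!mulrA (cP t).
- by move=> *; apply: K_anticomm.
- by move=> *; apply: K_anticomm.
- by move=> *; apply: K_anticomm.
- by move=> *; apply: K_sq.
- by move=> *; apply: K_sq.
- by move=> *; apply: cK.
- by move=> *; apply: cK.
- exact: MM.
- exact: MM2.
Qed.

Lemma adjoint_det_top i m :
  dopcoef (dop_adj (det_column (ddz_sub (- L^T)))) i m * (eps * (c2 * c1)) =
  dopcoef (det_column (ddz_sub L)) i m * (eps * (c1 * c2)).
Proof.
have mD := manin_ddz_sub (series_gaudin_same_point gL).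
have mD' := manin_ddz_sub (series_gaudin_same_point (series_gaudin_opp_tr gL)).
have Lep' a b r k : GRing.comm ((- L^T) a b r) (ep k).
  by rewrite !mxE lcoefN; apply/commr_sym/commrN/commr_sym/Lep.
have [p1 w1] := fermion_power inl inr mD Lep.
have [p2 w2] := fermion_power inr inl mD' Lep'.
have E : det_column (ddz_sub L) * K (eps * (c1 * c2)) =
    dop_adj (det_column (ddz_sub (- L^T))) * K (eps * (c2 * c1)).
  have adjE : dop_adj (K (eps * (c2 * c1)) * det_column (ddz_sub (- L^T))) =
      dop_adj (det_column (ddz_sub (- L^T))) * K (eps * (c2 * c1)).
    apply: dop_adj_CM => j; apply: laurentP => a; rewrite lconstMl lconstMr.
    exact/esym/(comm_dopC_lconst (commr_sym w2)).
  rewrite -w1 -p1 sum_ddz_sub_psi -adjE -p2 sum_ddz_sub_zeta.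
  by rewrite [in RHS]exprNn dop_adj_sign dop_adj_power (exprNn (_ - _)) signrMK.
have := congr1 (fun q => lcoef (dopcoef q i) m) E.
have coefK q (c : F) : lcoef (dopcoef (q * K c) i) m = dopcoef q i m * c by apply: dopcoef_M_lconst.
by move=> /= h; rewrite -!coefK h.
Qed.

End FermionicPower.

Section Adjunction.
Variables (e : expansion) (R : nzRingType) (n : nat) (L : 'M[laurent e R]_n).
Hypothesis gL : series_gaudin L.
Hypothesis factP : forall r : R, r *+ n`! = 0 -> r = 0.

(** The sign is that of interchanging the two top monomials in [adjoint_det_top]. Going back to [R]
    removes the fermions, a sign and, through [factP], the factorial. *)
Lemma det_column_adjoint i m : dopcoef (det_column (ddz_sub L)) i m =
  (-1) ^+ n * dopcoef (dop_adj (det_column (ddz_sub (- L^T)))) i m.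
Proof.
have [F [f [ep [d [p [edp fe fd fp]]]]]] := car_exists R ('I_n + 'I_n)%type.
have gLF := series_gaudin_map f gL.
have LFep i1 j1 m1 k : GRing.comm (map_mx (lmap f) L i1 j1 m1) (ep k).
  by rewrite mxE; apply: fe.
have := adjoint_det_top edp gLF LFep i m.
have trL : - (map_mx (lmap (e := e) f) L)^T = map_mx (lmap f) (- L^T).
  by apply/matrixP => a b; rewrite !mxE rmorphN.
have gder a : der (lmap (e := e) f a) = lmap f (der a) by apply: der_lmap.
have adjE : dopcoef (dop_adj (det_column (ddz_sub (- (map_mx (lmap (e := e) f) L)^T)))) i m =
    f (dopcoef (dop_adj (det_column (ddz_sub (- L^T)))) i m).
  by rewrite trL (det_ddz_sub_map gder) dop_adj_map dopcoef_map.
have detE : dopcoef (det_column (ddz_sub (map_mx (lmap (e := e) f) L))) i m =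
    f (dopcoef (det_column (ddz_sub L)) i m).
  by rewrite (det_ddz_sub_map gder) dopcoef_map.
rewrite adjE detE (zeta_psi_top edp).
move: (lcoef (dopcoef (dop_adj _) i) m) (lcoef (dopcoef (det_column _) i) m) => r1 r2.
set c1 := \prod_i ep (inl i); set c2 := \prod_i ep (inr i).
move=> h; apply/eqP; rewrite -subr_eq0; apply/eqP/factP.
pose t := (-1) ^+ 'C(n, 2) * ((r2 - (-1) ^+ n * r1) *+ n`!).
suff : t = 0 by move=> /(congr1 ( *%R ((-1) ^+ 'C(n, 2)))); rewrite signrMK mulr0.
apply/fp.
have ur : uniq ([seq inl i | i <- index_enum 'I_n]
    ++ [seq inr i | i <- index_enum 'I_n] : seq ('I_n + 'I_n)).
  rewrite cat_uniq !map_inj_uniq ?index_enum_uniq ?andbT /=; try by move=> ? ? [].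
  by apply/hasPn => _ /mapP[j _ ->]; apply/mapP => -[].
apply: (car_cancel edp ur); first by move=> k; apply: fd.
rewrite big_cat !big_map mulrA -/c1 -/c2.
suff -> : f t * (c1 * c2) = 0 by rewrite mul0r.
move: (c1 * c2) h => C h.
have E r : f ((-1) ^+ 'C(n, 2) * (r *+ n`!)) * C = f r * ((n`!)%:R * (-1) ^+ 'C(n, 2) * C).
  by rewrite rmorphM rmorph_sign rmorphMn -mulr_natr -commr_sign -!mulrA.
rewrite /t mulrnBl mulrBr rmorphB mulrBl !E -h rmorphM rmorph_sign.
rewrite -(commr_sign (f r1)) -(mulrA (f r1) ((-1) ^+ n)).
have sw (a b : F) : (-1) ^+ n * (a * b) = a * ((-1) ^+ n * b).
  by rewrite mulrA -(commr_sign a) mulrA.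
by rewrite sw subrr.
Qed.

Theorem QH_commute i j : series_commute (QH L i) (QH L j).
Proof.
suff D : dop_commute (QH L i) (det_column (ddz_sub L)) by apply: D.
have D : dop_commute (QH L i) (dop_adj (det_column (ddz_sub (- L^T)))).
  by apply: dop_commute_adj => k; apply: QH_commute_dual.
move=> k; apply/series_commuteP => a b; rewrite (det_column_adjoint k b).
apply: commrM; first exact: commr_sign.
exact: ((series_commuteP _ _).1 (D k) a b).
Qed.

End Adjunction.

(** * Newton identities *)

Section Newton.
Variables (A : diffRingType) (n : nat) (L : 'M[A]_n).
Local Notation X := (ddz A).
Local Notation M := (ddz_sub L).

Lemma dopcoef_Mdd (p : diffop A) i :
  dopcoef (p * X) i = if i is j.+1 then dopcoef p j else 0.
Proof.
rewrite {1}(@dopE _ (size (p : {poly A})) p) // mulr_suml dopcoef_sum.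
under eq_bigr do rewrite -mulrA -exprSr dopcoef_CM dopcoef_ddX.
case: i => [|i]; first by rewrite big1 // => k _; rewrite mulr0.
have [lt_i|le_i] := ltnP i (size (p : {poly A})).
  rewrite (bigD1 (Ordinal lt_i)) //= eqxx mulr1 big1 ?addr0 // => k ki.
  by rewrite eqSS eq_sym; rewrite -val_eqE /= in ki; rewrite (negPf ki) mulr0.
rewrite [RHS]nth_default // big1 // => k _; rewrite eqSS.
by rewrite gtn_eqF ?mulr0 // (leq_trans (ltn_ord k)).
Qed.

Lemma dopcoef_MC_high (p : diffop A) a m :
  (forall i, (m <= i)%N -> dopcoef p i = 0) ->
  forall i, (m <= i)%N -> dopcoef (p * dopC a) i = 0.
Proof.
move=> p0 i mi; have sp : (size (p : {poly A}) <= m)%N by apply/leq_sizeP.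
rewrite (@dopE _ m p) // mulr_suml dopcoef_sum big1 // => k _.
rewrite -mulrA dopcoef_CM; suff -> : dopcoef (X ^+ k * dopC a) i = 0 by rewrite mulr0.
have : (k < i)%N by rewrite (leq_trans (ltn_ord k)).
elim: (k : nat) i {mi} => [|j IHj] i ji.
  by rewrite mul1r dopcoefC; case: i ji.
rewrite exprS -mulrA dopcoef_ddM; case: i ji => // i ji.
by rewrite !IHj ?der0 ?addr0 // ltnW.
Qed.

(* Right multiplication by d - L shifts the leading coefficients. *)
Lemma mulmx_ddz_sub_inj (Y : 'M[diffop A]_n) (C : 'M[A]_n) :
  Y *m M = map_mx (@dopC A) C -> Y = 0.
Proof.
move=> YM; suff Y0 l m i : dopcoef (Y l m) i = 0.
  by apply/matrixP => l m; rewrite mxE; apply: dopP => i; rewrite Y0 /dopcoef coef0.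
pose N := (\max_l \max_m size (Y l m : {poly A}))%N.
have YN l' m' i' : (N <= i')%N -> dopcoef (Y l' m') i' = 0.
  move=> Ni; apply: nth_default; apply: leq_trans Ni.
  by apply: leq_trans (leq_bigmax l'); apply: leq_trans (leq_bigmax m').
suff {l m i} Yk k : (k <= N)%N -> forall l m i, (N - k <= i)%N -> dopcoef (Y l m) i = 0.
  by apply: (Yk N) => //; rewrite subnn.
elim: k => [|k IHk] kN l m i; first by rewrite subn0; apply: YN.
rewrite leq_eqVlt => /orP[/eqP ei|]; last first.
  by rewrite subnSK // => le_i; apply: IHk => //; apply: ltnW.
have le_i1 : (N - k <= i.+1)%N by rewrite -ei subnSK.
have := congr1 (fun Z : 'M_n => dopcoef (Z l m) i.+1) YM.
rewrite !mxE dopcoefC mulr0n dopcoef_sum.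
have -> : \sum_j dopcoef (Y l j * M j m) i.+1 = \sum_j dopcoef (Y l j) i *+ (j == m).
  apply: eq_bigr => j _; rewrite !mxE mulrBr dopcoefB.
  rewrite (@dopcoef_MC_high _ _ (N - k)) ?subr0 //; last by move=> *; apply: IHk => //; apply: ltnW.
  by case: (j == m); rewrite ?mulr1n ?mulr0n ?dopcoef_Mdd ?mulr0 // /dopcoef coef0.
by rewrite (bigD1 m) //= eqxx mulr1n big1 ?addr0 // => j /negPf->.
Qed.

(** Quotients of the right division of d^i by d - L. The recursion comes from d P = P (d - L) + (P L
    + P'), whose last part is also the recursion of the quantum powers. *)
Fixpoint dop_quot i : 'M[diffop A]_n :=
  if i is j.+1 then X *: dop_quot j + map_mx (@dopC A) (qpow L j) else 0.

Lemma dop_quotP i : (X ^+ i)%:M = dop_quot i *m M + map_mx (@dopC A) (qpow L i).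
Proof.
elim: i => [|i IHi] /=; first by rewrite mul0mx add0r map_mx1.
have -> : (X ^+ i.+1)%:M = X *: (dop_quot i *m M + map_mx (@dopC A) (qpow L i)).
  by rewrite -IHi exprS; apply/matrixP => k l; rewrite !mxE mulrnAr.
rewrite scalerDr scalemxAl mulmxDl -addrA; congr (_ + _).
apply/matrixP => k l; rewrite !mxE ddz_dopC rmorphD addrA; congr (_ + _).
rewrite rmorph_sum -[LHS]addr0.
have -> : \sum_j map_mx (@dopC A) (qpow L i) k j * M j l =
    dopC (qpow L i k l) * X - \sum_j dopC (qpow L i k j * L j l).
  rewrite (bigD1 l) //= [in RHS](bigD1 l) //= !mxE eqxx mulr1n mulrBr -rmorphM opprD !addrA.
  congr (_ + _); rewrite -sumrN; apply: eq_bigr => j jl.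
  by rewrite !mxE (negPf jl) sub0r mulrN rmorphM.
by rewrite addrNK addr0.
Qed.

Hypothesis mM : manin M.
Local Notation D := (det_column M).

Lemma det_column_quot :
  D%:M = (\sum_(i < n.+1) dopC (QH L i) *: dop_quot i) *m M
         + map_mx (@dopC A) (\sum_(i < n.+1) QH L i *: qpow L i).
Proof.
transitivity (\sum_(i < n.+1) dopC (QH L i) *: ((X ^+ i)%:M : 'M[diffop A]_n)).
  apply/matrixP => k l; rewrite !mxE det_column_QH summxE -sumrMnl.
  by apply: eq_bigr => i _; rewrite !mxE mulrnAr.
rewrite mulmx_suml raddf_sum -big_split; apply: eq_bigr => i _.
rewrite dop_quotP scalerDr scalemxAl; congr (_ + _).
apply/matrixP => k l; rewrite !mxE; exact/esym/rmorphM.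
Qed.

(** The cofactors divide the determinant by d - L without remainder, so uniqueness of right division
    identifies the quotients and annihilates the other remainder. The second identity is a
    Cayley-Hamilton theorem. *)
Lemma cofactor_quot :
  \matrix_(l, k) col_cofactor M l k = \sum_(i < n.+1) dopC (QH L i) *: dop_quot i /\
  \sum_(i < n.+1) QH L i *: qpow L i = 0.
Proof.
have [MM MM2] := mM; set B := \matrix_(l, k) _.
have BM : B *m M = D%:M.
  apply/matrixP => l m; rewrite !mxE -(sum_col_cofactor MM MM2).
  by apply: eq_bigr => k _; rewrite mxE.
have e0 := det_column_quot; rewrite -BM in e0.
have /mulmx_ddz_sub_inj/eqP : (B - \sum_(i < n.+1) dopC (QH L i) *: dop_quot i) *m M =
    map_mx (@dopC A) (\sum_(i < n.+1) QH L i *: qpow L i).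
  by rewrite mulmxBl e0 addrC addKr.
rewrite subr_eq0 => /eqP BQ; split=> //; move: e0; rewrite BQ -[LHS]addr0 => /addrI /esym Q0.
apply/matrixP => k l; have := congr1 (fun Z : 'M_n => dopcoef (Z k l) 0) Q0.
by rewrite !mxE dopcoefC mulr1n /dopcoef coef0.
Qed.

Lemma QH_newton : \sum_(i < n.+1) QH L i * \tr (qpow L i) = 0.
Proof.
have := congr1 mxtrace cofactor_quot.2; rewrite mxtrace0 raddf_sum => {2}<-.
by apply: eq_bigr => i _; rewrite /= mxtraceZ.
Qed.

Lemma tr_quot (z : A) : der z = 1 -> (forall i j, L i j * z = z * L i j) ->
  \sum_(i < n.+1) dopC (QH L i) * \tr (dop_quot i) = D * dopC z - dopC z * D.
Proof.
move=> z1 Lz; rewrite -(@tr_col_cofactor _ _ M).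
  have := congr1 mxtrace cofactor_quot.1; rewrite raddf_sum [LHS]/mxtrace => E.
  transitivity (\sum_i (\matrix_(l, k) col_cofactor M l k) i i).
    by rewrite E; apply: eq_bigr => i _; rewrite /= mxtraceZ.
  by apply: eq_bigr => i _; rewrite mxE.
move=> i j; rewrite !mxE mulrBl mulrBr -!rmorphM Lz addrAC; congr (_ - _).
case: (i == j); last by rewrite mul0r mulr0 addr0.
by rewrite !mulr1n ddz_dopC z1 rmorph1.
Qed.

(** Order [n] requires d in all [n] factors, hence only diagonal entries: the identity
    permutation. *)
Lemma QH_top : QH L n = 1.
Proof.
have top (s : 'S_n) r :
    dopcoef (\prod_(j <- r) M (s j) j) (size r) = \prod_(j <- r) (s j == j)%:R /\
    forall i, (size r < i)%N -> dopcoef (\prod_(j <- r) M (s j) j) i = 0.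
  elim: r => [|j r [IH1 IH2]].
    by rewrite !big_nil dopcoefC mulr1n; split=> // -[|i] // _; rewrite dopcoefC.
  rewrite !big_cons; split=> [|[|i] // lt_i].
    rewrite !mxE mulrBl dopcoefB dopcoef_CM IH2 // mulr0 subr0.
    case: (s j == j); rewrite ?mulr1n ?mulr0n ?mul0r ?mul1r; last by rewrite /dopcoef coef0.
    by rewrite dopcoef_ddM /= IH1 IH2 // der0 addr0.
  rewrite !mxE mulrBl dopcoefB dopcoef_CM IH2 ?mulr0 ?subr0; last by rewrite ltnW.
  case: (s j == j); rewrite ?mulr1n ?mulr0n ?mul0r; last by rewrite /dopcoef coef0.
  by rewrite dopcoef_ddM !IH2 ?der0 ?addr0 // ltnW.
have sz : size (index_enum 'I_n) = n by rewrite /index_enum -enumT size_enum_ord.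
have topn (s : 'S_n) : dopcoef (\prod_j M (s j) j) n = \prod_j (s j == j)%:R.
  by have := (top s (index_enum 'I_n)).1; rewrite sz.
have signM b (p : diffop A) i : dopcoef ((-1) ^+ b * p) i = (-1) ^+ b * dopcoef p i.
  by rewrite -[(-1) ^+ b](rmorph_sign (@dopC A)) dopcoef_CM.
rewrite /QH dopcoef_sum (bigD1 1%g) //= [X in _ + X]big1 ?addr0 => [|s s1].
  by rewrite signM odd_perm1 mul1r topn big1 // => j _; rewrite perm1 eqxx.
rewrite signM topn; have [j sj] : exists j, s j != j.
  apply/existsP; apply: contraR s1; rewrite negb_exists => /forallP h.
  by apply/eqP/permP => j; rewrite perm1; apply/eqP; have := h j; rewrite negbK.
rewrite (_ : \prod_(j <- _) _ = 0) ?mulr0 //.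
have /path.splitPr [r1 r2] := mem_index_enum j.
by rewrite big_cat big_cons /= (negPf sj) mul0r mulr0.
Qed.

End Newton.

(** * Traces and the commutant of the Hamiltonians *)

Section TraceCommutant.
Variables (e : expansion) (R : nzRingType) (n : nat) (L : 'M[laurent e R]_n).
Hypothesis mM : manin (ddz_sub L).
Variable f : laurent e R.
Hypothesis fQH : forall i, series_commute f (QH L i).
Local Notation t i := (\tr (qpow L i)).
Local Notation tau i := (\tr (dop_quot L i)).

Lemma tauS i : tau i.+1 = ddz _ * tau i + dopC (t i).
Proof.
rewrite raddfD /= mxtraceZ; congr (_ + _); rewrite /mxtrace rmorph_sum.
by apply: eq_bigr => j _; rewrite mxE.
Qed.

Lemma tau0 i : dopcoef (tau 0) i = 0.
Proof. by rewrite /= mxtrace0 /dopcoef coef0. Qed.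

(** In the recursion [tauS] a trace enters at order zero, and left multiplication by d raises the
    order by at most one: the coefficient of d^c in [tau i] involves [t k] only for [k + c < i]. *)
Lemma tau_commute i c : (forall k, (k + c < i)%N -> series_commute f (t k)) ->
  series_commute f (dopcoef (tau i) c).
Proof.
elim: i c => [|i IHi] c ft; first by rewrite tau0; apply: series_commute0.
have der_tau : series_commute f (der (dopcoef (tau i) c)).
  by apply/series_commute_der/IHi => k kc; apply: ft; apply: ltnW.
rewrite tauS dopcoefD dopcoef_ddM dopcoefC; case: c ft der_tau => [|c] ft der_tau.
  by rewrite add0r; apply: series_commuteD => //; apply: ft; rewrite addn0.
rewrite mulr0n addr0; apply: series_commuteD => //; apply: IHi => k kc.
by apply: ft; rewrite addnS ltnS.
Qed.

(** The extreme trace, of index [i - 1 - c], is reached by raising the order at every step; it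
    enters undifferentiated and with coefficient one. *)
Lemma tau_commute_top i c m : (m + c).+1 = i -> (forall k, (k < m)%N -> series_commute f (t k)) ->
  series_commute f (dopcoef (tau i) c - t m).
Proof.
elim: i c => [|i IHi] c // [mc] ft.
have der_tau : series_commute f (der (dopcoef (tau i) c)).
  by apply/series_commute_der/tau_commute => k kc; apply: ft; rewrite -mc ltn_add2r in kc.
rewrite tauS dopcoefD dopcoef_ddM dopcoefC; case: c mc der_tau => [|c] mc der_tau.
  by rewrite add0r -mc addn0 in der_tau *; rewrite mulr1n addrK.
rewrite mulr0n addr0 addrAC; apply: series_commuteD => //; apply: IHi => //.
by rewrite -mc addnS.
Qed.

Lemma trace_commute m : (m <= n)%N -> series_commute f (t m).
Proof.
elim/ltn_ind: m => m IHm; rewrite leq_eqVlt => /orP[/eqP mn|lt_mn].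
  (* For [m = n] the Newton identity determines the last trace, its coefficient being one by
     [QH_top]. *)
  have /eqP := QH_newton mM; rewrite big_ord_recr /= QH_top mul1r addrC addr_eq0 mn => /eqP->.
  apply/series_commuteN/series_commute_sum => i _; apply: series_commuteM => //.
  by apply: IHm; [rewrite mn | apply: ltnW].
(* At order [c] of [tr_quot] the quotient [tau n] contributes [t m] with coefficient one, and
   everything else involves only [t k] with [k < m]. *)
pose c := (n - m.+1)%N.
have ft k : (k < m)%N -> series_commute f (t k).
  by move=> km; apply: IHm => //; apply: ltnW (ltn_trans km lt_mn).
have fD : dop_commute f (det_column (ddz_sub L)) by move=> i; apply: fQH.
have fz : series_commute f lvar.
  by apply/series_commuteP => a b; apply/commrMn/commr1.
have Lz i j : L i j * lvar = lvar * L i j by rewrite lvar_comm.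
have := tr_quot mM (der_lvar e R) Lz => E.
have : series_commute f
    (dopcoef (det_column (ddz_sub L) * dopC lvar - dopC lvar * det_column (ddz_sub L)) c).
  rewrite dopcoefB; apply: series_commuteB; apply: dop_commuteM => //; exact: dop_commuteC.
rewrite -E dopcoef_sum big_ord_recr /= dopcoef_CM QH_top mul1r => sum_c.
have sum_lt : series_commute f (\sum_(i < n) dopcoef (dopC (QH L i) * tau i) c).
  apply: series_commute_sum => i _; rewrite dopcoef_CM; apply: series_commuteM => //.
  apply: tau_commute => k kc; apply: ft.
  by have := ltn_ord i; rewrite /c in kc; lia.
have tau_n : series_commute f (dopcoef (tau n) c).
  by have := series_commuteB sum_c sum_lt; rewrite addrAC subrr add0r.
have top := tau_commute_top (i := n) (c := c) (m := m) _ ft.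
have {}top := series_commuteB tau_n (top _).
by rewrite subKr in top; apply: top; rewrite /c; lia.
Qed.

End TraceCommutant.

Lemma series_traces_commute e (R : nzRingType) n (L : 'M[laurent e R]_n) k l :
    series_gaudin L -> (forall r : R, r *+ n`! = 0 -> r = 0) -> (k <= n)%N -> (l <= n)%N ->
  series_commute (QH L k) (\tr (qpow L l)) /\ series_commute (\tr (qpow L k)) (\tr (qpow L l)).
Proof.
move=> gL factP kn ln; have mM := manin_ddz_sub (series_gaudin_same_point gL).
have QHt i m : (m <= n)%N -> series_commute (QH L i) (\tr (qpow L m)).
  by apply: trace_commute => // j; apply: QH_commute.
split; first exact: QHt.
(* Now the commuting series is itself a trace, which the first part allows. *)
by apply: trace_commute => // i; apply/series_commute_sym/QHt.
Qed.

(** * Expansion of rational functions at infinity *)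

Section ScalarEvaluation.
Variables (F : numClosedFieldType) (R : algType F).
Implicit Types (p q : {poly R}) (d : {poly F}) (u v : F) (s : seq F).

Lemma horner_scalar_coef N p u : (size p <= N)%N ->
  p.[u%:A] = \sum_(i < N) u ^+ i *: p`_i.
Proof.
move=> sp; rewrite (horner_coef_wide _ sp); apply: eq_bigr => i _.
by rewrite -[u%:A]/(in_alg R u) -rmorphXn /= mulr_algr.
Qed.

Lemma scalars_avoiding s N :
  exists r : seq F, [/\ uniq r, size r = N & {in r, forall u, u \notin s}].
Proof.
pose r0 : seq F := [seq i%:R | i <- iota 0 (N + size s)].
have ur0 : uniq r0 by rewrite map_inj_uniq ?iota_uniq //; apply: mulrIn; rewrite oner_eq0.
have : (N <= size [seq u <- r0 | u \notin s])%N.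
  have : (size [seq u <- r0 | u \in s] <= size s)%N.
    by apply: uniq_leq_size; rewrite ?filter_uniq // => u; rewrite mem_filter => /andP[].
  have -> : size [seq u <- r0 | u \notin s] = (N + size s - size [seq u <- r0 | u \in s])%N.
    rewrite -(size_iota 0 (N + size s)) -(size_map (fun i => i%:R : F)) -/r0 !size_filter.
    by rewrite -(count_predC (fun u => u \in s) r0) addKn.
  by lia.
move=> le_N; exists (take N [seq u <- r0 | u \notin s]); split.
- by rewrite take_uniq ?filter_uniq.
- exact: size_takel.
- by move=> u /mem_take; rewrite mem_filter => /andP[].
Qed.

(** As [R] may have zero divisors, roots are not counted: the coefficients are recovered from the
    values at distinct scalars by an inverse Vandermonde matrix. *)
Lemma scalar_roots_eq0 s p : (forall u, u \notin s -> p.[u%:A] = 0) -> p = 0.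
Proof.
move=> p0; pose N := size p; have [r [ur sr rs]] := scalars_avoiding s N.
pose a := \row_(j < N) r`_j; pose V := Vandermonde N a.
have Vu : V \in unitmx.
  rewrite unitmxE det_Vandermonde unitfE; apply/prodf_neq0 => i _; apply/prodf_neq0 => j ij.
  rewrite !mxE subr_eq0 nth_uniq ?sr //.
  by rewrite gtn_eqF.
apply/polyP => i; rewrite coef0; have [lt_i|] := ltnP i N; last by move=> ?; rewrite nth_default.
transitivity (\sum_(k < N) (V *m invmx V) k (Ordinal lt_i) *: p`_k).
  rewrite mulmxV // (bigD1 (Ordinal lt_i)) //= big1 ?addr0 => [|k ki].
    by rewrite mxE eqxx scale1r.
  by rewrite mxE (negPf ki) scale0r.
transitivity (\sum_(j < N) invmx V j (Ordinal lt_i) *: p.[(r`_j)%:A]).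
  under [RHS]eq_bigr do rewrite (@horner_scalar_coef N) // scaler_sumr.
  rewrite exchange_big; apply: eq_bigr => k _ /=; rewrite !mxE scaler_suml.
  by apply: eq_bigr => j _; rewrite !mxE scalerA mulrC.
rewrite big1 // => j _; rewrite p0 ?scaler0 //; apply: rs; apply: mem_nth; by rewrite sr.
Qed.

Lemma comm_poly_scalar p u : comm_poly p u%:A.
Proof. by rewrite /comm_poly mulr_algl mulr_algr. Qed.

Definition eval_scalar u p := p.[u%:A].

Lemma eval_scalar_is_zmod_morphism u : zmod_morphism (eval_scalar u).
Proof. by move=> p q; rewrite /eval_scalar hornerD hornerN. Qed.

Lemma eval_scalar_is_monoid_morphism u : monoid_morphism (eval_scalar u).
Proof.
split=> [|p q]; first by rewrite /eval_scalar hornerC.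
by rewrite /eval_scalar hornerM_comm //; apply: comm_poly_scalar.
Qed.

HB.instance Definition _ u := GRing.isZmodMorphism.Build {poly R} R (eval_scalar u)
  (eval_scalar_is_zmod_morphism u).
HB.instance Definition _ u := GRing.isMonoidMorphism.Build {poly R} R (eval_scalar u)
  (eval_scalar_is_monoid_morphism u).

Lemma eval_scalar_polyA u d : eval_scalar u (polyA R d) = d.[u]%:A.
Proof. by rewrite /eval_scalar /polyA -[u%:A]/(in_alg R u) horner_map. Qed.

Definition eval2 u v : {rmorphism {poly {poly R}} -> R} :=
  eval_scalar u \o map_poly (eval_scalar v).

Lemma eval2_eq0 s (W : {poly {poly R}}) :
  (forall u v, u \notin s -> v \notin s -> u != v -> eval2 u v W = 0) -> W = 0.
Proof.
move=> W0; apply/polyP => i; rewrite coef0.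
apply: (@scalar_roots_eq0 s) => v vs.
have : map_poly (eval_scalar v) W = 0.
  (* The values are known only off the diagonal, so [v] joins the excluded points. *)
  by apply: (@scalar_roots_eq0 (v :: s)) => u; rewrite inE negb_or => /andP[uv us]; apply: W0.
by move=> /(congr1 (fun p : {poly R} => p`_i)); rewrite coef_map coef0.
Qed.

End ScalarEvaluation.

Section ExpansionAtInfinity.
Variables (F : numClosedFieldType) (R : algType F).
Local Notation E := (laurent at_infinity R).
Implicit Types (p q : {poly R}) (d : {poly F}) (g : E).

Lemma lconst_lvar_commr : commr_rmorph (@lconst at_infinity R) lvar.
Proof. by move=> r; apply: lvar_comm. Qed.

Definition pol : {poly R} -> E := horner_morph lconst_lvar_commr.

HB.instance Definition _ := GRing.RMorphism.copy pol (horner_morph lconst_lvar_commr).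

Lemma polC r : pol r%:P = lconst r.
Proof. exact: horner_morphC. Qed.

Lemma polX : pol 'X = lvar.
Proof. exact: horner_morphX. Qed.

Lemma pol_coef p (m : int) : pol p m = if m is Posz k then p`_k else 0.
Proof.
elim/poly_ind: p m => [|p c IHp] m; first by rewrite rmorph0; case: m => // k; rewrite coef0.
have -> : pol (p * 'X + c%:P) = pol p * lvar + lconst c by rewrite rmorphD rmorphM /= polC polX.
rewrite lcoefD lvarMr IHp.
case: m => [[|k]|k].
- by rewrite coefD coefMX coefC /= mulr1n.
- rewrite (_ : Posz k.+1 - 1 = Posz k); last by lia.
  by rewrite coefD coefMX coefC /= mulr0n.
- rewrite (_ : Negz k - 1 = Negz k.+1); last by lia.
  by rewrite /= mulr0n addr0.
Qed.

Lemma der_pol p : der (pol p) = pol p^`().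
Proof.
elim/poly_ind: p => [|p c IHp]; first by rewrite deriv0 !rmorph0 der0.
rewrite derivD derivM derivX derivC addr0 mulr1 !rmorphD !rmorphM /= polC polX derD derM.
by rewrite der_lconst der_lvar addr0 mulr1 IHp.
Qed.

Lemma pol_polyA_commute g d : series_commute g (pol (polyA R d)).
Proof.
apply/series_commuteP => a b; rewrite pol_coef; case: b => [k|k]; last exact: commr0.
by rewrite coef_map /= /GRing.comm mulr_algl mulr_algr.
Qed.

Lemma pol_polyA_comm g d : pol (polyA R d) * g = g * pol (polyA R d).
Proof. exact/esym/series_commute_comm/pol_polyA_commute. Qed.

(** The denominator splits into linear factors over the closed field, each inverted by a geometric
    series, or by a power of the variable when the root is 0. *)
Lemma pol_polyA_unit d : d != 0 -> exists s : E, pol (polyA R d) * s = 1 /\ s * pol (polyA R d) = 1.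
Proof.
move=> d0; have [r dr] := closed_field_poly_normal d.
have unitM d1 d2 : (exists s : E, pol (polyA R d1) * s = 1 /\ s * pol (polyA R d1) = 1) ->
    (exists s : E, pol (polyA R d2) * s = 1 /\ s * pol (polyA R d2) = 1) ->
    exists s : E, pol (polyA R (d1 * d2)) * s = 1 /\ s * pol (polyA R (d1 * d2)) = 1.
  move=> [s1 [h1 h1']] [s2 [h2 h2']]; exists (s2 * s1).
  rewrite !(rmorphM (polyA R)) !(rmorphM pol); split.
    by rewrite -mulrA (mulrA _ s2) h2 mul1r.
  by rewrite -mulrA (mulrA s1) h1' mul1r.
have unitC (a : F) : a != 0 ->
    exists s : E, pol (polyA R a%:P) * s = 1 /\ s * pol (polyA R a%:P) = 1.
  move=> a0; exists (pol (polyA R a^-1%:P)).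
  by rewrite -!rmorphM mulfV // mulVf // !rmorph1.
rewrite dr -mul_polyC; apply: (unitM); first by apply: unitC; rewrite lead_coef_eq0.
elim: r {dr} => [|a r IHr]; first by rewrite big_nil; exists 1; rewrite !rmorph1 mulr1.
rewrite big_cons; apply: (unitM) => //.
have -> : pol (polyA R ('X - a%:P)) = lvar - lconst a%:A.
  by rewrite !rmorphB /= /polyA map_polyX map_polyC polX polC.
have [->|a0] := eqVneq a 0; first by rewrite scale0r rmorph0 subr0; apply: lvar_unit.
apply: (@lvar_subC_unit _ _ _ a^-1%:A).
  by rewrite mulr_algl scalerA mulfV // scale1r.
by rewrite mulr_algl scalerA mulVf // scale1r.
Qed.

Lemma pol_polyA_inj d g1 g2 : d != 0 -> pol (polyA R d) * g1 = pol (polyA R d) * g2 -> g1 = g2.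
Proof.
move=> /pol_polyA_unit [s [_ sd]] /(congr1 ( *%R s)).
by rewrite !mulrA sd !mul1r.
Qed.

(** Picks a series whose product with a denominator is the numerator. Denominators being invertible,
    it exists and is unique, so the default 0 is never chosen for want of a solution. *)
Definition expand (f : ratfun R) : E :=
  xget 0 [set g : E | exists2 x : Defs.ratio R, f = \pi_(ratfun R) x
                      & pol (polyA R (ratnd x).2) * g = pol (ratnd x).1].

Lemma expandE (x : Defs.ratio R) :
  pol (polyA R (ratnd x).2) * expand (\pi_(ratfun R) x) = pol (ratnd x).1.
Proof.
have [s [ds _]] := pol_polyA_unit (den_neq0 x).
have [y /ratfunE xy dy] : exists2 y : Defs.ratio R, \pi_(ratfun R) x = \pi_(ratfun R) y
    & pol (polyA R (ratnd y).2) * expand (\pi_(ratfun R) x) = pol (ratnd y).1.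
  have ex : exists g : E, exists2 y : Defs.ratio R, \pi_(ratfun R) x = \pi_(ratfun R) y
      & pol (polyA R (ratnd y).2) * g = pol (ratnd y).1.
    by exists (s * pol (ratnd x).1), x => //; rewrite mulrA ds mul1r.
  exact: (xgetPex 0 ex).
apply: (pol_polyA_inj (den_neq0 y)).
by rewrite mulrA pol_polyA_comm -mulrA dy -!rmorphM xy.
Qed.

Lemma expand_pi (x : Defs.ratio R) g : pol (polyA R (ratnd x).2) * g = pol (ratnd x).1 ->
  expand (\pi_(ratfun R) x) = g.
Proof. by move=> xg; apply: (pol_polyA_inj (den_neq0 x)); rewrite expandE xg. Qed.

Lemma expand_is_zmod_morphism : zmod_morphism expand.
Proof.
elim/quotW=> x; elim/quotW=> y.
have -> : \pi_(ratfun R) x - \pi_(ratfun R) y = \pi_(ratfun R) (rat_add x (rat_opp y)).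
  by rewrite [in LHS]/GRing.add /= [in LHS]/GRing.opp /= !piE.
apply: expand_pi => /=; rewrite mulrN rmorphB !(rmorphM pol) (rmorphM (polyA R)) (rmorphM pol) /=.
rewrite -!expandE mulrBr; congr (_ - _); last exact/esym/mulrA.
by rewrite (pol_polyA_comm (pol (polyA R (ratnd y).2))); apply/esym/mulrA.
Qed.

Lemma expand_is_monoid_morphism : monoid_morphism expand.
Proof.
split=> [|f g].
  by apply: expand_pi => /=; rewrite !rmorph1 mulr1.
elim/quotW: f => x; elim/quotW: g => y.
have -> : \pi_(ratfun R) x * \pi_(ratfun R) y = \pi_(ratfun R) (rat_mul x y).
  by rewrite [in LHS]/GRing.mul /= !piE.
apply: expand_pi => /=; rewrite (rmorphM (polyA R)) !(rmorphM pol) /= -!expandE.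
rewrite -!mulrA; congr (_ * _).
by rewrite !mulrA pol_polyA_comm.
Qed.

HB.instance Definition _ := GRing.isZmodMorphism.Build (ratfun R) E expand
  expand_is_zmod_morphism.
HB.instance Definition _ := GRing.isMonoidMorphism.Build (ratfun R) E expand
  expand_is_monoid_morphism.

Lemma der_expand f : der (expand f) = expand (der f).
Proof.
elim/quotW: f => x; apply/esym.
have -> : der (\pi_(ratfun R) x) = \pi_(ratfun R) (rat_der x).
  by rewrite [LHS]/der /= !piE.
apply: expand_pi => /=; rewrite rmorphB (rmorphM (polyA R)) !(rmorphM pol) /=.
have := congr1 (@der _) (expandE x); rewrite derM !der_pol polyA_deriv => dx.
rewrite -dx -[X in _ - _ * X]expandE mulrDr -!mulrA.
rewrite [X in X + _ - _](_ : _ = pol (polyA R (ratnd x).2^`())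
    * (pol (polyA R (ratnd x).2) * expand (\pi_(ratfun R) x))).
  by rewrite addrAC subrr add0r.
by rewrite (mulrA (pol (polyA R (ratnd x).2))) pol_polyA_comm -mulrA.
Qed.

Lemma has_value_expand f u r : has_value f u r ->
  exists p d, [/\ pol (polyA R d) * expand f = pol p & r = d.[u]^-1 *: p.[u%:A]].
Proof.
move=> [p [d [d0 [-> _ ->]]]]; exists p, d; split=> //.
exact: (expandE (@Defs.Ratio _ _ (p, d) d0)).
Qed.

(** Denominators have scalar coefficients, so multiplying by them preserves commutation and reduces
    it to the coefficients of the numerators, which determine the values. *)
Lemma commute_expand (f g : ratfun R) :
  series_commute (expand f) (expand g) -> rational_commute f g.
Proof.
move=> fg u v r1 r2 /has_value_expand[p [d [pE ->]]] /has_value_expand[q [c [qE ->]]].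
have fq : series_commute (expand f) (pol q).
  by rewrite -qE; apply: series_commuteM => //; apply: pol_polyA_commute.
have /series_commuteP qp : series_commute (pol q) (pol p).
  rewrite -pE; apply: series_commuteM; first exact: pol_polyA_commute.
  exact: series_commute_sym.
suff pq : GRing.comm p.[u%:A] q.[v%:A].
  by rewrite -!scalerAl -!scalerAr pq !scalerA mulrC.
rewrite (@horner_scalar_coef _ _ (size p)) // (@horner_scalar_coef _ _ (size q)) //.
apply: commr_sum => j _; apply/commr_sym/commr_sum => i _.
have := qp j i; rewrite !pol_coef => qpij.
by rewrite /GRing.comm -!scalerAl -!scalerAr qpij !scalerA mulrC.
Qed.

Lemma common_denominator n (L : 'M[ratfun R]_n) :
  exists (d : {poly F}) (d0 : d != 0) (P : 'M[{poly R}]_n),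
  forall i j, L i j = \pi_(ratfun R) (@Defs.Ratio _ _ (P i j, d) d0).
Proof.
pose x (ij : 'I_n * 'I_n) : Defs.ratio R := repr (L ij.1 ij.2).
pose d := \prod_ij (ratnd (x ij)).2.
have d0 : d != 0 by apply/prodf_neq0 => ij _; apply: den_neq0.
exists d, d0, (\matrix_(i, j)
  (polyA R (\prod_(kl | kl != (i, j)) (ratnd (x kl)).2) * (ratnd (x (i, j))).1)).
move=> i j; rewrite -[LHS]reprK; apply: ratfunP => /=; rewrite mxE polyAA.
by rewrite /d (bigD1 (i, j)).
Qed.

End ExpansionAtInfinity.

(** Here [a] and [b] are the common denominator at u and at v, and [x] is u - v. *)
Lemma cancel_denominators (S : nzRingType) (a b a' b' x y1 y2 y3 z1 z2 z3 : S) (c1 c2 : bool) :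
    (forall w, a * w = w * a) -> (forall w, b * w = w * b) -> a' * a = 1 -> b' * b = 1 ->
    x * ((a * y1) * (b * z1) - (b * z1) * (a * y1)) =
      (a * (b * z2) - b * (a * y2)) *+ c1 - (a * (b * z3) - b * (a * y3)) *+ c2 ->
  x * (y1 * z1 - z1 * y1) = (z2 - y2) *+ c1 - (z3 - y3) *+ c2.
Proof.
move=> ca cb a'a b'b h; apply: (can_inj (g := fun w => b' * (a' * w)) (f := fun w => a * (b * w))).
  by move=> w; rewrite (mulrA a') a'a mul1r mulrA b'b mul1r.
have abM w w' : a * w * (b * w') = a * (b * (w * w')).
  by rewrite -mulrA; congr (_ * _); rewrite mulrA -cb mulrA.
have baM w w' : b * w * (a * w') = a * (b * (w * w')).
  by rewrite mulrA -[b * w * a]ca -!mulrA.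
have ba w : b * (a * w) = a * (b * w) by rewrite mulrA -ca -mulrA.
have xM w : x * (a * (b * w)) = a * (b * (x * w)).
  by rewrite mulrA -ca -mulrA; congr (_ * _); rewrite mulrA -cb -mulrA.
rewrite abM baM !ba -!mulrBr xM in h; rewrite h.
by rewrite -!mulrnAr -!mulrBr.
Qed.

(** * From values to series for the Gaudin relation *)

Section RationalGaudin.
Variables (F : numClosedFieldType) (R : algType F).
Local Notation E := (laurent at_infinity R).
Implicit Types (p q : {poly R}) (d : {poly F}).

Lemma lvar_lconst_pol_commr : commr_rmorph (@lconst at_infinity E \o @pol F R) lvar.
Proof. by move=> p; apply: lvar_comm. Qed.

(** The outer polynomial variable is u; the coefficients are polynomials in v. *)
Definition pol2 : {poly {poly R}} -> laurent at_infinity E := horner_morph lvar_lconst_pol_commr.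

HB.instance Definition _ := GRing.RMorphism.copy pol2 (horner_morph lvar_lconst_pol_commr).

Lemma pol2C p : pol2 p%:P = lconst (pol p).
Proof. exact: horner_morphC. Qed.

Lemma pol2X : pol2 'X = lvar.
Proof. exact: horner_morphX. Qed.

Lemma pol2Y p : pol2 (map_poly polyC p) = lmap (@lconst at_infinity R) (pol p).
Proof.
elim/poly_ind: p => [|p c IHp]; first by rewrite !rmorph0.
have -> : map_poly polyC (p * 'X + c%:P) = map_poly polyC p * 'X + c%:P%:P.
  by rewrite rmorphD rmorphM /= map_polyX map_polyC.
have -> : pol (p * 'X + c%:P) = pol p * lvar + lconst c by rewrite rmorphD rmorphM /= polC polX.
rewrite [LHS]rmorphD [X in X + _]rmorphM /= IHp pol2X pol2C polC.
rewrite [RHS]rmorphD [X in _ = X + _]rmorphM; congr (_ * _ + _); apply: laurentP => m /=.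
  by rewrite rmorphMn rmorph1.
by rewrite rmorphMn.
Qed.

Lemma pol2_uv : pol2 ('X - 'X%:P) = uv at_infinity R.
Proof. by rewrite rmorphB /= pol2X pol2C polX. Qed.

Lemma eval2Y u v p : eval2 R u v (map_poly polyC p) = p.[u%:A].
Proof.
rewrite /eval2 /= (_ : map_poly _ _ = p) //; apply/polyP => i.
by rewrite !coef_map; apply: hornerC.
Qed.

Lemma eval2Z u v p : eval2 R u v p%:P = p.[v%:A].
Proof. by rewrite /eval2 /= map_polyC /= /eval_scalar hornerC. Qed.

Lemma eval2_sub u v : eval2 R u v ('X - 'X%:P) = (u - v)%:A.
Proof.
by rewrite rmorphB eval2Z hornerX /eval2 /= map_polyX /eval_scalar hornerX scalerBl.
Qed.

Lemma pol2_central d (w : laurent at_infinity E) :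
  pol2 (map_poly polyC (polyA R d)) * w = w * pol2 (map_poly polyC (polyA R d)) /\
  pol2 (polyA R d)%:P * w = w * pol2 (polyA R d)%:P.
Proof.
rewrite pol2Y pol2C; split; last first.
  by apply: laurentP => m; rewrite lconstMl lconstMr pol_polyA_comm.
apply/esym/series_commute_comm/series_commuteP => a b.
rewrite -[lmap _ _ b]/(lconst (pol (polyA R d) b)); apply: laurentP => m.
rewrite lconstMl lconstMr pol_coef; case: b => [k|k].
  by rewrite coef_map /= mulr_algl mulr_algr.
by rewrite mul0r mulr0.
Qed.

(** The hypothesis concerns values at distinct points away from the poles. Cleared of denominators
    it is an identity of polynomials in u and v, which these values determine; it is then mapped to
    series, where the denominators are invertible again. *)
Theorem rational_gaudin_expand n (L : 'M[ratfun R]_n) :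
  rational_gaudin L -> series_gaudin (map_mx (@expand F R) L).
Proof.
move=> gL; have [d [d0 [P LP]]] := common_denominator L.
have [r dr] := closed_field_poly_normal d.
have dN0 u : u \notin r -> d.[u] != 0.
  by rewrite dr hornerZ mulf_eq0 lead_coef_eq0 (negPf d0) -root_prod_XsubC.
pose Y p : {poly {poly R}} := map_poly polyC p; pose Z p : {poly {poly R}} := p%:P.
pose dl := polyA R d.
have W0 i j k l : ('X - 'X%:P) * (Y (P i j) * Z (P k l) - Z (P k l) * Y (P i j)) =
    (Y dl * Z (P i l) - Z dl * Y (P i l)) *+ (j == k)
    - (Y dl * Z (P k j) - Z dl * Y (P k j)) *+ (l == i).
  apply/eqP; rewrite -subr_eq0; apply/eqP/(@eval2_eq0 _ _ r) => u v /dN0 du /dN0 dv uv.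
  pose Lu := \matrix_(i, j) (d.[u]^-1 *: (P i j).[u%:A]).
  pose Lv := \matrix_(i, j) (d.[v]^-1 *: (P i j).[v%:A]).
  have Lval w : d.[w] != 0 -> mx_value L w (\matrix_(i, j) (d.[w]^-1 *: (P i j).[w%:A])).
    by move=> dw a b; exists (P a b), d, d0; rewrite mxE.
  have Pu a b : (P a b).[u%:A] = d.[u] *: Lu a b by rewrite mxE scalerA mulfV // scale1r.
  have Pv a b : (P a b).[v%:A] = d.[v] *: Lv a b by rewrite mxE scalerA mulfV // scale1r.
  have := gL u v Lu Lv uv (Lval u du) (Lval v dv) i j k l => g.
  apply/eqP; rewrite rmorphB subr_eq0; apply/eqP.
  rewrite rmorphM eval2_sub !rmorphB !rmorphMn !rmorphB !rmorphM /Y /Z !eval2Y !eval2Z !Pu !Pv.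
  have w0 : u - v != 0 by rewrite subr_eq0.
  have dlE w : dl.[w%:A] = d.[w]%:A := eval_scalar_polyA R w d.
  have sM a b (y z : R) : a *: y * (b *: z) = (a * b) *: (y * z).
    by rewrite -scalerAl -scalerAr scalerA.
  rewrite !dlE !mulr_algl !sM !scalerA [d.[v] * d.[u]]mulrC -!scalerBr !scalerMnr -!scalerBr.
  rewrite g !scalerA mulrAC mulfV // mul1r; congr (_ *: _).
  by rewrite !mulrnBl opprD opprK !addrA.
apply/series_gaudinE => i j k l; rewrite !mxE.
have := congr1 pol2 (W0 i j k l).
have [a' [_ a'a]] : exists s, pol2 (Y dl) * s = 1 /\ s * pol2 (Y dl) = 1.
  have [s [h1 h2]] := pol_polyA_unit R d0; exists (lmap (@lconst at_infinity R) s).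
  by rewrite pol2Y -!rmorphM h1 h2 rmorph1.
have [b' [_ b'b]] : exists s, pol2 (Z dl) * s = 1 /\ s * pol2 (Z dl) = 1.
  have [s [h1 h2]] := pol_polyA_unit R d0; exists (lconst s).
  by rewrite pol2C -!rmorphM h1 h2 rmorph1.
have PE a b : pol (P a b) = pol dl * expand (L a b).
  by rewrite LP -(expandE (@Defs.Ratio _ _ (P a b, d) d0)).
have YE a b : pol2 (Y (P a b)) = pol2 (Y dl) * lmap (@lconst at_infinity R) (expand (L a b)).
  by rewrite !pol2Y PE rmorphM.
have ZE a b : pol2 (Z (P a b)) = pol2 (Z dl) * lconst (expand (L a b)).
  by rewrite !pol2C PE rmorphM.
rewrite rmorphM /= pol2_uv !rmorphB !rmorphMn !rmorphB !rmorphM => h.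
apply: (cancel_denominators (fun w => (pol2_central d w).1)
  (fun w => (pol2_central d w).2) a'a b'b).
by rewrite -!ZE -!YE.
Qed.

End RationalGaudin.

Lemma fact_torsion_free (F : numFieldType) (R : lmodType F) n (r : R) : r *+ n`! = 0 -> r = 0.
Proof.
rewrite -scaler_nat => h; apply: (scalerI (a := (n`!)%:R)); last by rewrite scaler0.
by rewrite pnatr_eq0 -lt0n fact_gt0.
Qed.

Theorem theorem5 (K : realType) (R : algType K[i]) (n : nat) :
  (forall (e : expansion) (L : 'M[laurent e R]_n),
     series_gaudin L ->
     forall k l : nat, (1 <= k <= n)%N -> (1 <= l <= n)%N ->
       series_commute (QH L k) (\tr (qpow L l)) /\
       series_commute (\tr (qpow L k)) (\tr (qpow L l)))
  /\
  (forall L : 'M[ratfun R]_n,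
     rational_gaudin L ->
     forall k l : nat, (1 <= k <= n)%N -> (1 <= l <= n)%N ->
       rational_commute (QH L k) (\tr (qpow L l)) /\
       rational_commute (\tr (qpow L k)) (\tr (qpow L l))).
Proof.
have torsion (r : R) : r *+ n`! = 0 -> r = 0 by apply: fact_torsion_free.
split=> [e L gL k l /andP[_ kn] /andP[_ ln]|L gL k l /andP[_ kn] /andP[_ ln]].
  exact: series_traces_commute.
have gE := rational_gaudin_expand gL.
(* Compatibility with [der] lets [expand] pass through [QH] and [qpow]. *)
have derE f : der (expand (R := R) f) = expand (der f) by apply: der_expand.
have trE m : \tr (qpow (map_mx (@expand _ R) L) m) = expand (\tr (qpow L m)).
  rewrite (qpow_map derE) /mxtrace rmorph_sum; apply: eq_bigr => i _; exact: mxE.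
have [] := series_traces_commute gE torsion kn ln; rewrite (QH_map derE) !trE => h1 h2.
by split; apply: commute_expand.
Qed.
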